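(* Let $k$ be an algebraically closed field and let $P\subset\mathbb{R}^2$ be a lattice polygon, i.e. a lattice polytope with $\dim P=2$. Any codimension $1$ retraction $h:k[P]\to k[P]$ is based and, therefore, at least one of the following holds: (i) $h^{\tau}=\iota\circ\rho_{(P,H,w)}$ for some lattice segmental fibration $(P,H,w)$, some $\tau\in\mathbb{T}_k(P)$ and some graded $k$-algebra embedding $\iota:k[H\cap P]\to k[P]$; (ii) $h^{\epsilon}=\iota\circ\pi_F$ for some facet (edge) $F\subset P$, some $\epsilon\in\mathbb{E}_k(P)$ and some graded $k$-algebra embedding $\iota:k[F]\to k[P]$. In particular, $h$ is tame.
   Context: A lattice polytope $P\subset\mathbb{R}^n$ is the convex hull of a finite set of points of $\mathbb{Z}^n$. Put $L_P=P\cap\mathbb{Z}^n$, and let $S_P\subset\mathbb{Z}^{n+1}$ be the sub-semigroup (with $0$) generated by $\{(x,1)\mid x\in L_P\}$; $\mathrm{gp}(S_P)$ is its group of differences. The algebra $k[P]:=k[S_P]$ is the semigroup algebra of $S_P$, graded by the last coordinate; $x\in L_P$ is identified with the degree $1$ element $(x,1)$. If $Q\subset P$ is a lattice subpolytope, $k[Q]$ is regarded as the subalgebra of $k[P]$ generated by $L_Q\subset L_P$, and $S_Q\subset S_P$. A retraction $h:k[P]\to k[P]$ is an idempotent homogeneous $k$-algebra endomorphism; $\mathrm{codim}(h)=\dim k[P]-\dim \mathrm{Im}(h)$ (Krull dimensions). With $A=\mathrm{Im}(h)$, a base of $h$ is a $(\dim A-1)$-dimensional cross section $Q=P\cap H$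 of $P$ by an affine subspace $H$ such that $Q$ is a lattice polytope and $h|_{k[Q]}:k[Q]\to A$ is an isomorphism. The retraction $h$ is based if it has a base. $\Gamma_k(P)$ is the group of graded $k$-algebra automorphisms of $k[P]$; $\mathbb{T}_k(P)\subset\Gamma_k(P)$ is the torus of those automorphisms that multiply each monomial (element of $S_P$) by a scalar from $k^*$. For $\alpha\in\Gamma_k(P)$, $h^\alpha:=\alpha\circ h\circ\alpha^{-1}$. A nonzero $v\in\mathbb{Z}^n$ is a column vector of $P$ with base facet $F$ if $F$ is a facet of $P$ and $x+v\in P$ for every lattice point $x\in P\setminus F$. For such $v$ (identified with $(v,0)\in\mathrm{gp}(S_P)$) and $x\in S_P$, let $\mathrm{ht}_v(x)$ be the largest integer $m\ge0$ with $x+mv\in S_P$ (for $x\in S_F$ put $\mathrm{ht}_v(x)=0$). For $\lambda\in k$ the assignment $x\mapsto(1+\lambda v)^{\mathrm{ht}_v(x)}x$, $x\in S_P$ (computed in $k[\mathrm{gp}(S_P)]$, with the semigroup written multiplicatively), defines $e_v^\lambda\in\Gamma_k(P)$, called an elementary automorphism. $\mathbb{E}_k(P)$ is the subgroup of $\Gamma_k(P)$ generated by all elementary automorphisms. For a facet $F$ of $P$, $\pi_F:k[P]\to k[F]$ is the homomorphism which is the identity on $L_F$ and sends $L_P\setminus L_F$ to $0$. A lattice segmental fibration $(P,H,w)$ with $\dim P=n$ consists of $P$, an affine hyperplane $H\subset\mathbb{R}^n$ and a nonzero vector $w\in\mathbb{R}^n$ such that $L_P\subset\bigcup_{x\in L_P\cap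 H}(x+\mathbb{R}w)$. Then $P\cap H$ is a lattice polytope of dimension $n-1$, and $\rho_{(P,H,w)}:k[P]\to k[P\cap H]$ denotes the homomorphism sending each $x\in L_P$ to the unique point of $(x+\mathbb{R}w)\cap H$, which lies in $L_{P\cap H}$. A codimension $1$ retraction $f:k[P]\to k[P]$ is called tame if there is $\alpha\in\Gamma_k(P)$ such that $f^\alpha=\iota\circ g$, where $g$ is either $\pi_F$ for a facet $F$ of $P$ or $\rho_{(P,H,w)}$ for a lattice segmental fibration $(P,H,w)$, and $\iota:\mathrm{Im}(g)\to k[P]$ is a graded $k$-algebra embedding. *)

(* Defs.v *)
From HB Require Import structures.
From mathcomp Require Import all_boot all_order all_algebra.
From mathcomp Require Import finmap monalg.
From mathcomp Require Import boolp classical_sets functions reals.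

Set Implicit Arguments.
Unset Strict Implicit.
Unset Printing Implicit Defensive.

Import GRing.Theory.
Local Open Scope ring_scope.
Local Open Scope classical_set_scope.

(* The group algebra k[G] of an additively written abelian group G: finitely
   supported functions G -> k with the convolution product. The ring structure
   of [monalg] is not available here, since [monomType] excludes nontrivial
   units among the monomials; only its k-module structure is reused. *)
Definition grpalg (k : fieldType) (G : zmodType) := {malg k[G]}.

HB.instance Definition _ (k : fieldType) (G : zmodType) :=
  Choice.on (grpalg k G).
HB.instance Definition _ (k : fieldType) (G : zmodType) :=
  GRing.Lmodule.on (grpalg k G).

Section GroupAlgebra.
Context (k : fieldType) (G : zmodType).
Implicit Types (f g : grpalg k G) (c : k) (x y : G).

Definition gmon x : grpalg k G := << x >>.

Definition gmul f g : grpalg k G :=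
  \sum_(x <- msupp f) \sum_(y <- msupp g) << f@_x * g@_y *g (x + y) >>.

Lemma gmulw (d1 d2 : {fset G}) f g :
  (msupp f `<=` d1)%fset -> (msupp g `<=` d2)%fset ->
  gmul f g = \sum_(x <- d1) \sum_(y <- d2) << f@_x * g@_y *g (x + y) >>.
Proof.
move=> le1 le2; rewrite /gmul (big_fset_incl _ le1) /=; last first.
  move=> x _ /mcoeff_outdom fx.
  by rewrite big1 // => y _; rewrite fx mul0r monalgU0.
apply/eq_bigr => x _; apply/big_fset_incl => // y _ /mcoeff_outdom ->.
by rewrite mulr0 monalgU0.
Qed.

Lemma gmulUU c1 c2 x y :
  gmul << c1 *g x >> << c2 *g y >> = << c1 * c2 *g (x + y) >>.
Proof. by rewrite (gmulw msuppU_le msuppU_le) !big_seq_fset1 !mcoeffUU. Qed.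

Lemma gmulDl : left_distributive gmul +%R.
Proof.
move=> f1 f2 g; rewrite (gmulw (msuppD_le _ _) (fsubset_refl _)).
rewrite (gmulw (fsubsetUl _ (msupp f2)) (fsubset_refl _)).
rewrite (gmulw (fsubsetUr (msupp f1) _) (fsubset_refl _)).
rewrite -big_split; apply/eq_bigr => x _; rewrite -big_split.
by apply/eq_bigr => y _; rewrite mcoeffD mulrDl monalgUD.
Qed.

Lemma gmulC : commutative gmul.
Proof.
move=> f g; rewrite /gmul exchange_big; apply/eq_bigr => x _.
by apply/eq_bigr => y _; rewrite mulrC addrC.
Qed.

Lemma gmulDr : right_distributive gmul +%R.
Proof. by move=> f g1 g2; rewrite ![gmul f _]gmulC gmulDl. Qed.

Lemma gmul0l : left_zero 0 gmul.
Proof. by move=> f; rewrite /gmul msupp0 big_seq_fset0. Qed.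

Lemma gmul0r : right_zero 0 gmul.
Proof. by move=> f; rewrite gmulC gmul0l. Qed.

Lemma gmul_suml I (r : seq I) (F : I -> grpalg k G) g :
  gmul (\sum_(i <- r) F i) g = \sum_(i <- r) gmul (F i) g.
Proof. by apply: (big_morph (gmul^~ g)) => [? ?|]; rewrite ?gmulDl ?gmul0l. Qed.

Lemma gmul_sumr I (r : seq I) (F : I -> grpalg k G) g :
  gmul g (\sum_(i <- r) F i) = \sum_(i <- r) gmul g (F i).
Proof. by apply: (big_morph (gmul g)) => [? ?|]; rewrite ?gmulDr ?gmul0r. Qed.

Lemma gmulA : associative gmul.
Proof.
move=> f g h; rewrite (monalgE f) (gmul_suml _ _ (gmul g h)).
rewrite (gmul_suml _ _ g) (gmul_suml _ _ h); apply/eq_bigr => x _.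
rewrite (monalgE g) (gmul_suml _ _ h) !(gmul_sumr _ _ << f@_x *g x >>).
rewrite (gmul_suml _ _ h); apply/eq_bigr => y _.
rewrite gmulUU (monalgE h) (gmul_sumr _ _ << g@_y *g y >>).
rewrite (gmul_sumr _ _ << f@_x *g x >>) gmul_sumr; apply/eq_bigr => z _.
by rewrite !gmulUU mulrA addrA.
Qed.

Lemma gmul1 : left_id (gmon 0) gmul.
Proof.
move=> f; rewrite [in RHS](monalgE f) [f in LHS]monalgE gmul_sumr.
by apply/eq_bigr => x _; rewrite gmulUU mul1r add0r.
Qed.

Lemma gmon0_neq0 : gmon 0 != 0 :> grpalg k G.
Proof. by rewrite monalgU_eq0 oner_eq0. Qed.

HB.instance Definition _ := GRing.Zmodule_isComNzRing.Build (grpalg k G)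
  gmulA gmulC gmul1 gmulDl gmon0_neq0.

Lemma gmulE f g : f * g = gmul f g. Proof. by []. Qed.

Lemma grpalg_scaleAl c f g : c *: (f * g) = (c *: f) * g.
Proof.
apply/malgP => z; rewrite mcoeffZ !gmulE (gmulw (msuppZ_le c f) (fsubset_refl _)).
move: (c *: f) (mcoeffZ c f) => cf cfE; rewrite /gmul !raddf_sum mulr_sumr; apply/eq_bigr => x _.
rewrite !raddf_sum mulr_sumr; apply/eq_bigr => y _.
by rewrite /= !mcoeffU cfE mulrnAr mulrA.
Qed.

HB.instance Definition _ := GRing.Lmodule_isLalgebra.Build k (grpalg k G)
  grpalg_scaleAl.
HB.instance Definition _ := GRing.Lalgebra_isComAlgebra.Build k (grpalg k G).

End GroupAlgebra.

Section Polytopes.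
Context (R : realType) (n : nat).
Implicit Types (P F X H : set 'rV[R]_n) (x p : 'rV[R]_n).

Definition pt (z : 'rV[int]_n) : 'rV[R]_n := map_mx intr z.

Definition conv_hull (s : seq 'rV[R]_n) : set 'rV[R]_n :=
  [set x | exists c : 'I_(size s) -> R,
    [/\ forall i, 0 <= c i, \sum_i c i = 1 & x = \sum_i c i *: s`_i]].

Definition lattice_polytope P :=
  exists s : seq 'rV[int]_n, P = conv_hull (map pt s).

Definition affine_space p (U : {vspace 'rV[R]_n}) : set 'rV[R]_n :=
  [set x | x - p \in U].

(* X is nonempty and the smallest affine subspace containing X has
   dimension d. *)
Definition has_dim X (d : nat) :=
  X !=set0 /\ exists p U,
    [/\ \dim U = d, X `<=` affine_space p U &
        forall p' U', X `<=` affine_space p' U' ->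
          affine_space p U `<=` affine_space p' U'].

Definition face P F := exists (a : 'cV[R]_n) (b : R),
  (forall x, P x -> (x *m a) 0 0 <= b) /\
  F = P `&` [set x | (x *m a) 0 0 = b].

Definition facet P F := face P F /\ exists d, has_dim P d.+1 /\ has_dim F d.

Definition hyperplane H :=
  exists p (U : {vspace 'rV[R]_n}), (\dim U).+1 = n /\ H = affine_space p U.

Definition latpts P : set 'rV[int]_n := [set z | P (pt z)].

Definition semigrp P : set ('rV[int]_n * int) :=
  [set x | exists2 s : seq 'rV[int]_n,
    (forall z, z \in s -> latpts P z) & x = \sum_(z <- s) (z, 1)].

Definition segmental_fibration P H (w : 'rV[R]_n) :=
  [/\ lattice_polytope P, has_dim P n, hyperplane H, w != 0 &
      forall z, latpts P z -> exists z0, [/\ latpts P z0, H (pt z0) &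
        exists t : R, pt z = pt z0 + t *: w]].

Definition column_vector P F (v : 'rV[int]_n) :=
  [/\ v != 0, facet P F & forall z, latpts P z -> ~ F (pt z) -> P (pt (z + v))].

Definition ht P F (v : 'rV[int]_n) (u : 'rV[int]_n * int) : nat :=
  if `[< semigrp F u >] then 0%N else
  xget 0%N [set m : nat | semigrp P (u + (v, 0) *+ m) /\
    forall m' : nat, semigrp P (u + (v, 0) *+ m') -> (m' <= m)%N].

End Polytopes.

Section PolytopalAlgebra.
Context (k : fieldType) (R : realType) (n : nat).
Implicit Types (P Q : set 'rV[R]_n).

Local Notation ambient := (grpalg k ('rV[int]_n * int)%type).

Definition kalg_pred P : {pred ambient} :=
  fun f => `[< forall x, f@_x != 0 -> semigrp P x >].

Lemma semigrp0 P : semigrp P 0.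
Proof. by exists [::]; rewrite ?big_nil. Qed.

Lemma semigrpD P x y : semigrp P x -> semigrp P y -> semigrp P (x + y).
Proof.
move=> [s sP ->] [t tP ->]; exists (s ++ t); last by rewrite big_cat.
by move=> z; rewrite mem_cat => /orP[/sP|/tP].
Qed.

Lemma kalg_subalg_closed P : GRing.subalg_closed (kalg_pred P).
Proof.
split.
- apply/asboolP => x; rewrite -[1]/(gmon k 0) mcoeffU.
  have [<- _|_] := eqVneq 0 x; first exact: semigrp0.
  by rewrite mulr0n eqxx.
- move=> c f g /asboolP fP /asboolP gP; apply/asboolP => x.
  rewrite mcoeffD mcoeffZ; have [f0|/fP//] := eqVneq f@_x 0.
  by rewrite f0 mulr0 add0r => /gP.
- move=> f g /asboolP fP /asboolP gP; apply/asboolP => z.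
  apply: contra_neqP => nz; rewrite gmulE /gmul raddf_sum big1_seq // => x.
  move=> /andP[_ xf]; rewrite raddf_sum big1_seq // => y /andP[_ yg] /=.
  rewrite mcoeffU; case: eqP => [xyz|_]; last by rewrite mulr0n.
  case: nz; rewrite -xyz; apply: semigrpD; first by apply: fP; rewrite mcoeff_neq0.
  by apply: gP; rewrite mcoeff_neq0.
Qed.

HB.instance Definition _ P := GRing.isSubalgClosed.Build k ambient
  (kalg_pred P) (kalg_subalg_closed P).

(* k[P], as the subalgebra of k[Z^n x Z] spanned by the elements of S_P. *)
Record kalg P := KAlg { kval : ambient; _ : kval \in kalg_pred P }.

HB.instance Definition _ P := [isSub for @kval P].
HB.instance Definition _ P := [Choice of kalg P by <:].
HB.instance Definition _ P := [SubChoice_isSubAlgebra of kalg P by <:].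
HB.instance Definition _ P := [SubNzRing_isSubComNzRing of kalg P by <:].
End PolytopalAlgebra.

Definition prime_ideal (A : comNzRingType) (I : {pred A}) :=
  idealr_closed I /\ prime_idealr_closed I.

Definition prime_chain (A : comNzRingType) (d : nat) :=
  exists c : nat -> {pred A},
    (forall i, (i <= d)%N -> prime_ideal (c i)) /\
    (forall i, (i < d)%N ->
      {subset c i <= c i.+1} /\ exists2 a, a \in c i.+1 & a \notin c i).

Definition krull_dim (A : comNzRingType) (d : nat) :=
  prime_chain A d /\ forall e, prime_chain A e -> (e <= d)%N.

Section ImageRing.
Context (A B : comNzRingType) (h : {rmorphism A -> B}).

Definition im_pred : {pred B} := fun b => `[< exists a, h a = b >].

Lemma im_subring_closed : GRing.subring_closed im_pred.
Proof.
split; first by apply/asboolP; exists 1; rewrite rmorph1.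
- move=> _ _ /asboolP[a <-] /asboolP[b <-]; apply/asboolP.
  by exists (a - b); rewrite rmorphB.
- move=> _ _ /asboolP[a <-] /asboolP[b <-]; apply/asboolP.
  by exists (a * b); rewrite rmorphM.
Qed.

HB.instance Definition _ := GRing.isSubringClosed.Build B im_pred
  im_subring_closed.

Record im_ring := ImRing { im_val : B; _ : im_val \in im_pred }.

HB.instance Definition _ := [isSub for im_val].
HB.instance Definition _ := [Choice of im_ring by <:].
HB.instance Definition _ := [SubChoice_isSubComNzRing of im_ring by <:].
End ImageRing.

Section Retractions.
Context (k : fieldType) (R : realType) (n : nat).
Implicit Types (P Q F H : set 'rV[R]_n).

Local Notation "k[ P ]" := (kalg k P) (at level 0, format "k[ P ]").

(* The element u of S_P as an element of k[P] (and 0 if u is not in S_P). *)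
Definition mono P (u : 'rV[int]_n * int) : k[P] := insubd 0 (gmon k u).

Lemma kval_mono P u : semigrp P u -> kval (mono P u) = gmon k u.
Proof.
move=> uP; rewrite /mono -[LHS]/(val _) insubdK //; apply/asboolP => x.
rewrite mcoeffU; have [<- //|_] := eqVneq u x.
by rewrite mulr0n eqxx.
Qed.

Definition homog P (d : int) (f : k[P]) :=
  forall u : 'rV[int]_n * int, (kval f)@_u != 0 -> u.2 = d.

Definition graded P Q (f : k[P] -> k[Q]) :=
  forall d x, homog d x -> homog d (f x).

Definition graded_embedding P Q (f : {lrmorphism k[P] -> k[Q]}) :=
  graded f /\ injective f.

Definition retraction P (h : {lrmorphism k[P] -> k[P]}) :=
  graded h /\ forall x, h (h x) = h x.

Definition codim P (h : {lrmorphism k[P] -> k[P]}) (c : nat) :=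
  exists d e, [/\ krull_dim k[P] d, krull_dim (im_ring h) e & d = (e + c)%N].

(* k[Q] as a subalgebra of k[P], for Q a subset of P. *)
Definition subalg P Q : set k[P] := [set f | kval f \in kalg_pred Q].
Arguments subalg : clear implicits.

Definition is_base P (h : {lrmorphism k[P] -> k[P]}) Q :=
  [/\ exists d, krull_dim (im_ring h) d.+1 /\ has_dim Q d,
      exists p U, Q = P `&` affine_space p U,
      lattice_polytope Q &
      set_bij (subalg P Q) (range h) h].

Definition based P (h : {lrmorphism k[P] -> k[P]}) := exists Q, is_base h Q.

Definition Gamma P : set (k[P] -> k[P]) :=
  [set a : k[P] -> k[P] | exists f : {lrmorphism k[P] -> k[P]},
    [/\ a = f :> (k[P] -> k[P]), graded f & bijective f]].

Definition torus P : set (k[P] -> k[P]) :=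
  [set a | Gamma a /\ forall u, semigrp P u ->
    exists2 c : k, c != 0 & a (mono P u) = c *: mono P u].

(* e_v^c for a column vector v with base facet F. The product is computed in
   k[Z^n x Z], which contains k[gp(S_P)]. *)
Definition elementary P (F : set 'rV[R]_n) (v : 'rV[int]_n) (c : k) :
    set (k[P] -> k[P]) :=
  [set e | Gamma e /\ forall u, semigrp P u ->
    kval (e (mono P u)) = (1 + c *: gmon k (v, 0)) ^+ ht P F v u * gmon k u].

Inductive elem_group P : (k[P] -> k[P]) -> Prop :=
| elem_group_elementary F v c e :
    column_vector P F v -> elementary F v c e -> elem_group e
| elem_group_id : elem_group id
| elem_group_comp a b : elem_group a -> elem_group b -> elem_group (a \o b)
| elem_group_inv a b :
    elem_group a -> cancel a b -> cancel b a -> elem_group b.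

(* [conj_by a h] is h^a = a o h o a^{-1}, for bijective a. *)
Definition conj_by P (a h : k[P] -> k[P]) : k[P] -> k[P] :=
  fun y => a (h (xget 0 [set x | a x = y])).

Definition is_facet_proj P F (g : {lrmorphism k[P] -> k[F]}) :=
  forall z, latpts P z ->
    (latpts F z -> g (mono P (z, 1)) = mono F (z, 1)) /\
    (~ latpts F z -> g (mono P (z, 1)) = 0).

Definition is_fibration_proj P H (w : 'rV[R]_n)
    (g : {lrmorphism k[P] -> k[P `&` H]}) :=
  forall z z0, latpts P z -> latpts (P `&` H) z0 ->
    (exists t : R, pt R z0 = pt R z + t *: w) ->
    g (mono P (z, 1)) = mono (P `&` H) (z0, 1).

Definition factors_through_facet P (h : k[P] -> k[P]) :=
  exists F (g : {lrmorphism k[P] -> k[F]}) (iota : {lrmorphism k[F] -> k[P]}),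
    [/\ facet P F, is_facet_proj g, graded_embedding iota & h = iota \o g].

Definition factors_through_fibration P (h : k[P] -> k[P]) :=
  exists H w (g : {lrmorphism k[P] -> k[P `&` H]})
      (iota : {lrmorphism k[P `&` H] -> k[P]}),
    [/\ segmental_fibration P H w, is_fibration_proj w g,
        graded_embedding iota & h = iota \o g].

Definition tame P (h : {lrmorphism k[P] -> k[P]}) :=
  [/\ retraction h, codim h 1 & exists a, Gamma a /\
    (factors_through_facet (conj_by a h) \/
     factors_through_fibration (conj_by a h))].

End Retractions.

(* Main.v *)
(* Idea.  Put [A = Im h], so that [A] has Krull dimension 2; comparing chains of
   primes with growth shows that no three elements of [A] are algebraically
   independent, while some two images of lattice points are linearly
   independent.  Affine relations among lattice points give binomial relations
   among their images, so that images of lattice points along a line are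
   independent as soon as two consecutive ones are.

   If [h] kills a lattice point, those it does not kill lie on an edge, and [h]
   factors through the projection to that edge.  Otherwise, for a weight
   separating the lattice points, the leading exponents of the degree one part
   [A_1] lie on a line, which therefore has at least [dim A_1] lattice points in
   [P]; a suitable such line meets [P] in lattice points [x + i w], [0 <= i <= N],
   whose images form a basis of [A_1], and its section [Q] of [P] is a base.

   Let [z1] be a lattice point at lattice distance 1 from [Q] and let [q z] in
   [k[Q]] have the same image as [z].  In the group algebra the binomial
   relations express [q z], for [z] at signed distance [j], as a monomial times
   the [j]-th power of [f = q z1 / x], and comparing extreme exponents bounds the
   slopes of [P] along [Q].  If [P] lies on one side of [Q], the exponents of
   [q z1 / z1] are thus column vectors, and the product of the corresponding
   elementary automorphisms conjugates [h] into a retraction killing everything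
   off [Q].  If [P] has points on both sides, [f] is a monomial up to a scalar,
   and a torus element conjugates [h] into a map constant along the fibres of a
   segmental fibration. *)
From HB Require Import structures.
Require Import Defs.
From mathcomp Require Import all_boot all_order all_algebra.
From mathcomp Require Import finmap monalg ring lra zify.
From mathcomp Require Import boolp classical_sets functions reals.

Set Implicit Arguments.
Unset Strict Implicit.
Unset Printing Implicit Defensive.

Import Order.TTheory GRing.Theory Num.Theory.
Local Open Scope ring_scope.

(** * Group algebras and leading exponents *)

Section GroupAlgebraLead.
Context (k : fieldType) (G : zmodType).
Implicit Types (f g : grpalg k G) (x y z u v : G) (w : G -> int).

Lemma mcoeff_mul f g z :
  (f * g)@_z = \sum_(x <- msupp f) f@_x * g@_(z - x).
Proof.
rewrite gmulE /gmul raddf_sum; apply: eq_bigr => x _.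
rewrite raddf_sum /=; have [gz|gz] := boolP (z - x \in msupp g).
  rewrite (big_fsetD1 _ gz) /= mcoeffU [x + _]addrC subrK eqxx mulr1n.
  rewrite big1_fset ?addr0 // => y; rewrite in_fsetD1 => /andP[yz _] _.
  rewrite mcoeffU; case: eqP => // xyz; case/eqP: yz.
  by rewrite -xyz addrAC subrr add0r.
rewrite (mcoeff_outdom gz) mulr0 big1_fset // => y yg _.
rewrite mcoeffU; case: eqP => // xyz; case/negP: gz.
by rewrite -xyz addrAC subrr add0r.
Qed.

Lemma gmonD x y : gmon k (x + y) = gmon k x * gmon k y.
Proof. by rewrite gmulE gmulUU mulr1. Qed.

Lemma gmon0 : gmon k (0 : G) = 1. Proof. by []. Qed.

Lemma gmonMn x n : gmon k (x *+ n) = gmon k x ^+ n.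
Proof.
by elim: n => [|n IH]; rewrite ?mulr0n ?gmon0 // mulrS gmonD exprS IH.
Qed.

Lemma mcoeff_gmon x y : (gmon k x)@_y = (x == y)%:R.
Proof. exact: mcoeffU. Qed.

Lemma gmon_inj : injective (@gmon k G).
Proof.
move=> x y /(congr1 (mcoeff y)); rewrite !mcoeff_gmon eqxx.
by case: eqP => // _ /eqP; rewrite eq_sym oner_eq0.
Qed.

Lemma grpalgE f : f = \sum_(x <- msupp f) f@_x *: gmon k x.
Proof.
rewrite [LHS]monalgE; apply: eq_bigr => x _; apply/malgP => y.
by rewrite mcoeffZ !mcoeffU mulrnAr mulr1.
Qed.

Lemma grpalg_neq0P f : f != 0 -> exists x, f@_x != 0.
Proof.
move=> /eqP f0; apply: contrapT => no; apply: f0; apply/malgP => x.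
rewrite mcoeff0; apply/eqP/negP => /negP fx; apply: no; by exists x.
Qed.

Lemma mcoeff_sum (I : Type) (r : seq I) (p : pred I) (F : I -> grpalg k G) x :
  (\sum_(i <- r | p i) F i)@_x = \sum_(i <- r | p i) (F i)@_x.
Proof. by apply: (big_morph (mcoeff x)) => [f g|]; rewrite ?mcoeffD ?mcoeff0. Qed.

Lemma gcoeffZ (c : k) f x : (c *: f)@_x = c * f@_x. Proof. exact: mcoeffZ. Qed.
Lemma gcoeffD f g x : (f + g)@_x = f@_x + g@_x. Proof. exact: mcoeffD. Qed.
Lemma mcoeff_family (I : finType) (c : I -> k) (e : I -> G) j : injective e ->
  (\sum_i c i *: gmon k (e i))@_(e j) = c j.
Proof.
move=> ei; rewrite mcoeff_sum (bigD1 j) //= gcoeffZ mcoeff_gmon eqxx mulr1.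
rewrite big1 ?addr0 // => i ij; rewrite gcoeffZ mcoeff_gmon (inj_eq ei).
by rewrite (negPf ij) mulr0.
Qed.

Lemma mcoeff_family_supp (I : finType) (c : I -> k) (e : I -> G) x :
  (\sum_i c i *: gmon k (e i))@_x != 0 -> exists i, x = e i.
Proof.
move=> nz; apply: contrapT => no; case/eqP: nz.
rewrite mcoeff_sum big1 // => j _.
rewrite gcoeffZ mcoeff_gmon; case: eqP => [e'|_]; last by rewrite mulr0.
by case: no; exists j.
Qed.

Lemma gcoeff0 x : (0 : grpalg k G)@_x = 0. Proof. exact: mcoeff0. Qed.

Definition lead w f x :=
  f@_x != 0 /\ forall y, f@_y != 0 -> y != x -> w y < w x.

Definition additive_weight w := forall x y, w (x + y) = w x + w y.

Section Weight.
Context (w : G -> int) (wD : additive_weight w).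

Lemma weight0 : w 0 = 0.
Proof. by apply: (addIr (w 0)); rewrite -wD !add0r. Qed.

Lemma weightB x y : w (x - y) = w x - w y.
Proof. by apply: (addIr (w y)); rewrite -wD !subrK. Qed.

Lemma weightMn x n : w (x *+ n) = w x *+ n.
Proof. by elim: n => [|n IH]; rewrite ?mulr0n ?weight0 // !mulrS wD IH. Qed.

Lemma lead_le f x y : lead w f x -> f@_y != 0 -> w y <= w x.
Proof. by move=> [_ H] fy; have [->//|yx] := eqVneq y x; apply/ltW/H. Qed.

Lemma lead_uniq f x y : lead w f x -> lead w f y -> x = y.
Proof.
move=> [fx lx] [fy ly]; apply/eqP/negP => /negP xy.
have := lx _ fy; rewrite eq_sym => /(_ xy).
by move/(lt_trans (ly _ fx xy)); rewrite ltxx.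
Qed.

Lemma lead_mul f g x y : lead w f x -> lead w g y -> lead w (f * g) (x + y).
Proof.
move=> lf lg; have [[fx fH] [gy gH]] := (lf, lg).
have le u v : f@_u != 0 -> g@_v != 0 -> (u != x) || (v != y) ->
    w u + w v < w x + w y.
  move=> fu gv; have [-> /= vy|ux _] := eqVneq u x.
    by rewrite ltrD2l; apply: gH.
  by apply: ltr_leD; [exact: fH | exact: lead_le gv].
split.
  rewrite mcoeff_mul (big_fsetD1 x) -?mcoeff_neq0 //= addrAC subrr add0r.
  rewrite big1_fset ?addr0 ?mulf_neq0 // => u; rewrite in_fsetD1 => /andP[ux].
  rewrite -mcoeff_neq0 => fu _; apply/eqP; rewrite mulf_eq0 (negPf fu) /=.
  apply/negP => /negP gv; have := le _ _ fu gv.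
  by rewrite ux weightB wD => /(_ isT); lia.
move=> z; rewrite mcoeff_mul => /eqP nz zxy.
have [u [fu gv]] : exists u, f@_u != 0 /\ g@_(z - u) != 0.
  apply: contrapT => no; apply: nz; apply: big1_fset => u.
  rewrite -mcoeff_neq0 => fu _; apply/eqP/negP => /negP.
  by rewrite mulf_eq0 negb_or => /andP[_ gv]; apply: no; exists u.
have := le _ _ fu gv; rewrite weightB wD.
rewrite [w u + _]addrC subrK; apply.
apply/norP => -[/negPn/eqP ux /negPn/eqP vy].
by case/eqP: zxy; rewrite -vy ux [x + _]addrC subrK.
Qed.

Lemma lead1 : lead w (1 : grpalg k G) 0.
Proof.
split; first by rewrite -gmon0 mcoeff_gmon eqxx oner_eq0.
by move=> y; rewrite -gmon0 mcoeff_gmon; case: (eqVneq 0 y) => [->|]; rewrite ?eqxx.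
Qed.

Lemma lead_exp f x n : lead w f x -> lead w (f ^+ n) (x *+ n).
Proof.
move=> lf; elim: n => [|n IH]; first exact: lead1.
by rewrite exprS mulrS; apply: lead_mul.
Qed.

Lemma lead_gmon x : lead w (gmon k x) x.
Proof.
split; first by rewrite mcoeff_gmon eqxx oner_eq0.
by move=> y; rewrite mcoeff_gmon; case: (eqVneq x y) => [->|]; rewrite ?eqxx.
Qed.

Lemma lead_exists f : f != 0 -> {in msupp f &, injective w} ->
  exists x, lead w f x.
Proof.
move=> /grpalg_neq0P[x0]; rewrite mcoeff_neq0 => x0f winj.
pose F (x : msupp f) := w (val x).
have := @Order.TotalTheory.arg_maxP _ _ (msupp f) [` x0f]%fset predT F isT.
case=> x _ xmax; exists (val x); split; first by rewrite mcoeff_neq0 (valP x).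
move=> y; rewrite mcoeff_neq0 => yf yx.
have /= := xmax [` yf]%fset isT; rewrite /F /= le_eqVlt => /orP[/eqP e|//].
by move: yx; rewrite (winj _ _ yf (valP x) e) eqxx.
Qed.

Lemma lead_free (I : finType) (F : I -> grpalg k G) (e : I -> G) (c : I -> k) :
  (forall i, lead w (F i) (e i)) -> injective e ->
  \sum_i c i *: F i = 0 -> forall i, c i = 0.
Proof.
move=> lF einj s0 i0; apply/eqP/negP => /negP ci0.
have := @Order.TotalTheory.arg_maxP _ _ I i0 (fun i => c i != 0) (fun i => w (e i)) ci0.
case=> i ci imax.
have /(congr1 (mcoeff (e i))) := s0; rewrite raddf_sum mcoeff0 (bigD1 i) //=.
rewrite big1 ?addr0 => [/eqP|j ji].
  by rewrite mcoeffZ mulf_eq0 (negPf ci) (negPf (proj1 (lF i))).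
rewrite mcoeffZ; apply/eqP; rewrite mulf_eq0.
have [//|cj] := eqVneq (c j) 0; rewrite /=; apply/negP => /negP Fj.
have ne : e i != e j by apply: contra_neq ji => /einj.
have := proj2 (lF j) _ Fj ne; rewrite ltNge => /negP; apply.
exact: imax.
Qed.

End Weight.
End GroupAlgebraLead.

Section LinearExtension.
Context (k : fieldType) (G : zmodType) (V : lmodType k) (m : G -> V).

Definition linext (f : grpalg k G) : V := \sum_(u <- msupp f) f@_u *: m u.

Lemma linextEw (d : {fset G}) (f : grpalg k G) : (msupp f `<=` d)%fset ->
  linext f = \sum_(u <- d) f@_u *: m u.
Proof.
move=> le; rewrite /linext (big_fset_incl _ le) //= => u _ /mcoeff_outdom ->.
by rewrite scale0r.
Qed.

Lemma linext_is_linear : linear linext.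
Proof.
move=> c f g; pose e := c *: f + g.
pose d := (msupp f `|` msupp g `|` msupp e)%fset.
have [df dg de] : [/\ msupp f `<=` d, msupp g `<=` d & msupp e `<=` d]%fset.
  by split; rewrite /d ?fsubsetUr // -fsetUA ?fsubsetUl // fsetUCA fsubsetUl.
rewrite -/e (linextEw df) (linextEw dg) (linextEw de) scaler_sumr -big_split /=.
apply: eq_bigr => u _; rewrite mcoeffD mcoeffZ.
by rewrite scalerDl scalerA.
Qed.

HB.instance Definition _ :=
  GRing.isLinear.Build k (grpalg k G) V _ linext linext_is_linear.

Lemma linext_gmon u : linext (gmon k u) = m u.
Proof.
by rewrite /linext /gmon msuppU oner_eq0 big_seq_fset1 mcoeffUU scale1r.
Qed.

End LinearExtension.

Lemma weight_bound (T : eqType) (s : seq T) (w : T -> int) :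
  exists2 D : int, 0 <= D & forall x, x \in s -> `|w x| <= D.
Proof.
elim: s => [|y s [D D0 HD]]; first by exists 0.
exists (D + `|w y|) => [|x]; first by rewrite addr_ge0.
rewrite inE => /orP[/eqP->|/HD]; first by rewrite lerDr.
by move/le_trans; apply; rewrite lerDl.
Qed.

Lemma weight_refine (G : zmodType) (s : seq G) (w1 w2 : G -> int) :
  additive_weight w1 -> additive_weight w2 ->
  exists w : G -> int, [/\ additive_weight w,
    {in s &, forall x y, w1 x < w1 y -> w x < w y} &
    {in s &, forall x y, w1 x = w1 y -> (w x < w y) = (w2 x < w2 y)}].
Proof.
move=> w1D w2D; have [D D0 HD] := weight_bound s w2.
exists (fun x => (2 * D + 1) * w1 x + w2 x); split.
- by move=> x y; rewrite w1D w2D; ring.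
- move=> x y /HD Hx /HD Hy lt.
  have lt1 : w1 x + 1 <= w1 y by lia.
  have := ler_wpM2l (_ : 0 <= 2 * D + 1) lt1; move/(_ ltac:(lia)); lia.
- by move=> x y _ _ ->; rewrite ltrD2l.
Qed.


Local Notation Z2 := 'rV[int]_2.
Local Notation Z3 := ('rV[int]_2 * int)%type.

Lemma row2P (T : Type) (a b : 'rV[T]_2) :
  a 0 0 = b 0 0 -> a 0 1 = b 0 1 -> a = b.
Proof.
move=> e0 e1; apply/rowP => j; case: (unliftP 0 j) => [j'|] -> //.
by rewrite (ord1 j') (_ : lift 0 0 = 1) //; apply/val_inj.
Qed.

Lemma weight_injective (s : seq Z3) (w1 : Z3 -> int) : additive_weight w1 ->
  exists w : Z3 -> int, [/\ additive_weight w,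
    {in s &, forall x y, w1 x < w1 y -> w x < w y} & {in s &, injective w}].
Proof.
pose c0 (u : Z3) := u.1 0 0; pose c1 (u : Z3) := u.1 0 1; pose c2 (u : Z3) := u.2.
move=> w1D.
have c0D : additive_weight c0 by move=> x y; rewrite /c0 mxE.
have c1D : additive_weight c1 by move=> x y; rewrite /c1 mxE.
have c2D : additive_weight c2 by [].
have [v [vD v1 v2]] := weight_refine s c1D c2D.
have [v' [v'D v'1 v'2]] := weight_refine s c0D vD.
have [w [wD wl wr]] := weight_refine s w1D v'D.
have key (u1 u2 u3 : Z3 -> int) :
    {in s &, forall x y, u1 x < u1 y -> u3 x < u3 y} ->
    {in s &, forall x y, u1 x = u1 y -> (u3 x < u3 y) = (u2 x < u2 y)} ->
    {in s &, forall x y, u3 x = u3 y -> u1 x = u1 y /\ u2 x = u2 y}.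
  move=> H1 H2 x y xs ys e; suff e1 : u1 x = u1 y.
    split=> //; apply: le_anti; rewrite !leNgt.
    by rewrite -(H2 _ _ xs ys e1) -(H2 _ _ ys xs (esym e1)) e ltxx.
  by apply: le_anti; rewrite !leNgt; apply/andP; split; apply/negP;
    [move/(H1 _ _ ys xs) | move/(H1 _ _ xs ys)]; rewrite e ltxx.
exists w; split=> // x y xs ys e.
have [_ e'] := key _ _ _ wl wr _ _ xs ys e.
have [e0 e''] := key _ _ _ v'1 v'2 _ _ xs ys e'.
have [e1 e2] := key _ _ _ v1 v2 _ _ xs ys e''.
move: x y {xs ys e e' e''} e0 e1 e2 => [x a] [y b]; rewrite /c0 /c1 /c2 /=.
by move=> e0 e1 ->; rewrite (row2P e0 e1).
Qed.

Lemma grpalg_mul_eq0 (k : fieldType) (f g : grpalg k Z3) :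
  f * g = 0 -> f = 0 \/ g = 0.
Proof.
move=> fg0; have [->|f0] := eqVneq f 0; first by left.
have [->|g0] := eqVneq g 0; first by right.
pose s : seq Z3 := enum_fset (msupp f) ++ enum_fset (msupp g).
have z0 : additive_weight (fun _ : Z3 => 0 : int) by move=> x y; rewrite addr0.
have [w [wD _ winj]] := weight_injective s z0.
have [x lx] : exists x, lead w f x.
  by apply: lead_exists f0 _; apply: sub_in2 winj => u uf; rewrite mem_cat uf.
have [y ly] : exists x, lead w g x.
  by apply: lead_exists g0 _; apply: sub_in2 winj => u uf; rewrite mem_cat uf orbT.
by have [] := lead_mul wD lx ly; rewrite fg0 mcoeff0 eqxx.
Qed.

(* [mono], locked: otherwise comparing two distinct monomials makes unification
   unfold [insubd] and diverge. *)
HB.lock Definition mon (k : fieldType) (R : realType) n (P : set 'rV[R]_n)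
  (u : 'rV[int]_n * int) : kalg k P := mono k P u.

(* The type annotation keeps the canonical structures on exponents uniform. *)
Definition up n (z : 'rV[int]_n) : 'rV[int]_n * int := (z, 1).

(** * The algebra k[P] *)

Section Kalg.
Context (k : fieldType) (R : realType) (n : nat).
Implicit Types (P Q : set 'rV[R]_n) (u v : 'rV[int]_n * int) (z : 'rV[int]_n).

Local Notation "k[ P ]" := (kalg k P) (at level 0, format "k[ P ]").

Lemma kval_inj P : injective (@kval k R n P). Proof. exact: val_inj. Qed.

Lemma kval0 P : kval (0 : k[P]) = 0. Proof. exact: (raddf0 val). Qed.
Lemma kvalZ P (c : k) (f : k[P]) : kval (c *: f) = c *: kval f.
Proof. exact: GRing.valZ. Qed.
Lemma kval1 P : kval (1 : k[P]) = 1. Proof. exact: (rmorph1 val). Qed.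
Lemma kvalM P (f g : k[P]) : kval (f * g) = kval f * kval g.
Proof. reflexivity. Qed.
Lemma kvalX P (f : k[P]) m : kval (f ^+ m) = kval f ^+ m.
Proof. by elim: m => [|m IH]; rewrite ?expr0 ?kval1 // !exprS kvalM IH. Qed.
Lemma kval_sum P (I : Type) (r : seq I) (p : pred I) (F : I -> k[P]) :
  kval (\sum_(i <- r | p i) F i) = \sum_(i <- r | p i) kval (F i).
Proof. exact: (raddf_sum val). Qed.

Lemma kval_support P (f : k[P]) u : (kval f)@_u != 0 -> semigrp P u.
Proof. by move: (valP f) => /asboolP; apply. Qed.

Lemma kval_mon P u : semigrp P u -> kval (mon k P u) = gmon k u.
Proof. by rewrite mon.unlock; apply: kval_mono. Qed.

Lemma monD P u v : semigrp P u -> semigrp P v ->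
  mon k P (u + v) = mon k P u * mon k P v.
Proof.
move=> uP vP; apply: kval_inj; by rewrite kvalM !kval_mon //; [exact: gmonD | exact: semigrpD].
Qed.

Lemma mon0 P : mon k P 0 = 1.
Proof. by apply: kval_inj; rewrite kval_mon ?kval1 //; apply: semigrp0. Qed.

Lemma semigrpMn P u m : semigrp P u -> semigrp P (u *+ m).
Proof.
move=> uP; elim: m => [|m IH]; first exact: semigrp0.
by rewrite mulrS; apply: semigrpD.
Qed.

Lemma monMn P u m : semigrp P u -> mon k P (u *+ m) = mon k P u ^+ m.
Proof.
move=> uP; elim: m => [|m IH]; first by rewrite mulr0n mon0.
by rewrite mulrS monD ?IH ?exprS //; apply: semigrpMn.
Qed.

Lemma kalgE P (f : k[P]) :
  f = \sum_(u <- msupp (kval f)) (kval f)@_u *: mon k P u.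
Proof.
apply: kval_inj; rewrite kval_sum [LHS]grpalgE; apply: eq_big_seq => u uf.
by rewrite kvalZ kval_mon //; apply: (@kval_support _ f); rewrite mcoeff_neq0.
Qed.
End Kalg.

Section Kalg2.
Context (k : fieldType) (R : realType) (n : nat).
Implicit Types (P Q : set 'rV[R]_n) (u v : 'rV[int]_n * int) (z : 'rV[int]_n).

Local Notation "k[ P ]" := (kalg k P) (at level 0, format "k[ P ]").
Local Notation mon := (mon k).

Lemma semigrp_gen P z : latpts P z -> semigrp P (up z).
Proof.
move=> zP; exists [:: z]; last by rewrite big_seq1.
by move=> y; rewrite inE => /eqP->.
Qed.

Lemma semigrp_ind P (Pr : 'rV[int]_n * int -> Prop) : Pr 0 ->
  (forall z u, latpts P z -> semigrp P u -> Pr u -> Pr (up z + u)) ->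
  forall u, semigrp P u -> Pr u.
Proof.
move=> Pr0 PrS u [s sP ->]; elim: s sP => [|z s IH] sP; first by rewrite big_nil.
have sP' y : y \in s -> latpts P y by move=> ys; apply: sP; rewrite inE ys orbT.
rewrite big_cons; apply: PrS; [|by exists s|exact: IH].
by apply: sP; rewrite inE eqxx.
Qed.

Lemma semigrp_deg_ge0 P u : semigrp P u -> 0 <= u.2.
Proof.
by elim/semigrp_ind => // z v _ _ v0; rewrite /= addr_ge0.
Qed.

Lemma semigrp_deg1 P u : semigrp P u -> u.2 = 1 -> latpts P u.1.
Proof.
case=> -[|z [|y s]] sP ->; rewrite ?big_nil // ?big_seq1.
  by move=> _; apply: sP; rewrite inE.
rewrite !big_cons /= => /eqP; rewrite addrA eq_sym -subr_eq0.
have s0 : semigrp P (\sum_(z <- s) (z, 1)).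
  by exists s => // x xs; apply: sP; rewrite !inE xs !orbT.
by have := semigrp_deg_ge0 s0; set S := \sum_(_ <- _) _; lia.
Qed.

Record semigroup_hom P (B : algType k) := SemigroupHom {
  hom_fun :> 'rV[int]_n * int -> B;
  hom0 : hom_fun 0 = 1;
  homD : forall u v, semigrp P u -> semigrp P v ->
    hom_fun (u + v) = hom_fun u * hom_fun v }.

Section Lift.
Context (P : set 'rV[R]_n) (B : algType k) (m : semigroup_hom P B).

Definition lift_fun (f : k[P]) : B := linext m (kval f).

Lemma lift_is_linear : linear lift_fun.
Proof.
move=> c f g; rewrite /lift_fun (_ : kval (c *: f + g) = c *: kval f + kval g) //.
exact: linearP.
Qed.

HB.instance Definition _ := GRing.isLinear.Build k k[P] B _ lift_fun lift_is_linear.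

Lemma lift_mon u : semigrp P u -> lift_fun (mon P u) = m u.
Proof.
by move=> uP; rewrite /lift_fun kval_mon // linext_gmon.
Qed.

Lemma lift_is_monoid_morphism : monoid_morphism lift_fun.
Proof.
split=> [|f g]; first by rewrite -mon0 lift_mon ?hom0 //; apply: semigrp0.
rewrite [in LHS](kalgE f) [in LHS](kalgE g) mulr_suml linear_sum [X in X * _]/lift_fun /linext mulr_suml.
apply: eq_big_seq => u uf; rewrite mulr_sumr linear_sum [X in _ * X]/lift_fun /linext mulr_sumr.
have uP : semigrp P u by apply: (@kval_support _ _ _ _ f); rewrite mcoeff_neq0.
apply: eq_big_seq => v vg.
have vP : semigrp P v by apply: (@kval_support _ _ _ _ g); rewrite mcoeff_neq0.
rewrite -!(scalerAl, scalerAr) -monD // !linearZ /= lift_mon; last exact: semigrpD.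
by rewrite homD // !scalerA mulrC.
Qed.

HB.instance Definition _ :=
  GRing.isMonoidMorphism.Build k[P] B lift_fun lift_is_monoid_morphism.

Definition lift_lr : {lrmorphism k[P] -> B} := lift_fun.

End Lift.

Lemma lrmorph_ext P (B : algType k) (f g : {lrmorphism k[P] -> B}) :
  (forall z, latpts P z -> f (mon P (up z)) = g (mon P (up z))) -> f =1 g.
Proof.
move=> fg a; rewrite (kalgE a) !linear_sum; apply: eq_big_seq => u ua.
have uP : semigrp P u by apply: (@kval_support _ _ _ _ a); rewrite mcoeff_neq0.
rewrite !linearZ /=; congr (_ *: _); elim/semigrp_ind: u / uP {ua} => [|z u zP uP IH].
  by rewrite mon0 !rmorph1.
by rewrite monD ?rmorphM /= ?fg ?IH //; apply: semigrp_gen.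
Qed.

End Kalg2.

(** * Chains of primes and growth *)

Section FreeModulo.
Context (k : fieldType) (B : comAlgType k).
Implicit Types (I : {pred B}).

Definition free_mod I (J : finType) (g : J -> B) :=
  forall c : J -> k, \sum_j c j *: g j \in I -> forall j, c j = 0.

Lemma ideal0 I : idealr_closed I -> 0 \in I. Proof. by case. Qed.

Lemma idealM I a u : idealr_closed I -> u \in I -> a * u \in I.
Proof. by case=> I0 _ IH uI; rewrite -[a * u]addr0 IH. Qed.

Lemma idealD I u v : idealr_closed I -> u \in I -> v \in I -> u + v \in I.
Proof. by case=> _ _ IH uI vI; rewrite -[u]mul1r IH. Qed.

Lemma idealB I u v : idealr_closed I -> u + v \in I -> v \in I -> u \in I.
Proof.
by case=> _ _ IH uI vI; rewrite -[u](addrK v) addrC -mulN1r IH.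
Qed.

Lemma ideal_unit I (c : k) : idealr_closed I -> c *: 1 \in I -> c = 0.
Proof.
move=> idI cI; apply/eqP/negP => /negP c0; have [_ /negP I1 _] := idI; apply: I1.
have := idealM (c^-1 *: 1) idI cI.
by rewrite -scalerAl mul1r scalerA mulVf // scale1r.
Qed.

(* A relation among the [a ^ m * g j] has its constant part in [I'], hence is
   divisible by [a], which can be cancelled modulo the prime [I]. *)
Lemma free_mod_step I I' (M : nat) (J : finType) (g : J -> B) a :
  prime_ideal I -> idealr_closed I' -> {subset I <= I'} ->
  a \in I' -> a \notin I -> free_mod I' g ->
  free_mod I (fun p : 'I_M * J => a ^+ p.1 * g p.2).
Proof.
move=> [idI prI] idI' sub aI' aI fr c.
pose d m j := if insub m is Some i then c (i, j) else 0.
have -> : \sum_p c p *: (a ^+ p.1 * g p.2) =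
    \sum_(m < M) a ^+ m * \sum_j d m j *: g j.
  rewrite (eq_bigr (fun p => c (p.1, p.2) *: (a ^+ p.1 * g p.2))); last first.
    by case.
  rewrite -(pair_big predT predT (fun i j => c (i, j) *: (a ^+ (i : 'I_M) * g j))) /=.
  apply: eq_bigr => i _; rewrite mulr_sumr; apply: eq_bigr => j _.
  by rewrite /d valK scalerAr.
suff H N (e : nat -> J -> k) : \sum_(m < N) a ^+ m * (\sum_j e m j *: g j) \in I ->
    forall m j, (m < N)%N -> e m j = 0.
  by move/H => + [i j] => /(_ i j (ltn_ord i)); rewrite /d valK.
elim: N e => [|N IH] e //; rewrite big_ord_recl expr0 mul1r.
set r := \sum_j _; under eq_bigr do rewrite /bump /= exprS -mulrA.
rewrite -mulr_sumr; set s := \sum_(i < N) _ => rI.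
have rI' : r \in I'.
  apply: (idealB idI' (sub _ rI)); rewrite mulrC; exact: idealM.
have e0 := fr _ rI'.
have r0 : r = 0 by rewrite /r big1 // => j _; rewrite e0 scale0r.
move: rI; rewrite r0 add0r => /prI; rewrite (negPf aI) /= => /(IH (fun m => e m.+1)).
by move=> H [|m] j //; rewrite ltnS; apply: H.
Qed.

Lemma free_mod_unit I : idealr_closed I -> free_mod I (fun _ : unit => 1).
Proof.
move=> idI c; rewrite (bigD1 tt) //= big1 ?addr0; last by case.
by move=> cI []; apply: ideal_unit cI.
Qed.

End FreeModulo.

Section Growth.
Context (k : fieldType) (R : realType) (P : set 'rV[R]_2).
Local Notation kP := (kalg k P).

Definition size3 (u : Z3) : nat := (`|u.1 0%R 0%R| + `|u.1 0%R 1%R| + `|u.2|)%N.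

Definition in_box (b : nat) (f : grpalg k Z3) :=
  forall u, f@_u != 0 -> (size3 u <= b)%N.

Lemma size3D (u v : Z3) : (size3 (u + v)%R <= size3 u + size3 v)%N.
Proof.
have tri (a b : int) : (`|(a + b)%R| <= `|a| + `|b|)%N by lia.
have := leq_add (leq_add (tri (u.1 0%R 0%R) (v.1 0%R 0%R))
  (tri (u.1 0%R 1%R) (v.1 0%R 1%R))) (tri u.2 v.2).
by rewrite /size3 /= !mxE => /leq_trans; apply; lia.
Qed.

Lemma in_boxW b b' f : (b <= b')%N -> in_box b f -> in_box b' f.
Proof. by move=> le H u /H /leq_trans; apply. Qed.

Lemma in_box_mul b b' f g : in_box b f -> in_box b' g -> in_box (b + b') (f * g).
Proof.
move=> Hf Hg z; rewrite mcoeff_mul => /eqP nz.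
have [u [fu gv]] : exists u, f@_u != 0 /\ g@_(z - u) != 0.
  apply: contrapT => no; apply: nz; apply: big1_fset => u.
  rewrite -mcoeff_neq0 => fu _; apply/eqP/negP => /negP.
  by rewrite mulf_eq0 negb_or => /andP[_ gv]; apply: no; exists u.
have := size3D u (z - u); rewrite addrC subrK => /leq_trans; apply.
by rewrite leq_add ?Hf ?Hg.
Qed.

Lemma in_box1 : in_box 0 1.
Proof.
move=> u; rewrite -gmon0 mcoeff_gmon; case: (eqVneq 0 u) => [<-|]; last by rewrite eqxx.
by rewrite /size3 !mxE.
Qed.

Lemma in_box_exp b f m : in_box b f -> in_box (b * m) (f ^+ m).
Proof.
move=> Hf; elim: m => [|m IH]; first by rewrite muln0; apply: in_box1.
by rewrite exprS mulnS; apply: in_box_mul.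
Qed.

Lemma in_box_exists f : exists b, in_box b f.
Proof.
exists (\sum_(u <- msupp f) size3 u)%N => u; rewrite mcoeff_neq0 => uf.
by rewrite (big_fsetD1 u) //= leq_addr.
Qed.

Lemma in_box_free b (J : finType) (g : J -> kP) :
  (forall j, in_box b (kval (g j))) -> free_mod (pred1 0) g ->
  (#|J| <= (2 * b + 1) ^ 3)%N.
Proof.
move=> gb fr; rewrite leqNgt; apply/negP => lt.
set K := (2 * b + 1)%N in lt.
pose S : finType := ('I_K * 'I_K * 'I_K)%type.
pose sh (i : 'I_K) : int := i%:Z - b%:Z.
pose pt (s : S) : Z3 := (\row_j (if j == 0 then sh s.1.1 else sh s.1.2), sh s.2).
have cS : #|S| = (K ^ 3)%N by rewrite !card_prod !card_ord !expnS expn0 muln1 mulnA.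
pose A := \matrix_(i < #|J|, j < #|S|) (kval (g (enum_val i)))@_(pt (enum_val j)).
have : kermx A != 0.
  rewrite -mxrank_eq0 mxrank_ker subn_eq0 -ltnNge.
  by apply: leq_ltn_trans (rank_leq_col _) _; rewrite cS.
move=> /rowV0Pn[v /sub_kermxP vA v0]; case/eqP: v0.
apply/rowP => i; rewrite mxE.
have := fr (fun j => v 0 (enum_rank j)); move=> /(_ _ (enum_val i)).
rewrite enum_valK; apply.
rewrite inE; apply/eqP/kval_inj/malgP => u; rewrite kval0 mcoeff0 kval_sum raddf_sum /=.
have [ub|ub] := leqP (size3 u) b; last first.
  rewrite big1 // => j _; rewrite mcoeffZ; apply/eqP; rewrite mulf_eq0.
  by apply/orP; right; apply/negP => /negP /gb; rewrite leqNgt ub.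
have bnd (x : int) : (`|x| <= b)%N -> exists i, sh i = x.
  move=> xb; have lt' : (`|(x + b%:Z)%R| < K)%N by rewrite /K; lia.
  by exists (Ordinal lt'); rewrite /sh /=; lia.
have [[i0 e0] [i1 e1] [i2 e2]] : [/\ exists i, sh i = u.1 0 0,
    exists i, sh i = u.1 0 1 & exists i, sh i = u.2].
  split; apply: bnd; apply: leq_trans ub; rewrite /size3; last exact: leq_addl.
    by rewrite -addnA leq_addr.
  by rewrite addnAC leq_addl.
have -> : u = pt (i0, i1, i2).
  by case: u e0 e1 e2 {ub} => u1 u2 /= e0 e1 e2; congr pair => //;
     apply: row2P; rewrite !mxE /=.
move/rowP: vA => /(_ (enum_rank (i0, i1, i2))); rewrite !mxE => vA.
rewrite -[RHS]vA (reindex _ (onW_bij _ (enum_val_bij J))) /=.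
apply: eq_bigr => j _; rewrite mcoeffZ enum_valK mxE.
by rewrite !enum_rankK.
Qed.

Lemma no_four_free (a1 a2 a3 a4 : kP) :
  ~ forall M, free_mod (pred1 0) (fun p : 'I_M * ('I_M * ('I_M * ('I_M * unit))) =>
      a1 ^+ p.1 * (a2 ^+ p.2.1 * (a3 ^+ p.2.2.1 * (a4 ^+ p.2.2.2.1 * 1)))).
Proof.
move=> fr; have [[b1 B1] [b2 B2]] := (in_box_exists (kval a1), in_box_exists (kval a2)).
have [[b3 B3] [b4 B4]] := (in_box_exists (kval a3), in_box_exists (kval a4)).
pose b := (b1 + b2 + b3 + b4)%N; pose M := ((2 * b + 1) ^ 3).+1.
have := @in_box_free (b * M) _ _ _ (fr M).
have H : forall j : 'I_M * ('I_M * ('I_M * ('I_M * unit))), in_box (b * M)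
    (kval (a1 ^+ j.1 * (a2 ^+ j.2.1 * (a3 ^+ j.2.2.1 * (a4 ^+ j.2.2.2.1 * 1))))).
  move=> [i1 [i2 [i3 [i4 []]]]]; rewrite !kvalM !kvalX kval1 mulr1 /=.
  apply: in_boxW (in_box_mul (in_box_exp B1) (in_box_mul (in_box_exp B2)
    (in_box_mul (in_box_exp B3) (in_box_exp B4)))).
  rewrite /b !mulnDl !addnA.
  by rewrite -!addnA !leq_add // leq_mul // ltnW.
move/(_ H); rewrite !card_prod !card_ord card_unit muln1.
apply/negP; rewrite -ltnNge.
apply: (@leq_ltn_trans ((2 * b + 1) ^ 3 * M ^ 3)); last first.
  have -> : (M * (M * (M * M)) = M * M ^ 3)%N by rewrite !expnS expn0 muln1.
  by rewrite ltn_pmul2r ?expn_gt0.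
by rewrite -expnMn leq_exp2r // mulnDl mul1n mulnA leq_add2l.
Qed.

End Growth.

Definition det2 (a b : Z2) : int := a 0 0 * b 0 1 - a 0 1 * b 0 0.

Lemma det2D a b c : det2 a (b + c) = det2 a b + det2 a c.
Proof. by rewrite /det2 !mxE; ring. Qed.

Lemma det2N a b : det2 a (- b) = - det2 a b.
Proof. by rewrite /det2 !mxE; ring. Qed.

Lemma det2B a b c : det2 a (b - c) = det2 a b - det2 a c.
Proof. by rewrite det2D det2N. Qed.

Lemma det20 a : det2 a 0 = 0.
Proof. by rewrite /det2 !mxE; ring. Qed.

Lemma det2aa a : det2 a a = 0.
Proof. by rewrite /det2; ring. Qed.

Lemma det2Mz a b (m : int) : det2 a (b *~ m) = det2 a b * m.
Proof.
have e j : (b *~ m) 0 j = b 0 j * m.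
  by case: m => m; rewrite ?NegzE ?mulrNz -?pmulrn ?mxE ?mulrN ?mulmxnE -mulr_natr ?natz.
by rewrite /det2 !e; ring.
Qed.

(* Algebraic closedness as a property of a [fieldType]: with [k : closedFieldType]
   unification gets lost between the various coercion paths from [k]. *)
Definition alg_closed (k : fieldType) := forall p : {poly k},
  exists r : seq k, p = lead_coef p *: \prod_(z <- r) ('X - z%:P).

Definition indep (k : fieldType) (V : lmodType k) (a b : V) :=
  forall s t : k, s *: a + t *: b = 0 -> s = 0 /\ t = 0.

Section KrullDimension.
Context (k : fieldType) (R : realType) (P : set 'rV[R]_2).
Local Notation kP := (kalg k P).
Local Notation mon := (mon k).

Lemma kalg_mul_eq0 (f g : kP) : f * g = 0 -> f = 0 \/ g = 0.
Proof.
move=> /(congr1 (@kval _ _ _ _)); rewrite kvalM kval0 => /grpalg_mul_eq0[] e.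
  by left; apply: kval_inj; rewrite e kval0.
by right; apply: kval_inj; rewrite e kval0.
Qed.

Lemma kalg_mul_neq0 (f g : kP) : f != 0 -> g != 0 -> f * g != 0.
Proof.
by move=> /eqP f0 /eqP g0; apply/eqP => /kalg_mul_eq0[].
Qed.

Lemma kalg_exp_neq0 (f : kP) m : f != 0 -> f ^+ m != 0.
Proof.
move=> f0; elim: m => [|m IH]; first by rewrite expr0 oner_eq0.
by rewrite exprS kalg_mul_neq0.
Qed.

Lemma ker_prime (B : comAlgType k) (f : {lrmorphism kP -> B}) :
  (forall a b : B, a * b = 0 -> a = 0 \/ b = 0) ->
  prime_ideal [pred a : kP | f a == 0].
Proof.
move=> dom; split=> [|a b]; last first.
  by rewrite !inE rmorphM => /eqP/dom[] ->; rewrite eqxx ?orbT.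
split; rewrite ?inE ?rmorph0 ?rmorph1 ?oner_eq0 // => a u v.
by rewrite !inE => /eqP fu /eqP fv; rewrite rmorphD rmorphM /= fu fv mulr0 addr0.
Qed.

Lemma zero_prime : prime_ideal (pred1 (0 : kP)).
Proof. by apply: (ker_prime (idfun : {lrmorphism kP -> kP})); apply: kalg_mul_eq0. Qed.

Lemma free_modS (B : comAlgType k) (I I' : {pred B}) (J : finType) (g : J -> B) :
  {subset I <= I'} -> free_mod I' g -> free_mod I g.
Proof. by move=> sub fr c /sub; apply: fr. Qed.

Lemma prime_chain_le3 d : prime_chain kP d -> (d <= 3)%N.
Proof.
move=> [c [cp cs]]; rewrite leqNgt; apply/negP => lt.
have id i : (i < 5)%N -> idealr_closed (c i) by move=> ?; apply: (proj1 (cp i _)); lia.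
have st i : (i < 4)%N -> {subset c i <= c i.+1} /\ exists2 a, a \in c i.+1 & a \notin c i.
  by move=> ?; apply: cs; lia.
have [s1 [a1 a1i a1n]] := st 0%N isT; have [s2 [a2 a2i a2n]] := st 1%N isT.
have [s3 [a3 a3i a3n]] := st 2%N isT; have [s4 [a4 a4i a4n]] := st 3%N isT.
apply: (@no_four_free _ _ _ a1 a2 a3 a4) => M.
apply: (@free_modS _ _ (c 0%N)) => [a|].
  by rewrite inE => /eqP->; apply/ideal0/id.
have pr i : (i < 4)%N -> prime_ideal (c i) by move=> ?; apply: cp; lia.
have fr4 := free_mod_unit (id 4%N isT).
have fr3 := @free_mod_step _ _ _ _ M _ _ _ (pr 3%N isT) (id 4%N isT) s4 a4i a4n fr4.
have fr2 := @free_mod_step _ _ _ _ M _ _ _ (pr 2%N isT) (id 3%N isT) s3 a3i a3n fr3.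
have fr1 := @free_mod_step _ _ _ _ M _ _ _ (pr 1%N isT) (id 2%N isT) s2 a2i a2n fr2.
exact: (@free_mod_step _ _ _ _ M _ _ _ (pr 0%N isT) (id 1%N isT) s1 a1i a1n fr1).
Qed.

Section Specialisation.
Context (phi : Z3 -> Z3) (phiD : {morph phi : x y / x + y}).

Lemma gmon_phi0 : gmon k (phi 0) = 1.
Proof. by rewrite -(addr0 (phi 0)) -{2}(subrr (phi 0)) addrA -phiD add0r subrr gmon0. Qed.

Lemma gmon_phiD u v : semigrp P u -> semigrp P v ->
  gmon k (phi (u + v)) = gmon k (phi u) * gmon k (phi v).
Proof. by move=> _ _; rewrite phiD gmonD. Qed.

Definition spec_hom : semigroup_hom P (grpalg k Z3) :=
  SemigroupHom gmon_phi0 gmon_phiD.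

Definition spec : {lrmorphism kP -> grpalg k Z3} := lift_lr spec_hom.

Lemma spec_mon u : semigrp P u -> spec (mon P u) = gmon k (phi u).
Proof. exact: (lift_mon spec_hom). Qed.

Lemma spec_monB u v : semigrp P u -> semigrp P v ->
  spec (mon P u - mon P v) = gmon k (phi u) - gmon k (phi v).
Proof.
move=> uP vP; rewrite -(spec_mon uP) -(spec_mon vP).
exact: (raddfB spec).
Qed.

End Specialisation.

Lemma specE phi (phiD : {morph phi : x y / x + y}) (f : kP) :
  spec phiD f = \sum_(u <- msupp (kval f)) (kval f)@_u *: gmon k (phi u).
Proof. by []. Qed.

Lemma spec_comp phi chi (phiD : {morph phi : x y / x + y})
    (chiD : {morph chi : x y / x + y}) (f : kP) :
  (forall u, chi (phi u) = chi u) ->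
  spec chiD f = linext (fun u => gmon k (chi u)) (spec phiD f).
Proof.
move=> e; rewrite !specE linear_sum; apply: eq_bigr => u _.
by rewrite linearZ /= linext_gmon e.
Qed.

Lemma prime_chain3 (a b c : Z2) : latpts P a -> latpts P b -> latpts P c ->
  det2 (b - a) (c - a) != 0 -> prime_chain kP 3.
Proof.
move=> aP bP cP det.
pose f0 (u : Z3) : Z3 := u.
pose f1 (u : Z3) : Z3 := (\row_j (if j == 0 then 0 else det2 (b - a) u.1), u.2).
pose f2 (u : Z3) : Z3 := (0, u.2).
pose f3 (u : Z3) : Z3 := 0.
have f0D : {morph f0 : x y / x + y} by [].
have f1D : {morph f1 : x y / x + y}.
  move=> x y; rewrite /f1 /= det2D; congr pair; apply/rowP => j; rewrite !mxE.
  by case: eqP; rewrite ?addr0.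
have f2D : {morph f2 : x y / x + y} by move=> x y; congr pair; rewrite addr0.
have f3D : {morph f3 : x y / x + y} by move=> x y; rewrite addr0.
pose K f (fD : {morph f : x y / x + y}) : {pred kP} := [pred x : kP | spec fD x == 0].
exists (nth xpredT [:: K _ f0D; K _ f1D; K _ f2D; K _ f3D]).
have pr f (fD : {morph f : x y / x + y}) : prime_ideal (K f fD).
  by apply: ker_prime; apply: grpalg_mul_eq0.
have sub f g (fD : {morph f : x y / x + y}) (gD : {morph g : x y / x + y}) :
    (forall u, g (f u) = g u) -> {subset K f fD <= K g gD}.
  move=> e x; change (spec fD x == 0 -> spec gD x == 0); move/eqP => fx.
  by rewrite (spec_comp fD gD x e) fx linear0 eqxx.
have wit f g (fD : {morph f : x y / x + y}) (gD : {morph g : x y / x + y}) u v :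
    semigrp P u -> semigrp P v -> g u = g v -> f u != f v ->
    exists2 x, x \in K g gD & x \notin K f fD.
  move=> uP vP guv fuv; exists (mon P u - mon P v).
    change (spec gD (mon P u - mon P v) == 0).
    by rewrite spec_monB // guv subrr.
  change (spec fD (mon P u - mon P v) != 0).
  by rewrite spec_monB // subr_eq0; apply: contra fuv => /eqP/gmon_inj->.
have [[aS bS] cS] := (semigrp_gen aP, semigrp_gen bP, semigrp_gen cP).
split; first by case=> [|[|[|[|i]]]] // _; apply: pr.
case=> [|[|[|i]]] //= _; split; try exact: sub.
- apply: (wit _ _ _ _ _ _ bS aS); rewrite /f1 /f0 /=.
    congr pair; apply/rowP => j; rewrite !mxE; case: eqP => // _.
    by apply/eqP; rewrite -subr_eq0 -det2B det2aa.
  apply/eqP => -[ab]; move: det; rewrite ab subrr.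
  by rewrite /det2 !mxE !mul0r subrr eqxx.
- apply: (wit _ _ _ _ _ _ cS aS) => //; apply/eqP => -[/rowP/(_ 1)]; rewrite !mxE /= => e.
  by move: det; rewrite det2B e subrr eqxx.
- by apply: (wit _ _ _ _ _ _ aS (semigrp0 P)) => //; apply/eqP => /(congr1 snd).
Qed.

End KrullDimension.

Section OneGenerator.
Context (k : fieldType) (kc : alg_closed k) (B : comAlgType k) (a : B).

Definition poly_value (f : B) := exists p, f = horner_alg a p.

Lemma poly_value0 : poly_value 0. Proof. by exists 0; rewrite rmorph0. Qed.
Lemma poly_value1 : poly_value 1. Proof. by exists 1; rewrite rmorph1. Qed.
Lemma poly_value_gen : poly_value a. Proof. by exists 'X; rewrite horner_algX. Qed.
Lemma poly_valueD f g : poly_value f -> poly_value g -> poly_value (f + g).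
Proof. by move=> [p ->] [q ->]; exists (p + q); rewrite rmorphD. Qed.
Lemma poly_valueM f g : poly_value f -> poly_value g -> poly_value (f * g).
Proof. by move=> [p ->] [q ->]; exists (p * q); rewrite rmorphM. Qed.
Lemma poly_valueZ s f : poly_value f -> poly_value (s *: f).
Proof. by move=> [p ->]; exists (s%:P * p); rewrite rmorphM /= horner_algC mulr_algl. Qed.

Lemma no_chain_of_generator (c0 c1 c2 : {pred B}) :
  prime_ideal c0 -> prime_ideal c1 -> prime_ideal c2 ->
  {subset c0 <= c1} -> {subset c1 <= c2} ->
  (exists2 f, f \in c1 & f \notin c0) -> (exists2 f, f \in c2 & f \notin c1) ->
  (forall f, exists2 g, poly_value g & f - g \in c0) -> False.
Proof.
move=> [id0 pr0] [id1 pr1] [id2 pr2] s01 s12 [f f1 f0] [q q2 q1] gen.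
have [_ [p ->] fp] := gen f; have [_ [Q ->] qQ] := gen q.
pose ev : {rmorphism {poly k} -> B} := horner_alg a.
have evC s : ev s%:P = s *: 1 by apply: horner_algC.
have modc (I : {pred B}) u v : idealr_closed I -> u - v \in I -> (v \in I) = (u \in I).
  move=> idI uv; apply/idP/idP => H; first by rewrite -[u](subrK v); apply: idealD.
  by apply: (idealB idI _ uv); rewrite addrC subrK.
have {}f0 : ev p \notin c0 by rewrite (modc _ f).
have {}f1 : ev p \in c1 by rewrite (modc _ f) //; apply: s01.
have {}q1 : ev Q \notin c1 by rewrite (modc _ q) //; apply: s01.
have {}q2 : ev Q \in c2 by rewrite (modc _ q) //; apply/s12/s01.
have [r er] := kc p.
have p0 : lead_coef p != 0.
  apply/negP => /eqP l0; move: f0; rewrite er l0 scale0r rmorph0.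
  by rewrite (ideal0 id0).
have [x xr xc] : exists2 x, x \in r & ev ('X - x%:P) \in c1.
  have : ev (\prod_(z <- r) ('X - z%:P)) \in c1.
    have := idealM ((lead_coef p)^-1 *: 1) id1 f1.
    rewrite {2}er -mul_polyC rmorphM /= evC -!scalerAl !mul1r scalerA mulVf //.
    by rewrite scale1r.
  elim: (r) => [|y s IH]; first by rewrite big_nil rmorph1; case: id1 => _ /negP.
  rewrite big_cons rmorphM => /pr1/orP[yc|/IH[x xs xc]].
    by exists y; rewrite // inE eqxx.
  by exists x; rewrite // inE xs orbT.
have [Q' eQ'] : exists Q', Q = Q' * ('X - x%:P) + Q.[x]%:P.
  have /factor_theorem[Q' e] : root (Q - Q.[x]%:P) x by rewrite rootE !hornerE subrr.
  by exists Q'; rewrite -e subrK.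
have xc2 := s12 _ xc.
have Qx : Q.[x] = 0.
  apply: (ideal_unit id2); rewrite -evC.
  move: q2; rewrite {1}eQ' rmorphD rmorphM /= addrC => q2.
  by apply: (idealB id2 q2); apply: (idealM _ id2 xc2).
by move/negP: q1; apply; rewrite eQ' Qx addr0 rmorphM; apply: (idealM _ id1 xc).
Qed.

End OneGenerator.

Section RetractionDimension.
Context (k : fieldType) (kc : alg_closed k) (R : realType) (P : set 'rV[R]_2).
Local Notation kP := (kalg k P).
Local Notation mon := (mon k).
Context (h : {lrmorphism kP -> kP}) (hh : forall x, h (h x) = h x).

Definition to_im (a : kP) : im_ring h :=
  @ImRing _ _ h (h a) (asboolT (ex_intro _ a erefl)).

Lemma to_im0 : to_im 0 = 0.
Proof. by apply: val_inj; exact: rmorph0. Qed.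
Lemma to_im1 : to_im 1 = 1.
Proof. by apply: val_inj; exact: rmorph1. Qed.
Lemma to_imD a b : to_im (a + b) = to_im a + to_im b.
Proof. by apply: val_inj; exact: rmorphD. Qed.
Lemma to_imM a b : to_im (a * b) = to_im a * to_im b.
Proof. by apply: val_inj; exact: rmorphM. Qed.
Lemma to_im_surj (y : im_ring h) : exists a, to_im a = y.
Proof.
case: y => y yP; have /asboolP[a ay] := yP; exists a; exact: val_inj.
Qed.

Lemma im_prime (I : {pred im_ring h}) : prime_ideal I ->
  prime_ideal [pred a | to_im a \in I].
Proof.
move=> [[I0 I1 IL] Ip]; split=> [|u v]; last by rewrite !inE to_imM => /Ip.
by split=> [||a u v]; rewrite !inE ?to_im0 ?to_im1 // => uI vI; rewrite to_imD to_imM IL.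
Qed.

Lemma prime_chain_of_im d : prime_chain (im_ring h) d ->
  exists c : nat -> {pred kP},
    [/\ forall i, (i <= d)%N -> prime_ideal (c i),
      forall i, (i < d)%N ->
        {subset c i <= c i.+1} /\ exists2 a, a \in c i.+1 & a \notin c i &
      forall a, h a = 0 -> a \in c 0%N].
Proof.
move=> [c [cp cs]]; exists (fun i (a : kP) => to_im a \in c i); split.
- by move=> i /cp; apply: im_prime.
- move=> i /cs[sub [y yI yn]]; split=> [a|]; first exact: sub.
  by have [a ay] := to_im_surj y; exists a; rewrite unfold_in ay.
- move=> a ha; rewrite unfold_in (_ : to_im a = 0); last exact: val_inj.
  by have [[]] := cp 0%N isT.
Qed.

Lemma prime_chain_im_of_inj d : (forall a, h a = a) -> prime_chain kP d ->
  prime_chain (im_ring h) d.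
Proof.
move=> hid [c [cp cs]]; exists (fun i (y : im_ring h) => im_val y \in c i); split.
  move=> i /cp[[I0 I1 IL] Ip]; split=> [|u v]; last exact: Ip.
  by split=> // a u v; apply: IL.
move=> i /cs[sub [a aI an]]; split=> [y|]; first exact: sub.
by exists (to_im a); rewrite unfold_in /= hid.
Qed.

Context (h1 : codim h 1).

Lemma retraction_kernel : exists2 w, w != 0 & h w = 0.
Proof.
have [d [e [[dP _] [_ eP] de]]] := h1; apply: contrapT => no.
have hid a : h a = a.
  apply/eqP/negP => /negP ha; apply: no; exists (h a - a); first by rewrite subr_eq0.
  by rewrite rmorphB /= hh subrr.
have := prime_chain_im_of_inj hid dP => /eP; lia.
Qed.

Lemma im_dim (a b c : Z2) : latpts P a -> latpts P b -> latpts P c ->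
  det2 (b - a) (c - a) != 0 -> krull_dim (im_ring h) 2.
Proof.
move=> aP bP cP det; have [d [e [[dP dm] ek de]]] := h1.
have := dm _ (prime_chain3 k aP bP cP det); have := prime_chain_le3 dP.
move=> d3 d3'; have e2 : e = 2%N by lia.
by move: ek; rewrite e2.
Qed.

Lemma no_three_free (a b c : kP) : h a = a -> h b = b -> h c = c ->
  ~ forall M, free_mod (pred1 0) (fun p : 'I_M * ('I_M * ('I_M * unit)) =>
      a ^+ p.1 * (b ^+ p.2.1 * (c ^+ p.2.2.1 * 1))).
Proof.
move=> ha hb hc fr; have [w w0 hw] := retraction_kernel.
apply: (@no_four_free _ _ _ w a b c) => M.
have kerP := ker_prime h (@kalg_mul_eq0 k R P).
apply: (@free_mod_step _ _ _ [pred x | h x == 0] M _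
   (fun p : 'I_M * ('I_M * ('I_M * unit)) => a ^+ p.1 * (b ^+ p.2.1 * (c ^+ p.2.2.1 * 1)))).
- exact: zero_prime.
- exact: (proj1 kerP).
- by move=> x; rewrite !inE => /eqP->; rewrite rmorph0.
- by rewrite inE hw.
- by rewrite inE.
move=> C; rewrite inE => /eqP hC; apply: fr; rewrite inE -[X in _ == X]hC.
rewrite linear_sum; apply/eqP/eq_bigr => j _.
by rewrite linearZ /= !rmorphM !rmorphXn /= ha hb hc rmorph1.
Qed.

Lemma indep_pair : krull_dim (im_ring h) 2 -> exists x y,
  [/\ latpts P x, latpts P y & indep (h (mon P (up x))) (h (mon P (up y)))].
Proof.
pose H z := h (mon P (up z)).
move=> [/prime_chain_of_im[c [cp cs c0]] _]; apply: contrapT => no.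
have [a aP] : exists a : kP, forall z, latpts P z -> exists s : k, H z = s *: a.
  have [[x [xP x0]]|all0] := pselect (exists x, latpts P x /\ H x != 0).
    exists (H x) => z zP; apply: contrapT => nz; apply: no; exists x, z; split=> // s t.
    have [-> /eqP|t0 st] := eqVneq t 0.
      by rewrite scale0r addr0 scaler_eq0 (negPf x0) orbF => /eqP.
    case: nz; exists (- s / t); rewrite mulrC -scalerA scaleNr.
    have -> : - (s *: H x) = t *: H z by apply/eqP; rewrite eq_sym -addr_eq0 addrC st.
    by rewrite scalerA mulVf // scale1r.
  exists 0 => z zP; exists 0; rewrite scaler0; apply/eqP/negP => /negP z0.
  by apply: all0; exists z.
have Ap f : poly_value a (h f).
  rewrite (kalgE f) linear_sum big_seq.
  elim/big_ind: _ => [|f1 f2|u uf]; [exact: poly_value0 | exact: poly_valueD |].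
  have uP : semigrp P u by apply: (@kval_support _ _ _ _ f); rewrite mcoeff_neq0.
  rewrite linearZ /=; apply: poly_valueZ.
  elim/semigrp_ind: u / uP {uf} => [|z u zP uP IH].
    by rewrite mon0 rmorph1; apply: poly_value1.
  rewrite monD //; last exact: semigrp_gen.
  have [s es] := aP z zP.
  by rewrite rmorphM /= [h _]es; apply: poly_valueM => //; apply/poly_valueZ/poly_value_gen.
have pr i : (i <= 2)%N -> prime_ideal (c i) by move/cp.
apply: (no_chain_of_generator kc (pr 0%N isT) (pr 1%N isT) (pr 2%N isT) (a := a)).
- exact: (proj1 (cs 0%N isT)).
- exact: (proj1 (cs 1%N isT)).
- exact: (proj2 (cs 0%N isT)).
- exact: (proj2 (cs 1%N isT)).
move=> f; exists (h f); first exact: Ap.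
by apply: c0; rewrite rmorphB /= hh subrr.
Qed.

End RetractionDimension.

(** * Lattice polygons *)

Lemma intmxMzE (m : int) n (z : 'rV[int]_n) j : (z *~ m) 0 j = z 0 j * m.
Proof.
case: m => m; first by rewrite -pmulrn mulmxnE -mulr_natr natz.
by rewrite NegzE mulrNz -pmulrn mxE mulmxnE mulrN -mulr_natr natz.
Qed.

Section LatticePolytope.
Context (R : realType).
Implicit Types (P : set 'rV[R]_2) (x y z w : Z2).
Local Notation pt := (@Defs.pt R _).

Lemma ptD n (x y : 'rV[int]_n) : pt (x + y) = pt x + pt y.
Proof. by apply/rowP => j; rewrite !mxE rmorphD. Qed.
Lemma ptMz n (x : 'rV[int]_n) m : pt (x *~ m) = m%:~R *: pt x.
Proof. by apply/rowP => j; rewrite [LHS]mxE intmxMzE [RHS]mxE !mxE rmorphM mulrC. Qed.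

Lemma conv_hull_vertex (s : seq Z2) z : z \in s -> latpts (conv_hull (map pt s)) z.
Proof.
move=> zs; have lt : (index z s < size (map pt s))%N by rewrite size_map index_mem.
exists (fun i => (i == Ordinal lt)%:R); split=> [i||].
- by case: eqP.
- by rewrite (bigD1 (Ordinal lt)) //= eqxx big1 ?addr0 // => i /negPf->.
rewrite (bigD1 (Ordinal lt)) //= eqxx scale1r big1 ?addr0.
  by rewrite (nth_map z) ?index_mem // nth_index.
by move=> i /negPf->; rewrite scale0r.
Qed.

Lemma conv_hull_closed (s : seq 'rV[R]_2) m (t : 'I_m -> R) (p : 'I_m -> 'rV[R]_2) :
  (forall j, 0 <= t j) -> \sum_j t j = 1 -> (forall j, conv_hull s (p j)) ->
  conv_hull s (\sum_j t j *: p j).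
Proof.
move=> t0 t1 /choice[c H]; exists (fun i => \sum_j t j * c j i); split.
- by move=> i; apply: sumr_ge0 => j _; have [c0 _ _] := H j; apply: mulr_ge0.
- rewrite exchange_big -[RHS]t1; apply: eq_bigr => j _ /=.
  by have [_ c1 _] := H j; rewrite -mulr_sumr c1 mulr1.
under [RHS]eq_bigr do rewrite scaler_suml.
rewrite exchange_big; apply: eq_bigr => j _ /=; have [_ _ {1}->] := H j.
by rewrite scaler_sumr; apply: eq_bigr => i _; rewrite scalerA.
Qed.

Lemma conv_hull_ge0 (s : seq Z2) (a b c : int) :
  (forall z, z \in s -> 0 <= a * z 0 0 + b * z 0 1 + c) ->
  forall p, conv_hull (map pt s) p -> 0 <= a%:~R * p 0 0 + b%:~R * p 0 1 + c%:~R.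
Proof.
move=> H p [e [e0 e1 ep]].
have coord j : p 0 j = \sum_i e i * ((map pt s)`_i 0 j).
  by rewrite ep summxE; apply: eq_bigr => i _; rewrite mxE.
have -> : c%:~R = \sum_i e i * c%:~R :> R by rewrite -mulr_suml e1 mul1r.
rewrite !coord !mulr_sumr -!big_split /=; apply: sumr_ge0 => i _.
rewrite -[_ + _](_ : e i * (a * s`_i 0 0 + b * s`_i 0 1 + c)%:~R = _).
  rewrite mulr_ge0 // ler0z H //; apply: mem_nth; have := ltn_ord i.
  by rewrite {2}size_map.
rewrite (nth_map 0); last by have := ltn_ord i; rewrite {2}size_map.
by rewrite !mxE !rmorphD !rmorphM /=; ring.
Qed.

Section Lattice.
Context (P : set 'rV[R]_2) (Pl : lattice_polytope P).

Lemma polytope_convex m (t : 'I_m -> R) (p : 'I_m -> 'rV[R]_2) :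
  (forall j, 0 <= t j) -> \sum_j t j = 1 -> (forall j, P (p j)) ->
  P (\sum_j t j *: p j).
Proof. by have [s ->] := Pl; apply: conv_hull_closed. Qed.

Lemma polytope_ge0 (a b c : int) :
  (forall z, latpts P z -> 0 <= a * z 0 0 + b * z 0 1 + c) ->
  forall p, P p -> 0 <= a%:~R * p 0 0 + b%:~R * p 0 1 + c%:~R.
Proof.
have [s Ps] := Pl; move=> H p; rewrite Ps; apply: conv_hull_ge0 => z zs.
by apply: H; rewrite Ps; apply: conv_hull_vertex.
Qed.

Lemma lattice_convex (n1 n2 n3 n4 : int) x1 x2 x3 x4 z :
  latpts P x1 -> latpts P x2 -> latpts P x3 -> latpts P x4 ->
  0 <= n1 -> 0 <= n2 -> 0 <= n3 -> 0 <= n4 -> 0 < n1 + n2 + n3 + n4 ->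
  z *~ (n1 + n2 + n3 + n4) = x1 *~ n1 + x2 *~ n2 + x3 *~ n3 + x4 *~ n4 ->
  latpts P z.
Proof.
move=> P1 P2 P3 P4 ge1 ge2 ge3 ge4; set N := n1 + n2 + n3 + n4 => N0 e.
have NR : 0 < N%:~R :> R by rewrite ltr0z.
pose t := [:: n1; n2; n3; n4]; pose x := [:: x1; x2; x3; x4].
have -> : latpts P z = P (\sum_(j < 4) ((t`_j)%:~R / N%:~R) *: pt x`_j).
  congr P; rewrite !big_ord_recl big_ord0 /=.
  have := congr1 pt e; rewrite !ptD !ptMz => eR.
  have sc (m : int) (p : 'rV[R]_2) :
      N%:~R *: ((m%:~R / N%:~R) *: p) = m%:~R *: p.
    by rewrite scalerA mulrC divfK // lt0r_neq0.
  apply: (scalerI (lt0r_neq0 NR)); rewrite {}eR !scalerDr !sc.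
  by rewrite scaler0 addr0 !addrA.
apply: polytope_convex.
- case=> -[|[|[|[|m]]]] lt //=; apply: divr_ge0; rewrite ?ler0z //; exact: ltW.
- rewrite -mulr_suml !big_ord_recl big_ord0 /= addr0 -!rmorphD /= !addrA.
  by rewrite divff // lt0r_neq0.
by case=> -[|[|[|[|m]]]] lt.
Qed.

Lemma segment_latpts x w (N i : nat) : latpts P x -> latpts P (x + w *~ N) ->
  (i <= N)%N -> latpts P (x + w *~ i).
Proof.
move=> xP yP iN; have [N0|N0] := posnP N; first by move: iN; rewrite N0 leqn0 => /eqP->; rewrite addr0.
apply: (@lattice_convex (N%:Z - i%:Z) i 0 0 x (x + w *~ N) x x) => //; try lia.
by apply: row2P; rewrite !(mxE, intmxMzE); ring.
Qed.

Lemma intermediate_level (a b w w' : Z2) (s m n : int) : 0 < m -> 0 <= n -> n <= m ->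
  latpts P a -> latpts P (a + w) -> latpts P b -> latpts P (b + w) ->
  b - a = w *~ s + w' *~ m ->
  exists c : int, latpts P (a + w' *~ n + w *~ c).
Proof.
move=> m0 n0 nm aP awP bP bwP e.
pose c := (((s * n) + (m - 1)) %/ m)%Z; pose r := m * c - s * n.
have r0 : 0 <= r /\ r < m.
  have := divz_eq (s * n + (m - 1)) m; rewrite -/c => E.
  have := modz_ge0 (s * n + (m - 1)) (lt0r_neq0 m0).
  have := ltz_pmod (s * n + (m - 1)) m0.
  by rewrite /r mulrC; lia.
have [r1 [r1a r1b r1c r1d]] : exists r1, [/\ 0 <= r1, r1 <= r, r1 <= m - n & r - r1 <= n].
  move: r r0 => r [ra rb].
  by have [le|lt] := leP r (m - n); [exists r | exists (m - n)]; split; lia.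
exists c.
apply: (@lattice_convex (m - n - r1) r1 (n - (r - r1)) (r - r1) a (a + w) b (b + w)) => //; try lia.
have E j : b 0 j = a 0 j + w 0 j * s + w' 0 j * m.
  by have := congr1 (fun v : Z2 => v 0 j) e; rewrite /= !(mxE, intmxMzE) => E; rewrite -addrA -E; ring.
by apply: row2P; rewrite !(mxE, intmxMzE) E /r; ring.
Qed.

Lemma latpts_finite : exists L : seq Z2, uniq L /\ forall z, z \in L <-> latpts P z.
Proof.
have [s Ps] := Pl.
have [D0 D00 HD0] := weight_bound s (fun z => z 0 0).
have [D1 D10 HD1] := weight_bound s (fun z => z 0 1).
pose D := D0 + D1.
have bnd z : latpts P z -> `|z 0 0| <= D /\ `|z 0 1| <= D.
  rewrite /latpts /= Ps => zP.
  have key a b : (forall y, y \in s -> 0 <= a * y 0 0 + b * y 0 1 + D) ->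
      0 <= a * z 0 0 + b * z 0 1 + D.
    by move=> H; have := conv_hull_ge0 H zP; rewrite !mxE -!rmorphM -!rmorphD /= ler0z.
  have k1 := key 1 0; have k2 := key (-1) 0; have k3 := key 0 1; have k4 := key 0 (-1).
  have {}k1 : 0 <= 1 * z 0 0 + 0 * z 0 1 + D.
    by apply: k1 => y /[dup] /HD0 h0 /HD1 h1; rewrite /D; lia.
  have {}k2 : 0 <= -1 * z 0 0 + 0 * z 0 1 + D.
    by apply: k2 => y /[dup] /HD0 h0 /HD1 h1; rewrite /D; lia.
  have {}k3 : 0 <= 0 * z 0 0 + 1 * z 0 1 + D.
    by apply: k3 => y /[dup] /HD0 h0 /HD1 h1; rewrite /D; lia.
  have {}k4 : 0 <= 0 * z 0 0 + -1 * z 0 1 + D.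
    by apply: k4 => y /[dup] /HD0 h0 /HD1 h1; rewrite /D; lia.
  by lia.
pose rng := [seq i%:Z - D | i <- iota 0 `|2 * D + 1|].
have rngP (c : int) : `|c| <= D -> c \in rng.
  move=> cD; apply/mapP; exists `|(c + D)%R|%N; last by lia.
  by rewrite mem_iota; lia.
pose box : seq Z2 := [seq \row_j (if j == 0 then c else d) | c <- rng, d <- rng].
exists (undup [seq z <- box | `[< latpts P z >]]); split; first exact: undup_uniq.
move=> z; rewrite mem_undup mem_filter; split=> [/andP[/asboolP]//|zP].
rewrite asboolT //=; have [z0 z1] := bnd _ zP.
apply/allpairsP; exists (z 0 0, z 0 1); rewrite !rngP //; split=> //.
by apply: row2P; rewrite !mxE.
Qed.

Lemma det2_eq0_line (x z w : Z2) : w != 0 -> det2 w (z - x) = 0 ->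
  pt z - pt x \in <[pt w]>%VS.
Proof.
move=> w0 e; apply/vlineP.
have [w00|w00] := eqVneq (w 0 0) 0.
  have w01 : w 0 1 != 0.
    apply: contra w0 => /eqP w1; apply/eqP/row2P; rewrite mxE //.
  exists ((z 0 1 - x 0 1)%:~R / (w 0 1)%:~R).
  have z0 : z 0 0 = x 0 0.
    move: e; rewrite /det2 !mxE w00 mul0r sub0r => /eqP.
    by rewrite oppr_eq0 mulf_eq0 (negPf w01) subr_eq0 => /eqP.
  apply: row2P; rewrite !mxE.
    by rewrite z0 subrr w00 mulr0.
  by rewrite divfK ?intr_eq0 // rmorphB.
exists ((z 0 0 - x 0 0)%:~R / (w 0 0)%:~R); apply: row2P; rewrite !mxE.
  by rewrite divfK ?intr_eq0 // rmorphB.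
have w0R : (w 0 0)%:~R != 0 :> R by rewrite intr_eq0.
apply: (mulfI w0R); rewrite [RHS]mulrA [X in _ = X * _]mulrC divfK // -!rmorphB -!rmorphM /=.
by congr (_%:~R); move: e; rewrite /det2 !mxE => /eqP; rewrite subr_eq0 => /eqP ->; ring.
Qed.

Lemma not_collinear (x w : Z2) : has_dim P 2 -> w != 0 ->
  exists2 z, latpts P z & det2 w (z - x) != 0.
Proof.
move=> [[p0 p0P] [p [U [dU _ Umin]]]] w0; have [s Ps] := Pl; apply: contrapT => no.
have line : (P `<=` affine_space (pt x) <[pt w]>)%classic.
  move=> q; rewrite Ps => -[c [_ c1 ->]].
  rewrite /affine_space /= -[pt x]scale1r -c1 scaler_suml -sumrB.
  apply: memv_suml => i _; rewrite -scalerBr; apply: memvZ.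
  have si : (i < size s)%N by have := ltn_ord i; rewrite {2}size_map.
  rewrite (nth_map 0) //; apply: det2_eq0_line => //; apply/eqP/negP => /negP ne.
  by apply: no; exists s`_i => //; rewrite Ps; apply/conv_hull_vertex/mem_nth.
have sub := Umin _ _ line.
have pline : p - pt x \in <[pt w]>%VS by apply: sub; rewrite /affine_space /= subrr mem0v.
have : (U <= <[pt w]>)%VS.
  apply/subvP => u uU; have := sub (p + u); rewrite /affine_space /= addrAC subrr add0r.
  by move=> /(_ uU) H; rewrite -[u](addrK (p - pt x)) memvB // addrC addrAC.
move=> /dimvS; rewrite dU dim_vline; by case: (_ != _).
Qed.

Lemma three_points : has_dim P 2 -> exists a b c,
  [/\ latpts P a, latpts P b, latpts P c & det2 (b - a) (c - a) != 0].
Proof.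
move=> dimP.
have e0 : \row_j (j == 0)%:R != 0 :> Z2.
  by apply/eqP => /rowP/(_ 0); rewrite !mxE.
have [a aP _] := not_collinear 0 dimP e0; have [b bP ab] := not_collinear a dimP e0.
have ba : b - a != 0 by apply: contra ab => /eqP->; rewrite det20.
by have [c cP abc] := not_collinear a dimP ba; exists a, b, c.
Qed.

End Lattice.
End LatticePolytope.

(** * Binomial relations between the images of lattice points *)

Section HomogeneousRelation.
Context (k : fieldType) (kc : alg_closed k) (B : comAlgType k).
Context (dom : forall f g : B, f * g = 0 -> f = 0 \/ g = 0).

Lemma indep_neq0 (V : lmodType k) (a b : V) : indep a b -> a != 0 /\ b != 0.
Proof.
move=> ab; split; apply/eqP => e0.
  have /ab[/eqP] : 1 *: a + 0 *: b = 0 by rewrite e0 scale0r scaler0 addr0.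
  by rewrite oner_eq0.
have /ab[_ /eqP] : 0 *: a + 1 *: b = 0 by rewrite e0 scale0r scaler0 addr0.
by rewrite oner_eq0.
Qed.

Lemma indepC (V : lmodType k) (a b : V) : indep a b -> indep b a.
Proof. by move=> ab s t; rewrite addrC => /ab[]. Qed.

Lemma not_indepP (V : lmodType k) (a b : V) : a != 0 -> b != 0 -> ~ indep a b ->
  exists2 s : k, s != 0 & b = s *: a.
Proof.
move=> a0 b0 nab; apply: contrapT => no; apply: nab => s t e.
have [t0|t0] := eqVneq t 0.
  move/eqP: e; rewrite t0 scale0r addr0 scaler_eq0 (negPf a0) orbF.
  by move=> /eqP.
have be : b = (- s / t) *: a.
  have -> : (- s / t) = t^-1 * - s by rewrite mulrC.
  rewrite -scalerA scaleNr (_ : - (s *: a) = t *: b); last first.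
    by apply/eqP; rewrite eq_sym -addr_eq0 addrC e.
  by rewrite scalerA mulVf // scale1r.
case: no; exists (- s / t) => //; apply: contra b0 => /eqP e0.
by rewrite be e0 scale0r.
Qed.

Definition homogenize (a b : B) D (p : {poly k}) : B :=
  \sum_(i < D.+1) p`_i *: (a ^+ (D - i) * b ^+ i).

Lemma homogenizeS a b D (p : {poly k}) x : (size p <= D.+1)%N ->
  homogenize a b D.+1 (p * ('X - x%:P)) = homogenize a b D p * (b - x *: a).
Proof.
move=> sp; rewrite mulrBr [RHS]mulrBr /homogenize.
have eX : \sum_(i < D.+2) (p * 'X)`_i *: (a ^+ (D.+1 - i) * b ^+ i) =
    homogenize a b D p * b.
  rewrite big_ord_recl coefMX scale0r add0r /homogenize mulr_suml.
  apply: eq_bigr => i _; rewrite coefMX /= -scalerAl -mulrA -exprSr.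
  by rewrite /bump /= add1n subSS.
have eC : \sum_(i < D.+2) (p * x%:P)`_i *: (a ^+ (D.+1 - i) * b ^+ i) =
    homogenize a b D p * (x *: a).
  rewrite big_ord_recr /= coefMC (nth_default 0 sp) mul0r scale0r addr0.
  rewrite /homogenize mulr_suml; apply: eq_bigr => i _.
  rewrite coefMC -scalerAl -scalerAr scalerA; congr (_ *: _).
  have -> : (D.+1 - i = (D - i).+1)%N by rewrite subSn // -ltnS.
  by rewrite exprS -[LHS]mulrA [LHS]mulrC.
rewrite -/(homogenize a b D p) -eX -eC -sumrB; apply: eq_bigr => i _.
by rewrite coefB scalerBl.
Qed.

(* A homogeneous relation between [a] and [b] splits into linear ones. *)
Lemma indep_homogenize (a b : B) D (p : {poly k}) : indep a b ->
  (size p <= D.+1)%N -> homogenize a b D p = 0 -> p = 0.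
Proof.
move=> ab sp e; apply/eqP/negP => /negP p0; have [a0 _] := indep_neq0 ab.
have neq0M (f g : B) : f != 0 -> g != 0 -> f * g != 0.
  by move=> /eqP f0 /eqP g0; apply/eqP => /dom[].
have [r er] := kc p.
suff H : forall D', (size (\prod_(z <- r) ('X - z%:P))%R <= D'.+1)%N ->
    homogenize a b D' (\prod_(z <- r) ('X - z%:P)) != 0.
  have l0 : lead_coef p != 0 by rewrite lead_coef_eq0.
  have /H/negP : (size (\prod_(z <- r) ('X - z%:P))%R <= D.+1)%N.
    by move: sp; rewrite er size_scale.
  apply; apply/eqP/(scalerI l0); rewrite scaler0 -[RHS]e er /homogenize scaler_sumr.
  by apply: eq_bigr => i _; rewrite coefZ scalerA -er.
elim: r {er} => [|x r IH] D' sD.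
  rewrite big_nil /homogenize big_ord_recl big1 ?addr0 => [|i _].
    rewrite coef1 scale1r subn0 expr0 mulr1.
    by elim: D' {sD} => [|D' IH]; rewrite ?expr0 ?oner_eq0 // exprS neq0M.
  by rewrite coef1 scale0r.
move: sD; rewrite !size_prod_XsubC /= ltnS in IH *.
rewrite big_cons mulrC; case: D' => // D' sD.
rewrite homogenizeS; last by rewrite size_prod_XsubC.
apply: neq0M; first exact: IH.
apply/eqP => e0; have /ab[_ /eqP] : - x *: a + 1 *: b = 0.
  by rewrite scaleNr scale1r addrC.
by rewrite oner_eq0.
Qed.

Lemma indep_powers (a b : B) D (c : nat -> k) : indep a b ->
  \sum_(i < D.+1) c i *: (a ^+ (D - i) * b ^+ i) = 0 ->
  forall i, (i <= D)%N -> c i = 0.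
Proof.
move=> ab e i iD; have : \poly_(i < D.+1) c i = 0.
  apply: (indep_homogenize ab (size_poly _ _)); rewrite -[RHS]e.
  by apply: eq_bigr => j _; rewrite coef_poly ltn_ord.
by move=> /(congr1 (fun p : {poly k} => p`_i)); rewrite coef_poly ltnS iD coef0.
Qed.

Lemma indep_exp (a b : B) m : indep a b -> (0 < m)%N -> indep (a ^+ m) (b ^+ m).
Proof.
move=> ab m0 s t e; pose c i := if i == 0%N then s else if i == m then t else 0.
have H : forall i, (i <= m)%N -> c i = 0.
  apply: (indep_powers ab); case: m m0 e @c => // m _ e c.
  rewrite big_ord_recl big_ord_recr /= big1 ?add0r => [|i _].
    by rewrite /c /= /bump /= add1n eqxx subn0 subnn !expr0 mul1r mulr1.
  by rewrite /c /= /bump /= add1n eqSS ltn_eqF // scale0r.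
split; first by have := H 0%N; rewrite /c /=; apply.
by have := H m; rewrite /c eqxx -if_neg -lt0n m0; apply.
Qed.

Lemma geometric_indep (a b t : B) (e : nat -> B) D (c : nat -> k) : indep a b ->
  t != 0 -> (forall i, (i <= D)%N -> e i * a ^+ i = t * b ^+ i) ->
  \sum_(i < D.+1) c i *: e i = 0 -> forall i, (i <= D)%N -> c i = 0.
Proof.
move=> ab t0 ei e0; apply: (indep_powers ab).
have : t * \sum_(i < D.+1) c i *: (a ^+ (D - i) * b ^+ i) = 0.
  transitivity ((\sum_(i < D.+1) c i *: e i) * a ^+ D); last by rewrite e0 mul0r.
  rewrite mulr_sumr mulr_suml; apply: eq_bigr => i _.
  have iD : (i <= D)%N by rewrite -ltnS.
  rewrite -scalerAl -scalerAr; congr (_ *: _).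
  by rewrite mulrCA -ei // mulrCA -exprD subnK.
by case/dom => // /eqP; rewrite (negPf t0).
Qed.

End HomogeneousRelation.

Definition pos_part (n : int) : nat := if n is Posz m then m else 0%N.
Definition neg_part (n : int) : nat := if n is Negz m then m.+1 else 0%N.

Lemma pos_negE (n : int) : n = (pos_part n)%:Z - (neg_part n)%:Z.
Proof. by case: n => m /=; lia. Qed.

Lemma pair_mulrn (V : zmodType) (z : V) m : (z, 1 : int) *+ m = (z *+ m, m%:Z).
Proof.
by elim: m => // m IH; rewrite !mulrS IH.
Qed.

Section Relations.
Context (k : fieldType) (R : realType) (P : set 'rV[R]_2).
Local Notation kP := (kalg k P).
Local Notation mon := (mon k).
Context (h : {lrmorphism kP -> kP}).

Definition img (z : Z2) : kP := h (mon P (up z)).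

Lemma img_prod (s : seq (Z2 * int)) (e : int -> nat) :
  (forall p, p \in s -> latpts P p.1) ->
  semigrp P (\sum_(p <- s) up p.1 *+ e p.2) /\
  \prod_(p <- s) img p.1 ^+ e p.2 = h (mon P (\sum_(p <- s) up p.1 *+ e p.2)).
Proof.
elim: s => [|p s IH] sP.
  by rewrite !big_nil mon0 rmorph1; split=> //; apply: semigrp0.
have [q qs|gs es] := IH; first by apply: sP; rewrite inE qs orbT.
have gp : semigrp P (up p.1 *+ e p.2).
  by apply/semigrpMn/semigrp_gen/sP; rewrite inE eqxx.
rewrite !big_cons; split; first exact: semigrpD.
rewrite es monD // rmorphM /= monMn ?rmorphXn //.
by apply/semigrp_gen/sP; rewrite inE eqxx.
Qed.

(* An affine relation among lattice points is a binomial relation among their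
   images; signs are separated since inverses are not available in [k[P]]. *)
Lemma img_relation (s : seq (Z2 * int)) :
  (forall p, p \in s -> latpts P p.1) ->
  \sum_(p <- s) p.1 *~ p.2 = 0 -> \sum_(p <- s) p.2 = 0 ->
  \prod_(p <- s) img p.1 ^+ pos_part p.2 = \prod_(p <- s) img p.1 ^+ neg_part p.2.
Proof.
move=> sP s1 s2.
have [_ ->] := img_prod pos_part sP; have [_ ->] := img_prod neg_part sP.
congr (h (mon _ _)); apply/eqP; rewrite -subr_eq0 -sumrB; apply/eqP.
have key : forall t : seq (Z2 * int),
   \sum_(p <- t) (up p.1 *+ pos_part p.2 - up p.1 *+ neg_part p.2)
   = (\sum_(p <- t) p.1 *~ p.2, \sum_(p <- t) p.2).
  elim=> [|[z n] t IH]; first by rewrite !big_nil.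
  rewrite !big_cons {}IH /= !pair_mulrn; congr (_ + _, _ + _).
    by case: n => m; rewrite /= ?mulr0n ?subr0 ?sub0r ?NegzE ?mulrNz -?pmulrn.
  by rewrite [RHS]pos_negE.
by rewrite key s1 s2.
Qed.

End Relations.

Section DegreeOne.
Context (k : fieldType) (kc : alg_closed k) (R : realType) (P : set 'rV[R]_2).
Local Notation kP := (kalg k P).
Local Notation mon := (mon k).
Context (h : {lrmorphism kP -> kP}).
Local Notation img := (img h).

Lemma cancel_shuffle (B : comAlgType k) (a b a' b' x y x' y' : B) (c d c' d' : k) :
  a * (b * (x * (c *: y * (x' * (d *: y'))))) =
    a' * (b' * (y * (c' *: x * (y' * (d' *: x'))))) ->
  (c * d) *: (a * b) * (x * y * (x' * y')) =
    (c' * d') *: (a' * b') * (x * y * (x' * y')).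
Proof.
have sc (t : k) (f : B) : t *: f = (t *: 1) * f by rewrite -scalerAl mul1r.
move=> E; rewrite -!scalerA (sc c (d *: _)) (sc d) (sc c' (d' *: _)) (sc d').
rewrite (sc c y) (sc d y') (sc c' x) (sc d' x') in E.
transitivity (a * (b * (x * (c *: 1 * y * (x' * (d *: 1 * y')))))); first by ring.
by rewrite E; ring.
Qed.

Lemma kalg_mulI (f f' g : kP) : g != 0 -> f * g = f' * g -> f = f'.
Proof.
move=> g0 e; apply/eqP; rewrite -subr_eq0; apply/negP => /negP ff.
have := kalg_mul_neq0 ff g0; rewrite (_ : (f - f') * g = f * g - f' * g); last exact: mulrBl.
by rewrite e subrr eqxx.
Qed.

Lemma pos_partN n : pos_part (- n) = neg_part n.
Proof. by case: n => [[|m]|m]. Qed.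

Lemma neg_partN n : neg_part (- n) = pos_part n.
Proof. by case: n => [[|m]|m]. Qed.

Lemma pos_neg_cases (n : int) : n != 0 -> exists m : nat,
  pos_part n = m.+1 /\ neg_part n = 0%N \/ pos_part n = 0%N /\ neg_part n = m.+1.
Proof. by case: n => [[|m]|m] // _; exists m; [left | right]. Qed.

Lemma linear_dep (V : lmodType k) (s t : k) (f g : V) :
  s *: f = t *: g -> s *: f + (- t) *: g = 0.
Proof. by move=> ->; rewrite scaleNr subrr. Qed.

Lemma dep_transfer (x y x' y' z z' : Z2) (D a b : int) :
  (forall u, latpts P u -> img u != 0) ->
  latpts P x -> latpts P y -> latpts P x' -> latpts P y' ->
  latpts P z -> latpts P z' -> D != 0 ->
  (z' - z) *~ D = (y - x) *~ a + (y' - x') *~ b ->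
  ~ indep (img x) (img y) -> ~ indep (img x') (img y') ->
  ~ indep (img z) (img z').
Proof.
move=> nz xP yP x'P y'P zP z'P D0 e dxy dx'y' ind.
have [c c0 yx] := not_indepP (nz _ xP) (nz _ yP) dxy.
have [d d0 y'x'] := not_indepP (nz _ x'P) (nz _ y'P) dx'y'.
have cd n n' : c ^+ n * d ^+ n' != 0 by apply: mulf_neq0; apply: expf_neq0.
pose s : seq (Z2 * int) := [:: (z', D); (z, - D); (x, a); (y, - a); (x', b); (y', - b)].
have /(@img_relation _ _ _ h) : forall p, p \in s -> latpts P p.1.
  by move=> p; rewrite !inE => /orP[|/orP[|/orP[|/orP[|/orP[]]]]] /eqP->.
rewrite /s !big_cons !big_nil /= !mulr1 !pos_partN !neg_partN.
have -> : z' *~ D + (z *~ - D + (x *~ a + (y *~ - a + (x' *~ b + (y' *~ - b + 0))))) = 0.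
  have e0 := congr1 (fun v : Z2 => v 0 0) e; have e1 := congr1 (fun v : Z2 => v 0 1) e.
  rewrite /= !(mxE, intmxMzE) in e0 e1.
  by apply: row2P; rewrite !(mxE, intmxMzE); lra.
move/(_ erefl); rewrite (_ : D + _ = 0); last by lia.
move/(_ erefl); rewrite yx y'x' !exprZn.
set W := img x ^+ (pos_part a + neg_part a) * img x' ^+ (pos_part b + neg_part b).
have W0 : W != 0 by rewrite /W kalg_mul_neq0 // kalg_exp_neq0 // nz.
have key p q n p' q' n' : img z' ^+ p * (img z ^+ q * (img x ^+ pos_part a *
     (c ^+ n *: img x ^+ neg_part a * (img x' ^+ pos_part b *
     (d ^+ n' *: img x' ^+ neg_part b))))) =
   img z' ^+ p' * (img z ^+ q' * (img x ^+ neg_part a *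
     (c ^+ pos_part a *: img x ^+ pos_part a * (img x' ^+ neg_part b *
     (d ^+ pos_part b *: img x' ^+ pos_part b))))) ->
   (c ^+ n * d ^+ n') *: (img z' ^+ p * img z ^+ q) =
   (c ^+ pos_part a * d ^+ pos_part b) *: (img z' ^+ p' * img z ^+ q').
  by move=> E; apply: (kalg_mulI W0); rewrite /W !exprD; apply: cancel_shuffle.
move/key => E {key}.
have dom := @kalg_mul_eq0 k R P.
have [m [] [pD nD]] := pos_neg_cases D0; rewrite pD nD !expr0 ?mul1r ?mulr1 in E.
  have [_ /eqP] := indep_exp kc dom ind (ltn0Sn m) (linear_dep (esym E)).
  by rewrite oppr_eq0 (negPf (cd _ _)).
have [/eqP] := indep_exp kc dom ind (ltn0Sn m) (linear_dep E).
by rewrite (negPf (cd _ _)).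
Qed.

End DegreeOne.

(** * Lines carrying a base *)

Section DegreeOneMatrix.
Context (k : fieldType) (R : realType) (P : set 'rV[R]_2).
Local Notation kP := (kalg k P).
Local Notation mon := (mon k).
Context (h : {lrmorphism kP -> kP}) (hg : graded h) (hh : forall x, h (h x) = h x).
Context (L : seq Z2) (Lu : uniq L) (LP : forall z, z \in L <-> latpts P z).
Local Notation img := (img h).
Local Notation m := (size L).

Definition lpt (i : 'I_m) : Z2 := L`_i.

Lemma lptP i : latpts P (lpt i).
Proof. by apply/LP/mem_nth. Qed.

Lemma lpt_inj : injective lpt.
Proof. by move=> i j /eqP; rewrite nth_uniq // => /eqP/val_inj. Qed.

Lemma lpt_surj z : latpts P z -> exists i, lpt i = z.
Proof.
move=> /LP zL; have lt : (index z L < m)%N by rewrite index_mem.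
by exists (Ordinal lt); rewrite /lpt /= nth_index.
Qed.

Definition lin1 (v : 'rV[k]_m) : kP := \sum_j v 0 j *: mon P (up (lpt j)).

Lemma lin1_is_linear : linear lin1.
Proof.
move=> c u v; rewrite /lin1 scaler_sumr -big_split; apply: eq_bigr => j _ /=.
by rewrite !mxE scalerDl scalerA.
Qed.
HB.instance Definition _ := GRing.isLinear.Build k 'rV[k]_m kP _ lin1 lin1_is_linear.

Lemma kval_lin1 v : kval (lin1 v) = \sum_j v 0 j *: gmon k (up (lpt j)).
Proof.
rewrite kval_sum; apply: eq_bigr => j _; rewrite kvalZ kval_mon //.
exact/semigrp_gen/lptP.
Qed.

Lemma lin1_coef v j : (kval (lin1 v))@_(up (lpt j)) = v 0 j.
Proof.
rewrite (kval_lin1 v); apply: (@mcoeff_family k _ _ (fun j => v 0 j) (fun j => up (lpt j))) => i i'.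
by move=> /(congr1 fst)/lpt_inj.
Qed.

Lemma lin1_supp v u : (kval (lin1 v))@_u != 0 ->
  exists2 j, u = up (lpt j) & v 0 j != 0.
Proof.
move=> nz; suff [j e] : exists j, u = up (lpt j).
  by exists j => //; rewrite -lin1_coef -e.
by move: nz; rewrite (kval_lin1 v) => /(@mcoeff_family_supp _ _ _ _ (fun j => up (lpt j))).
Qed.

Lemma lin1_of (f : kP) : homog 1 f -> exists v, f = lin1 v.
Proof.
move=> f1; exists (\row_j (kval f)@_(up (lpt j))); apply/kval_inj/malgP => u.
have [f0|f0] := eqVneq (kval f)@_u 0.
  rewrite f0; apply/esym/eqP/negP => /negP /lin1_supp[j uj].
  by rewrite mxE -uj f0 eqxx.
have u2 := f1 _ f0; have uP := kval_support f0.
have [i ei] := lpt_surj (semigrp_deg1 uP u2).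
have -> : u = up (lpt i) by case: (u) u2 ei => a b /= -> ->.
by rewrite lin1_coef mxE.
Qed.

Lemma lin1_homog v : homog 1 (lin1 v).
Proof. by move=> u /lin1_supp[j ->]. Qed.

Lemma lin1_inj v : lin1 v = 0 -> v = 0.
Proof.
by move=> e; apply/rowP => j; rewrite -lin1_coef e kval0 gcoeff0 mxE.
Qed.

Lemma mon_homog z : latpts P z -> homog 1 (mon P (up z)).
Proof.
move=> zP u; rewrite kval_mon ?mcoeff_gmon; last exact: semigrp_gen.
by have [<- //|_] := eqVneq (up z) u; rewrite eqxx.
Qed.

Definition img_mx : 'M[k]_m := \matrix_(i, j) (kval (img (lpt i)))@_(up (lpt j)).
Local Notation M := img_mx.

Lemma img_homog z : latpts P z -> homog 1 (img z).
Proof. by move=> zP; apply/hg/mon_homog. Qed.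

Lemma lin1_row i : lin1 (row i M) = img (lpt i).
Proof.
have [v e] := lin1_of (img_homog (lptP i)); rewrite e; congr lin1.
by apply/rowP => j; rewrite !mxE e lin1_coef.
Qed.

Lemma lin1_mulM v : lin1 (v *m M) = h (lin1 v).
Proof.
rewrite mulmx_sum_row linear_sum [in RHS]/lin1 linear_sum; apply: eq_bigr => i _.
by rewrite linearZ [in RHS]linearZ /= lin1_row.
Qed.

Lemma row_mulM i : row i M *m M = row i M.
Proof.
have := lin1_mulM (row i M); rewrite lin1_row => e.
apply/eqP; rewrite -subr_eq0; apply/eqP/lin1_inj; rewrite linearB /= e lin1_row.
by rewrite /img hh subrr.
Qed.

Lemma lin1_fixed v : h (lin1 (v *m M)) = lin1 (v *m M).
Proof. by rewrite lin1_mulM hh. Qed.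

Local Notation rk := (\rank M).

Lemma rank_le_proj n (t : 'I_n -> Z2) :
  (forall v, v *m M != 0 -> exists i, (kval (lin1 (v *m M)))@_(up (t i)) != 0) ->
  (rk <= n)%N.
Proof.
move=> H; pose C : 'M[k]_(m, n) := \matrix_(i, j) (kval (img (lpt i)))@_(up (t j)).
apply: leq_trans (rank_leq_col C).
have : (kermx C <= kermx M)%MS.
  apply/rV_subP => v /sub_kermxP vC; apply/sub_kermxP/eqP/negP => /negP /H[j].
  rewrite lin1_mulM /lin1 linear_sum kval_sum mcoeff_sum /= => /eqP; apply.
  move/rowP: vC => /(_ j); rewrite !mxE => vC; rewrite -[RHS]vC.
  apply: eq_bigr => i _; rewrite linearZ /= gcoeffZ mxE //.
move/mxrankS; rewrite !mxrank_ker => le.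
by have := rank_leq_row M; have := rank_leq_row C; lia.
Qed.

Lemma indep_family_le n (t : 'I_n -> Z2) : (forall i, latpts P (t i)) ->
  (forall c : 'I_n -> k, \sum_i c i *: img (t i) = 0 -> forall i, c i = 0) ->
  (n <= rk)%N /\ (n = rk -> forall z, latpts P z ->
     exists c : 'I_n -> k, img z = \sum_i c i *: img (t i)).
Proof.
move=> tP ind; have /choice[f fP] : forall i, exists j, lpt j = t i.
  by move=> i; apply: lpt_surj.
pose S := rowsub f M.
have lS v : lin1 (v *m S) = \sum_i v 0 i *: img (t i).
  rewrite mulmx_sum_row linear_sum; apply: eq_bigr => i _.
  by rewrite linearZ /= row_rowsub lin1_row fP.
have rS : \rank S = n.
  apply/eqP; rewrite -[_ == _]/(row_free S) -kermx_eq0; apply/eqP/row_matrixP => i.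
  rewrite row0; apply/rowP => j; rewrite [RHS]mxE.
  have rk0 : row i (kermx S) *m S = 0 by rewrite -row_mul mulmx_ker row0.
  by apply: (ind (fun j => row i (kermx S) 0 j)); rewrite -lS rk0 linear0.
have SM : (S <= M)%MS by apply/row_subP => i; rewrite row_rowsub row_sub.
split; first by rewrite -rS mxrankS.
move=> nrk z zP; have [i <-] := lpt_surj zP.
have [_ eSM] := mxrank_leqif_sup SM.
have MS : (M <= S)%MS by rewrite -eSM rS nrk.
have /submxP[v rv] := submx_trans (row_sub i M) MS.
by exists (fun j => v 0 j); rewrite -lS -rv lin1_row.
Qed.

Lemma rank_le_span n (t : 'I_n -> Z2) : (forall i, latpts P (t i)) ->
  (forall z, latpts P z -> forall y, (kval (img z))@_(up y) != 0 ->
     exists i (s : k), img y = s *: img (t i)) ->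
  (rk <= n)%N.
Proof.
move=> tP H; have /choice[f fP] : forall i, exists j, lpt j = t i.
  by move=> i; apply: lpt_surj.
apply: leq_trans (rank_leq_row (rowsub f M)); apply: mxrankS; apply/row_subP => i.
rewrite -row_mulM mulmx_sum_row; apply: summx_sub => j _.
have [z0|z0] := eqVneq (row i M 0 j) 0; first by rewrite z0 scale0r sub0mx.
apply: scalemx_sub; rewrite !mxE in z0.
have [l [s e]] := H _ (lptP i) _ z0.
suff -> : row j M = s *: row (f l) M.
  by apply: scalemx_sub; rewrite -row_rowsub row_sub.
apply/eqP; rewrite -subr_eq0; apply/eqP/lin1_inj.
by rewrite linearB linearZ /= !lin1_row e fP subrr.
Qed.

Lemma rank_ge2 x y : latpts P x -> latpts P y -> indep (img x) (img y) -> (2 <= rk)%N.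
Proof.
move=> xP yP xy; pose t (i : 'I_2) := if i == 0 then x else y.
have tP i : latpts P (t i) by rewrite /t; case: ifP.
have [|le _] := indep_family_le tP; last exact: le.
move=> c; rewrite !big_ord_recl big_ord0 addr0 => /xy[c0 c1] i.
case: (unliftP 0 i) => [j|] -> //.
by rewrite (ord1 j).
Qed.

End DegreeOneMatrix.

Definition primitive (w : Z2) := exists a b : int, a * w 0 0 + b * w 0 1 = 1.

Lemma primitive_exists (v : Z2) : v != 0 -> exists w (e : int),
  [/\ primitive w, 0 < e & v = w *~ e].
Proof.
move=> v0; set a := v 0 0; set b := v 0 1; set e := gcdz a b.
have e0 : e != 0.
  apply: contra v0; rewrite gcdz_eq0 => /andP[/eqP a0 /eqP b0].
  by apply/eqP/row2P; rewrite mxE.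
have ea : (a %/ e)%Z * e = a by apply: divzK; apply: dvdz_gcdl.
have eb : (b %/ e)%Z * e = b by apply: divzK; apply: dvdz_gcdr.
exists (\row_j if j == 0 then (a %/ e)%Z else (b %/ e)%Z), e; split.
- have [s [t st]] := Bezoutz a b; exists s, t; rewrite !mxE /=.
  apply: (mulIf e0); rewrite mul1r mulrDl -!mulrA ea eb; exact: st.
- by rewrite lt_def e0 /e /gcdz.
by apply: row2P; rewrite intmxMzE mxE /= ?ea ?eb.
Qed.

Lemma primitive_neq0 w : primitive w -> w != 0.
Proof.
by move=> [a [b e]]; apply/eqP => w0; move: e; rewrite w0 !mxE !mulr0 addr0.
Qed.

Lemma on_line (a b : int) (w d : Z2) : a * w 0 0 + b * w 0 1 = 1 -> det2 w d = 0 ->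
  d = w *~ (a * d 0 0 + b * d 0 1).
Proof.
rewrite /det2 => e1 /eqP; rewrite subr_eq0 => /eqP e2.
apply: row2P; rewrite intmxMzE.
  rewrite -[LHS]mulr1 -e1; have -> : w 0 0 * (a * d 0 0 + b * d 0 1) =
    a * w 0 0 * d 0 0 + b * (w 0 0 * d 0 1) by ring.
  by rewrite e2; ring.
rewrite -[LHS]mulr1 -e1; have -> : w 0 1 * (a * d 0 0 + b * d 0 1) =
  a * (w 0 1 * d 0 0) + b * w 0 1 * d 0 1 by ring.
by rewrite -e2; ring.
Qed.

Lemma det2Mzl (a b : Z2) (m : int) : det2 (a *~ m) b = m * det2 a b.
Proof. by rewrite /det2 !intmxMzE; ring. Qed.

Lemma seq_argmin (T : eqType) (s : seq T) (f : T -> int) x : x \in s ->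
  exists2 y, y \in s & forall z, z \in s -> f y <= f z.
Proof.
elim: s x => // a s IH x _; case: s IH => [|b s] IH.
  by exists a; rewrite ?inE // => z; rewrite inE => /eqP->.
have [y ys ymin] := IH b (mem_head _ _).
have [le|lt] := leP (f a) (f y).
  exists a; rewrite ?mem_head // => z; rewrite inE => /orP[/eqP->//|/ymin].
  exact: le_trans.
exists y; first by rewrite inE ys orbT.
by move=> z; rewrite inE => /orP[/eqP->|/ymin //]; apply: ltW.
Qed.

Lemma line_extremes (P : Z2 -> Prop) (L : seq Z2) (w p : Z2) :
  (forall z, z \in L <-> P z) -> primitive w -> P p ->
  exists x (N : nat), [/\ P x, P (x + w *~ N), det2 w (x - p) = 0 &
    forall z, P z -> det2 w (z - p) = 0 -> exists2 i : nat, (i <= N)%N & z = x + w *~ i].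
Proof.
move=> LP [a [b ab]] pP; pose s (z : Z2) := a * (z - p) 0 0 + b * (z - p) 0 1.
pose S := [seq z <- L | det2 w (z - p) == 0].
have mS z : z \in S <-> P z /\ det2 w (z - p) = 0.
  by rewrite mem_filter; split=> [/andP[/eqP ? /LP]|[/LP-> ->]]; rewrite ?eqxx.
have vs z : z \in S -> w *~ s z = z - p.
  by move=> /mS[_ d]; rewrite -(on_line ab d).
have vs2 z z' : z \in S -> z' \in S -> z + w *~ (s z' - s z) = z'.
  move=> zS z'S; rewrite mulrzBr !vs // opprB [z' - p + _]addrA subrK.
  by rewrite [z + _]addrC subrK.
have pS : p \in S by apply/mS; rewrite subrr det20.
have [z1 z1S z1min] := seq_argmin s pS.
have [z2 z2S z2max] := seq_argmin (fun z => - s z) pS.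
have le12 : s z1 <= s z2 by apply: z1min.
exists z1, `|s z2 - s z1|%N; rewrite gez0_abs ?subr_ge0 // vs2 //.
have [z1P z1d] := (mS z1).1 z1S; have [z2P _] := (mS z2).1 z2S.
split=> // z zP d; have zS : z \in S by apply/mS.
have i1 := z1min _ zS; have i2 := z2max _ zS.
exists `|s z - s z1|%N; first by lia.
by rewrite gez0_abs ?subr_ge0 // vs2.
Qed.

Section Leads.
Context (k : fieldType) (kc : alg_closed k) (R : realType) (P : set 'rV[R]_2).
Local Notation kP := (kalg k P).
Context (h : {lrmorphism kP -> kP}) (hg : graded h) (hh : forall x, h (h x) = h x).
Context (h1 : codim h 1).
Context (L : seq Z2) (Lu : uniq L) (LP : forall z, z \in L <-> latpts P z).
Local Notation img := (img h).
Local Notation rk := (\rank (img_mx h L)).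

Lemma leads_collinear (w : Z3 -> int) (f g e : kP) x y z : additive_weight w ->
  h f = f -> h g = g -> h e = e -> lead w (kval f) (up x) ->
  lead w (kval g) (up y) -> lead w (kval e) (up z) -> det2 (y - x) (z - x) = 0.
Proof.
move=> wD hf hg' he lf lg le; apply/eqP/negP => /negP det.
apply: (no_three_free hh h1 hf hg' he) => M c; rewrite inE => /eqP c0.
pose T : finType := ('I_M * ('I_M * ('I_M * unit)))%type.
pose ex (p : T) : Z3 := up x *+ p.1 + (up y *+ p.2.1 + (up z *+ p.2.2.1 + 0)).
apply: (@lead_free k _ w T (fun p => kval (f ^+ p.1 * (g ^+ p.2.1 * (e ^+ p.2.2.1 * 1)))) ex).
- move=> p; rewrite !kvalM !kvalX kval1.
  by do 3! [apply: (lead_mul wD); first exact: (lead_exp wD)]; apply: lead1.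
- move=> [i [j [l []]]] [i' [j' [l' []]]]; rewrite /ex /up !pair_mulrn /= => -[exy e1].
  have mn (c' : int) n : c' *+ n = c' * n%:Z by rewrite -mulr_natr natz.
  have ei : i%:Z = i'%:Z + j'%:Z + l'%:Z - j%:Z - l%:Z by move: e1; rewrite /=; lia.
  have e0 : (j%:Z - j'%:Z) * (y 0 0 - x 0 0) + (l%:Z - l'%:Z) * (z 0 0 - x 0 0) = 0.
    have := congr1 (fun v : Z2 => v 0 0) exy; rewrite /= !(mxE, mulmxnE) !mn.
    by rewrite !addr0 ei; lra.
  have e2 : (j%:Z - j'%:Z) * (y 0 1 - x 0 1) + (l%:Z - l'%:Z) * (z 0 1 - x 0 1) = 0.
    have := congr1 (fun v : Z2 => v 0 1) exy; rewrite /= !(mxE, mulmxnE) !mn.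
    by rewrite !addr0 ei; lra.
  have dE : det2 (y - x) (z - x) = (y 0 0 - x 0 0) * (z 0 1 - x 0 1) -
     (y 0 1 - x 0 1) * (z 0 0 - x 0 0) by rewrite /det2 !mxE.
  have d1 : (j%:Z - j'%:Z) * det2 (y - x) (z - x) = 0.
    transitivity ((z 0 1 - x 0 1) * 0 - (z 0 0 - x 0 0) * 0 : int); last by ring.
    by rewrite -{1}e0 -e2 dE; ring.
  have d2 : (l%:Z - l'%:Z) * det2 (y - x) (z - x) = 0.
    transitivity ((y 0 0 - x 0 0) * 0 - (y 0 1 - x 0 1) * 0 : int); last by ring.
    by rewrite -{1}e2 -e0 dE; ring.
  move/eqP: d1; rewrite mulf_eq0 (negPf det) orbF => /eqP d1.
  move/eqP: d2; rewrite mulf_eq0 (negPf det) orbF => /eqP d2.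
  have jj : j = j' by apply: val_inj => /=; lia.
  have ll : l = l' by apply: val_inj => /=; lia.
  have ii : i = i' by apply: val_inj => /=; lia.
  by rewrite ii jj ll.
by move/(congr1 (@kval _ _ _ _)): c0; rewrite kval_sum kval0.
Qed.

Lemma lead_deg1 (w : Z3 -> int) (f : kP) :
  {in [seq up z | z <- L] &, injective w} -> homog 1 f -> f != 0 ->
  exists2 x, latpts P x & lead w (kval f) (up x).
Proof.
move=> winj f1 f0.
have supp u : u \in msupp (kval f) -> exists2 z, latpts P z & u = up z.
  rewrite -mcoeff_neq0 => nz; exists u.1.
    exact: (semigrp_deg1 (kval_support nz) (f1 _ nz)).
  by have := f1 _ nz; case: (u) => a b /= ->.
have [||u lu] := @lead_exists k _ w (kval f).
- by apply: contra f0 => /eqP e; apply/eqP/kval_inj; rewrite e kval0.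
- move=> u v /supp[z zP ->] /supp[z' z'P ->]; apply: winj; apply: map_f; exact/LP.
have [z zP uz] : exists2 z, latpts P z & u = up z.
  by apply: supp; rewrite -mcoeff_neq0; case: lu.
by exists z => //; rewrite -uz.
Qed.

Lemma lead_line (w : Z3 -> int) : additive_weight w ->
  {in [seq up z | z <- L] &, injective w} -> (1 < rk)%N ->
  exists x0 v (N : nat), [/\ primitive v, latpts P x0, latpts P (x0 + v *~ N),
    (rk <= N.+1)%N & forall f x, homog 1 f -> h f = f -> lead w (kval f) (up x) ->
      det2 v (x - x0) = 0].
Proof.
move=> wD winj rk1.
pose A (r : 'rV[k]_(size L)) := lin1 P (r *m img_mx h L).
have Ahom r : homog 1 (A r) by apply: lin1_homog.
have Afix r : h (A r) = A r by apply: lin1_fixed.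
have Anz r : r *m img_mx h L != 0 -> A r != 0.
  by apply: contra => /eqP; move/(lin1_inj Lu LP)->.
have [r0 r0n] : exists r : 'rV[k]_(size L), r *m img_mx h L != 0.
  apply: contrapT => no; have : img_mx h L = 0; last by move=> e; rewrite e mxrank0 in rk1.
  apply/row_matrixP => i; rewrite row0; apply/eqP/negP => /negP ni.
  by apply: no; exists (delta_mx 0 i); rewrite -rowE.
have [x xP lx] := lead_deg1 winj (Ahom r0) (Anz _ r0n).
have [r1 r1n [y yP [ly yx]]] : exists2 r : 'rV[k]_(size L), r *m img_mx h L != 0 &
    exists2 y, latpts P y & lead w (kval (A r)) (up y) /\ y != x.
  apply: contrapT => no; move: rk1; rewrite ltnNge => /negP; apply.
  apply: (@rank_le_proj _ _ _ h hg L Lu LP 1 (fun=> x)) => r rn; exists 0.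
  have [y yP ly] := lead_deg1 winj (Ahom r) (Anz _ rn).
  have [yx|yx] := eqVneq y x; first by rewrite -yx; case: ly.
  by case: no; exists r => //; exists y.
have [v [e [vprim e0 yxe]]] : exists v e, [/\ primitive v, 0 < e & y - x = v *~ e].
  by apply: primitive_exists; rewrite subr_eq0.
have line f z : homog 1 f -> h f = f -> lead w (kval f) (up z) -> det2 v (z - x) = 0.
  move=> f1 ff lf; have := leads_collinear wD (Afix r0) (Afix r1) ff lx ly lf.
  by rewrite yxe det2Mzl => /eqP; rewrite mulf_eq0 (gt_eqF e0) => /eqP.
have [x0 [N [x0P yP' d0 ext]]] := line_extremes LP vprim xP.
exists x0, v, N; split=> //.
  apply: (@rank_le_proj _ _ _ h hg L Lu LP _
    (fun i : 'I_N.+1 => x0 + v *~ i)) => r rn.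
  have [z zP lz] := lead_deg1 winj (Ahom r) (Anz _ rn).
  have [i iN zi] := ext z zP (line _ _ (Ahom r) (Afix r) lz).
  by exists (Ordinal (iN : (i < N.+1)%N)); rewrite /= -zi; case: lz.
move=> f z f1 ff lf; have d1 := line _ _ f1 ff lf.
rewrite -[z](subrK x) -addrA [x - x0](_ : _ = - (x0 - x)); last by rewrite opprB.
by rewrite det2D det2N d1 d0 oppr0 addr0.
Qed.

End Leads.

Section LineBase.
Context (k : fieldType) (kc : alg_closed k) (R : realType) (P : set 'rV[R]_2).
Context (Pl : lattice_polytope P).
Local Notation kP := (kalg k P).
Context (h : {lrmorphism kP -> kP}).
Local Notation img := (img h).

Lemma segment_relation x w (i : nat) : latpts P x -> latpts P (x + w) ->
  latpts P (x + w *~ i) -> img (x + w *~ i) * img x ^+ i = img x * img (x + w) ^+ i.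
Proof.
move=> xP yP zP.
pose s : seq (Z2 * int) := [:: (x + w *~ i, 1); (x, i : int); (x, -1); (x + w, - i%:Z)].
have /(@img_relation _ _ _ h) : forall p, p \in s -> latpts P p.1.
  by move=> p; rewrite !inE => /orP[|/orP[|/orP[]]] /eqP->.
rewrite /s !big_cons !big_nil !pos_partN !neg_partN /= !expr0 !expr1 !mul1r !mulr1; apply.
  by apply: row2P; rewrite !(mxE, intmxMzE); ring.
by lia.
Qed.

Definition line_base x w (N : nat) :=
  [/\ primitive w, (0 < N)%N, forall i : nat, (i <= N)%N -> latpts P (x + w *~ i),
    forall z, latpts P z -> det2 w (z - x) = 0 ->
      exists2 i : nat, (i <= N)%N & z = x + w *~ i &
    indep (img x) (img (x + w)) /\ forall z, latpts P z ->
      exists c : nat -> k, img z = \sum_(i < N.+1) c i *: img (x + w *~ i)].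

Context (hg : graded h) (hh : forall x, h (h x) = h x) (h1 : codim h 1).
Context (L : seq Z2) (Lu : uniq L) (LP : forall z, z \in L <-> latpts P z).
Local Notation rk := (\rank (img_mx h L)).

Section NonZero.
Context (nz : forall u, latpts P u -> img u != 0).

Lemma segment_indep x w (N : nat) (c : 'I_N.+1 -> k) : latpts P (x + w) ->
  (forall i : nat, (i <= N)%N -> latpts P (x + w *~ i)) -> indep (img x) (img (x + w)) ->
  \sum_i c i *: img (x + w *~ i) = 0 -> forall i, c i = 0.
Proof.
move=> yP sP ind e i.
have xP : latpts P x by have := sP 0%N isT; rewrite mulr0z addr0.
have H := @geometric_indep k kc kP (@kalg_mul_eq0 k R P) (img x) (img (x + w)) (img x)
   (fun i : nat => img (x + w *~ i)) N (fun i => c (inord i)) ind (nz xP).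
rewrite -[i]inord_val; apply: H; last by rewrite -ltnS.
  by move=> j jN; apply: segment_relation => //; apply: sP.
by rewrite -[RHS]e; apply: eq_bigr => j _; rewrite inord_val.
Qed.

Lemma segment_rank x w (N : nat) : (0 < N)%N ->
  (forall i : nat, (i <= N)%N -> latpts P (x + w *~ i)) -> indep (img x) (img (x + w)) ->
  (N.+1 <= rk)%N /\ (N.+1 = rk -> forall z, latpts P z ->
      exists c : 'I_N.+1 -> k, img z = \sum_i c i *: img (x + w *~ i)).
Proof.
move=> N0 sP ind; apply: (@indep_family_le _ _ _ h hg L Lu LP N.+1 (fun i => x + w *~ i)).
  by move=> i; apply: sP; rewrite -ltnS.
move=> c; apply: segment_indep => //.
by have := sP 1%N N0; rewrite mulr1z.
Qed.

Lemma line_base_criterion x w (N : nat) : primitive w -> (0 < N)%N ->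
  latpts P x -> latpts P (x + w *~ N) -> (rk <= N.+1)%N ->
  indep (img x) (img (x + w)) -> line_base x w N.
Proof.
move=> wprim N0 xP yP rkN ind.
have sP i : (i <= N)%N -> latpts P (x + w *~ i) by apply: (segment_latpts Pl).
have [le span] := segment_rank N0 sP ind.
split=> //; last first.
  split=> // z zP; have [|c ->] := span _ z zP; first by apply/eqP; rewrite eqn_leq le.
  by exists (fun i => c (inord i)); apply: eq_bigr => i _; rewrite inord_val.
move=> z zP d; have [a [b ab]] := wprim; have := on_line ab d.
set s := a * _ + _ => es; have {es d} ez : z = x + w *~ s by rewrite -es addrC subrK.
have [s0|s0] := leP 0 s; last first.
  have uP : latpts P (x - w).
    apply: (@lattice_convex _ P Pl 1 (- s - 1) 0 0 z x x x) => //; try lia.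
    by apply: row2P; rewrite ez !(mxE, intmxMzE); ring.
  have sP' i : (i <= N.+1)%N -> latpts P (x - w + w *~ i).
    apply: (segment_latpts Pl) => //; rewrite (_ : x - w + w *~ N.+1 = x + w *~ N) //.
    by rewrite intS mulrzDr mulr1z addrA subrK.
  have [|le' _] := segment_rank (ltn0Sn N) sP'; last by lia.
  rewrite subrK => s' t' e; apply: contrapT => nst.
  have ndep : ~ indep (img (x - w)) (img x) by move=> /(_ s' t' e).
  have xwP : latpts P (x + w) by have := sP 1%N N0; rewrite mulr1z.
  apply: (dep_transfer (D := 1) (a := 1) (b := 0) kc nz uP xP uP xP xP xwP _ _ ndep ndep ind) => //.
  by apply: row2P; rewrite !(mxE, intmxMzE); ring.
have [sN|sN] := leP s N; first by exists `|s|%N; [lia | rewrite gez0_abs].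
have zP' : latpts P (x + w *~ N.+1).
  have /= := @segment_latpts _ _ Pl x w `|s| N.+1 xP; apply; last by lia.
  by rewrite gez0_abs -?ez.
have [le' _] := segment_rank (ltn0Sn N) (fun i => segment_latpts Pl xP zP') ind.
by lia.
Qed.

Context (p q : Z2) (pP : latpts P p) (qP : latpts P q) (pq : indep (img p) (img q)).

Lemma indep_transversal x y z z' : latpts P x -> latpts P y -> latpts P z -> latpts P z' ->
  ~ indep (img x) (img y) -> det2 (y - x) (z' - z) != 0 -> indep (img z) (img z').
Proof.
move=> xP yP zP z'P nxy det; apply: contrapT => nzz'.
apply: (dep_transfer (a := det2 (q - p) (z' - z)) (b := det2 (y - x) (q - p))
  kc nz xP yP zP z'P pP qP det _ nxy nzz' pq).
by rewrite /det2; apply: row2P; rewrite !(mxE, intmxMzE); ring.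
Qed.

Lemma rk_gt1 : (1 < rk)%N. Proof. exact: (rank_ge2 hg Lu LP pP qP pq). Qed.

(* The leading exponents of [Im h] in degree one lie on a line, which carries a
   base unless its direction is [v], the only one along which images of lattice
   points can be proportional. *)
Lemma lead_line_or_parallel (w : Z3 -> int) (v : Z2) : additive_weight w ->
  {in [seq up z | z <- L] &, injective w} ->
  primitive v -> (forall z z', latpts P z -> latpts P z' -> det2 v (z' - z) != 0 ->
     indep (img z) (img z')) ->
  (exists x u N, line_base x u N) \/
  exists x (N : nat), [/\ latpts P x, forall i : nat, (i <= N)%N -> latpts P (x + v *~ i),
    (rk <= N.+1)%N & forall f z, homog 1 f -> h f = f -> lead w (kval f) (up z) ->
      det2 v z = det2 v x].
Proof.
move=> wD winj [a [b ab]] trans; have rk1 := rk_gt1.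
have [x [u [N [uprim xP yP rkN line]]]] := lead_line hg hh h1 Lu LP wD winj rk1.
have N0 : (0 < N)%N by lia.
have sP i : (i <= N)%N -> latpts P (x + u *~ i) by apply: (segment_latpts Pl).
have xuP : latpts P (x + u) by have := sP 1%N N0; rewrite mulr1z.
have [vu|vu] := eqVneq (det2 v u) 0; last first.
  left; exists x, u, N; apply: line_base_criterion => //; apply: trans => //.
  by rewrite addrAC subrr add0r.
right.
have uE := on_line ab vu; set s := a * _ + _ in uE.
have s1 : s = 1 \/ s = -1.
  have [a' [b' e]] := uprim; move: e; rewrite {1 2}uE !intmxMzE.
  move: (v 0 0) (v 0 1) => v0' v1' e.
  have /eqP : `|s| * `|a' * v0' + b' * v1'| = 1.
    by rewrite -normrM -[RHS](normr1 int) -e; congr `|_|; ring.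
  by rewrite -!abszE -PoszM eqz_nat muln_eq1 => /andP[/eqP]; lia.
have s0 : s != 0 by lia.
have lv f z : homog 1 f -> h f = f -> lead w (kval f) (up z) -> det2 v (z - x) = 0.
  move=> f1 ff lf; have := line _ _ f1 ff lf; rewrite uE det2Mzl => /eqP.
  by rewrite mulf_eq0 (negPf s0) => /eqP.
have lv' y f z : det2 v y = det2 v x -> homog 1 f -> h f = f ->
    lead w (kval f) (up z) -> det2 v z = det2 v y.
  by move=> yx f1 ff lf; have := lv _ _ f1 ff lf; rewrite det2B yx => /eqP; rewrite subr_eq0 => /eqP.
case: s1 => s1; move: uE; rewrite s1 ?mulr1z ?mulrN1z => uE.
  by exists x, N; split=> // [i|f z]; [rewrite -uE; apply: sP | apply: lv'].
exists (x + u *~ N), N; split=> //.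
  move=> i iN; have -> : x + u *~ N + v *~ i = x + u *~ (N - i)%N.
    by rewrite -(opprK v) -uE -subzn // mulrzBr mulNrz addrA.
  by apply: sP; rewrite leq_subr.
move=> f z; apply: lv'; rewrite det2D det2Mz uE det2N det2aa; lia.
Qed.

End NonZero.
End LineBase.

Section LineBaseExists.
Context (k : fieldType) (kc : alg_closed k) (R : realType) (P : set 'rV[R]_2).
Context (Pl : lattice_polytope P).
Local Notation kP := (kalg k P).
Context (h : {lrmorphism kP -> kP}) (hg : graded h) (hh : forall x, h (h x) = h x).
Context (h1 : codim h 1).
Context (L : seq Z2) (Lu : uniq L) (LP : forall z, z \in L <-> latpts P z).
Local Notation img := (img h).
Local Notation rk := (\rank (img_mx h L)).
Context (nz : forall u, latpts P u -> img u != 0).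
Context (p q : Z2) (pP : latpts P p) (qP : latpts P q) (pq : indep (img p) (img q)).

Lemma img_lead (w : Z3 -> int) z : {in [seq up z | z <- L] &, injective w} ->
  latpts P z -> exists2 x, latpts P x & lead w (kval (img z)) (up x).
Proof.
by move=> winj zP; apply: (lead_deg1 LP winj (img_homog hg zP) (nz zP)).
Qed.

Lemma line_base_exists : exists x w N, line_base h x w N.
Proof.
have [[x [y [xP yP xy nxy]]]|alli] := pselect (exists x y, [/\ latpts P x, latpts P y,
    x != y & ~ indep (img x) (img y)]); last first.
  have zD : additive_weight (fun _ : Z3 => 0 : int) by move=> ? ?; rewrite addr0.
  have [w [wD _ winj]] := weight_injective [seq up z | z <- L] zD.
  have [x [u [N [uprim xP yP rkN _]]]] := lead_line hg hh h1 Lu LP wD winj (rk_gt1 hg Lu LP pP qP pq).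
  have N0 : (0 < N)%N by have := rk_gt1 hg Lu LP pP qP pq; lia.
  exists x, u, N; apply: (line_base_criterion kc Pl hg Lu LP nz) => //.
  apply: contrapT => nind; apply: alli; exists x, (x + u); split=> //.
    by have := segment_latpts Pl xP yP N0; rewrite mulr1z.
  by rewrite -subr_eq0 opprD addrA subrr add0r oppr_eq0; apply: primitive_neq0.
have [w [e [wprim e0 we]]] : exists w e, [/\ primitive w, 0 < e & y - x = w *~ e].
  by apply: primitive_exists; rewrite subr_eq0 eq_sym.
have trans z z' : latpts P z -> latpts P z' -> det2 w (z' - z) != 0 -> indep (img z) (img z').
  move=> zP z'P d; apply: (indep_transversal kc nz pP qP pq xP yP zP z'P nxy).
  by rewrite we det2Mzl mulf_neq0 // gt_eqF.
have par z z' : latpts P z -> latpts P z' -> det2 w (z' - z) = 0 -> ~ indep (img z) (img z').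
  move=> zP z'P d; have [a [b ab]] := wprim.
  apply: (dep_transfer (D := e) (a := a * (z' - z) 0 0 + b * (z' - z) 0 1) (b := 0)
    kc nz xP yP xP yP zP z'P _ _ nxy nxy); first by rewrite gt_eqF.
  by rewrite we {1}(on_line ab d) mulr0z addr0 -!mulrzA mulrC.
pose w1 (u : Z3) := det2 w u.1; pose w2 (u : Z3) := - det2 w u.1.
have w1D : additive_weight w1 by move=> u v; rewrite /w1 det2D.
have w2D : additive_weight w2 by move=> u v; rewrite /w2 det2D opprD.
have [W1 [W1D W1l W1inj]] := weight_injective [seq up z | z <- L] w1D.
have [W2 [W2D W2l W2inj]] := weight_injective [seq up z | z <- L] w2D.
have upL z : latpts P z -> up z \in [seq up z | z <- L] by move=> /LP; apply: map_f.
have [//|[t [Nt [tP tsP rkt tline]]]] :=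
  lead_line_or_parallel kc Pl hg hh h1 Lu LP nz pP qP pq W1D W1inj wprim trans.
have [//|[d [Nd [dP dsP rkd dline]]]] :=
  lead_line_or_parallel kc Pl hg hh h1 Lu LP nz pP qP pq W2D W2inj wprim trans.
have rk1 := rk_gt1 hg Lu LP pP qP pq.
pose lo := det2 w d; pose hi := det2 w t.
have suppP z y' : latpts P z -> (kval (img z))@_(up y') != 0 ->
    [/\ latpts P y', lo <= det2 w y' & det2 w y' <= hi].
  move=> zP nzc; have y'P : latpts P y'.
    exact: (semigrp_deg1 (kval_support nzc)).
  split=> //.
    have [v vP lv] := img_lead W2inj zP; rewrite /lo -(dline _ _ (img_homog hg zP) (hh _) lv).
    rewrite leNgt; apply/negP => lt.
    have : W2 (up v) < W2 (up y') by apply: W2l; rewrite ?upL // /w2 /= ltrN2.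
    by rewrite ltNge (lead_le lv nzc).
  have [v vP lv] := img_lead W1inj zP; rewrite /hi -(tline _ _ (img_homog hg zP) (hh _) lv).
  rewrite leNgt; apply/negP => lt.
  have : W1 (up v) < W1 (up y') by apply: W1l; rewrite ?upL.
  by rewrite ltNge (lead_le lv nzc).
have lohi : lo <= hi.
  have [v vP lv] := img_lead W1inj pP; have [_] := suppP _ _ pP (proj1 lv).
  exact: le_trans.
have rklevels : (rk <= `|hi - lo|.+1)%N.
  have rep (i : 'I_(`|hi - lo|.+1)) : exists v, latpts P v /\
      ((exists2 v', latpts P v' & det2 w v' = lo + i%:Z) -> det2 w v = lo + i%:Z).
    have [[v vP ve]|no] := pselect (exists2 v', latpts P v' & det2 w v' = lo + i%:Z).
      by exists v.
    by exists x; split=> // /no.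
  have /choice[r rP] := rep.
  apply: (@rank_le_span _ _ _ h hg hh L Lu LP _ r) => [i|z zP y' nzc]; first by case: (rP i).
  have [y'P ylo yhi] := suppP _ _ zP nzc.
  have lt : (`|det2 w y' - lo| < `|hi - lo|.+1)%N by lia.
  have [vP vE] := rP (Ordinal lt); exists (Ordinal lt).
  have [|s _ es] := not_indepP (nz vP) (nz y'P); last by exists s.
  apply: par => //; rewrite det2B vE /=; first by lia.
  by exists y'; rewrite // gez0_abs ?subr_ge0 //; lia.
have [Nt0 Nd0] : (0 < Nt)%N /\ (0 < Nd)%N by lia.
have [a [b ab]] := wprim.
pose w' : Z2 := \row_j if j == 0 then - b else a.
have ww' : det2 w w' = 1 by rewrite /det2 !mxE /= -ab; ring.
pose s := det2 (t - d) w'; pose m := hi - lo.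
have m0 : 0 < m by rewrite /m; lia.
have tdE : t - d = w *~ s + w' *~ m.
  have -> : m = det2 w (t - d) by rewrite det2B.
  by rewrite -[LHS]mulr1z -ww' /s /det2; apply: row2P; rewrite !(mxE, intmxMzE); ring.
pose n := (rk.-1)%:Z; have nn : 0 < n by rewrite /n; lia.
have nm : n <= m by rewrite /n /m; lia.
have dwP : latpts P (d + w) by have := dsP 1%N Nd0; rewrite mulr1z.
have twP : latpts P (t + w) by have := tsP 1%N Nt0; rewrite mulr1z.
have [c cP] := intermediate_level Pl m0 (ltW nn) nm dP dwP tP twP tdE.
pose j := (c %% n)%Z; pose u := w' + w *~ (c %/ n)%Z.
have jn : 0 <= j /\ j < n by rewrite /j modz_ge0 ?gt_eqF // ltz_pmod.
have jP : latpts P (d + w *~ j).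
  have := dsP `|j|%N; rewrite gez0_abs; last by lia.
  by apply; rewrite /n in jn; lia.
have wu : det2 w u = 1 by rewrite /u det2D det2Mz det2aa mul0r addr0.
have uprim : primitive u.
  by exists (- w 0 1), (w 0 0); rewrite -wu /det2; ring.
have endP : latpts P (d + w *~ j + u *~ rk.-1).
  rewrite (_ : _ + _ = d + w' *~ n + w *~ c) //.
  have cE := divz_eq c n; rewrite -/j in cE.
  have cE' (X : int) : X * c = X * ((c %/ n)%Z * n + j) by rewrite -cE.
  by apply: row2P; rewrite /u /n !(mxE, intmxMzE) cE' /n; ring.
have rk0 : (0 < rk.-1)%N by lia.
exists (d + w *~ j), u, rk.-1; apply: (line_base_criterion kc Pl hg Lu LP nz) => //.
  by lia.
apply: trans => //; last by rewrite addrAC subrr add0r wu.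
by have := segment_latpts Pl jP endP rk0; rewrite mulr1z.
Qed.

End LineBaseExists.

(** * Retractions killing a lattice point *)

Section ZeroImage.
Context (k : fieldType) (kc : alg_closed k) (R : realType) (P : set 'rV[R]_2).
Context (Pl : lattice_polytope P).
Local Notation kP := (kalg k P).
Context (h : {lrmorphism kP -> kP}).
Context (L : seq Z2) (LP : forall z, z \in L <-> latpts P z).
Local Notation img := (img h).

Lemma img_neq0_relation (s : seq (Z2 * int)) z n :
  (forall p, p \in s -> latpts P p.1) ->
  \sum_(p <- s) p.1 *~ p.2 = 0 -> \sum_(p <- s) p.2 = 0 ->
  (forall p, p \in s -> p.2 < 0 -> img p.1 != 0) ->
  (z, n) \in s -> 0 < n -> img z != 0.
Proof.
move=> sP s1 s2 neg zs n0; apply/eqP => z0.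
have := img_relation h sP s1 s2; rewrite (big_rem _ zs) /=.
have -> : img z ^+ pos_part n = 0.
  by case: n n0 {zs} => [[|n]|n] // _; rewrite z0 expr0n.
rewrite mul0r => /esym/eqP; apply/negP.
elim: s neg {sP s1 s2 zs} => [|[y m] s IH] neg; first by rewrite big_nil oner_eq0.
rewrite big_cons; apply: kalg_mul_neq0; last first.
  by apply: IH => p ps; apply: neg; rewrite inE ps orbT.
case: m neg => m neg; first by rewrite expr0 oner_eq0.
by apply: kalg_exp_neq0; apply: (neg (y, Negz m)); rewrite ?mem_head.
Qed.

Lemma plucker (a b v : Z2) : v *~ det2 a b + a *~ det2 b v + b *~ det2 v a = 0.
Proof. by rewrite /det2; apply: row2P; rewrite !(mxE, intmxMzE); ring. Qed.

Lemma zero_image_line_aux p q z0 : latpts P p -> latpts P q -> indep (img p) (img q) ->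
  latpts P z0 -> img z0 = 0 -> 0 < det2 (q - p) (z0 - p) ->
  exists x w N, [/\ line_base h x w N, forall z, latpts P z -> 0 <= det2 w (z - x) &
    forall z, latpts P z -> det2 w (z - x) != 0 -> img z = 0].
Proof.
move=> pP qP pq z0P z00 d0; have [p0 q0] := indep_neq0 pq.
have neq0 z z' (m m' D : int) : latpts P z -> latpts P z' -> 0 < m ->
    (z - p) *~ m + (z' - p) *~ m' + (q - p) *~ D = 0 ->
    (m' < 0 -> img z' != 0) -> img z != 0.
  move=> zP z'P m0 e z'0.
  apply: (@img_neq0_relation [:: (z, m); (z', m'); (q, D); (p, - (m + m' + D))] z m) => //.
  - by move=> u; rewrite !inE => /orP[|/orP[|/orP[]]] /eqP->.
  - rewrite !big_cons big_nil /=; rewrite -[RHS]e.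
    by apply: row2P; rewrite !(mxE, intmxMzE); ring.
  - by rewrite !big_cons big_nil /=; ring.
  - move=> u; rewrite !inE => /orP[|/orP[|/orP[]]] /eqP-> /=; [|exact: z'0|by []|by []].
    by rewrite ltNge ltW.
  - by rewrite mem_head.
have pl z z' := plucker (z - p) (z' - p) (q - p).
have ge0 z : latpts P z -> 0 <= det2 (q - p) (z - p).
  move=> zP; rewrite leNgt; apply/negP => dz.
  have /eqP := z00; apply/negP.
  apply: (neq0 z0 z (- det2 (q - p) (z - p)) (det2 (q - p) (z0 - p)) (det2 (z0 - p) (z - p))) => //; first by lia.
    by rewrite -[RHS](pl z0 z) /det2; apply: row2P; rewrite !(mxE, intmxMzE); ring.
  by rewrite ltNge ltW.
have gt0 z : latpts P z -> 0 < det2 (q - p) (z - p) -> img z = 0.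
  move=> zP dz; apply/eqP/negP => /negP nz; have /eqP := z00; apply/negP.
  apply: (neq0 z0 z (det2 (q - p) (z - p)) (- det2 (q - p) (z0 - p)) (det2 (z - p) (z0 - p))) => //.
  rewrite -[RHS](pl z z0) /det2.
  by apply: row2P; rewrite !(mxE, intmxMzE); ring.
have qp : q - p != 0 by apply: contraTneq d0 => ->; rewrite /det2 !mxE !mul0r subrr ltxx.
have [w [e [wprim e0 we]]] := primitive_exists qp.
have [x [N [xP yP xd ext]]] := line_extremes LP wprim pP.
have dE z : det2 w (z - x) = det2 w (z - p).
  by rewrite -[RHS]subr0 -xd /det2 !mxE; ring.
have dE' z : det2 (q - p) (z - p) = e * det2 w (z - p) by rewrite we det2Mzl.
have sP i : (i <= N)%N -> latpts P (x + w *~ i) by apply: segment_latpts.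
have [i iN pi] : exists2 i : nat, (i <= N)%N & p = x + w *~ i by apply: ext; rewrite ?subrr ?det20.
have [j jN qj] : exists2 i : nat, (i <= N)%N & q = x + w *~ i.
  by apply: ext => //; rewrite we det2Mz det2aa mul0r.
have ij : i != j.
  by apply: contraNneq qp => ij; rewrite pi qj ij subrr.
have N0 : (0 < N)%N by lia.
have neq0_line z : latpts P z -> det2 w (z - p) = 0 -> img z != 0.
  move=> zP dz; have dz' : det2 (q - p) (z - p) = 0 by rewrite dE' dz mulr0.
  have [a [b ab]] := wprim; have zE := on_line ab dz; set m := a * _ + _ in zE.
  apply: (@img_neq0_relation [:: (z, e); (q, - m); (p, m - e)] z e) => //.
  - by move=> u; rewrite !inE => /orP[|/orP[]] /eqP->.
  - rewrite !big_cons big_nil /= addr0.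
    have -> : z *~ e + (q *~ - m + p *~ (m - e)) = (z - p) *~ e - (q - p) *~ m.
      by apply: row2P; rewrite !(mxE, intmxMzE); ring.
    by rewrite zE we -!mulrzA mulrC subrr.
  - by rewrite !big_cons big_nil /=; ring.
  - move=> u; rewrite !inE => /orP[|/orP[]] /eqP-> /=; [|by []|by []].
    by rewrite ltNge ltW.
  - by rewrite mem_head.
have xwP : latpts P (x + w) by have := sP 1%N N0; rewrite mulr1z.
have x0 : img x != 0 by apply: neq0_line.
have xw0 : img (x + w) != 0.
  by apply: neq0_line; rewrite // addrAC det2D xd det2aa addr0.
exists x, w, N; split.
- split=> //; first by move=> z zP; rewrite dE; apply: ext.
  split=> [|z zP]; last first.
    have [d|d] := eqVneq (det2 w (z - p)) 0; last first.
      exists (fun=> 0); rewrite big1 => [|l _]; last exact: scale0r.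
      by apply: gt0; rewrite // lt_def ge0 // dE' mulf_neq0 // gt_eqF.
    have [l lN ->] := ext z zP d; exists (fun l' => (l' == l)%:R).
    rewrite (bigD1 (Ordinal (lN : (l < N.+1)%N))) //= eqxx scale1r.
    rewrite big1 ?addr0 // => l' ll'; rewrite (_ : (_ == _) = false) ?scale0r //.
    by apply: negbTE; apply: contra ll' => /eqP e'; apply/eqP/val_inj.
  apply: contrapT => nind; have [g g0 xwE] := not_indepP x0 xw0 nind.
  have pw l : (l <= N)%N -> img (x + w *~ l) = g ^+ l *: img x.
    move=> lN; apply: (@kalg_mulI k R P _ _ (img x ^+ l)); first exact: kalg_exp_neq0.
    rewrite segment_relation //; last exact: sP.
    by rewrite xwE exprZn -scalerAr -scalerAl -exprS exprS.
  have gn l : g ^+ l != 0 by apply: expf_neq0.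
  have /pq[/eqP] : g ^+ j *: img p + - g ^+ i *: img q = 0.
    by rewrite pi qj !pw // !scalerA mulNr [g ^+ j * _]mulrC scaleNr subrr.
  by rewrite (negPf (gn _)).
- by move=> z zP; rewrite dE -(pmulr_rge0 _ e0) -dE'; apply: ge0.
move=> z zP; rewrite dE => d; apply: gt0 => //.
by rewrite lt_def ge0 // dE' mulf_neq0 // gt_eqF.
Qed.

Lemma zero_image_line p q z0 : latpts P p -> latpts P q -> indep (img p) (img q) ->
  latpts P z0 -> img z0 = 0 ->
  exists x w N, [/\ line_base h x w N, forall z, latpts P z -> 0 <= det2 w (z - x) &
    forall z, latpts P z -> det2 w (z - x) != 0 -> img z = 0].
Proof.
move=> pP qP pq z0P z00.
have [lt|gt|e] := ltgtP 0 (det2 (q - p) (z0 - p)).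
- exact: (zero_image_line_aux pP qP pq z0P z00 lt).
- apply: (zero_image_line_aux qP pP (indepC pq) z0P z00).
  by move: gt; rewrite /det2 !mxE; lra.
have [p0 q0] := indep_neq0 pq; suff : img z0 != 0 by rewrite z00 eqxx.
have qp : q - p != 0.
  apply/eqP => /eqP; rewrite subr_eq0 => /eqP qpE; have /pq[/eqP] : 1 *: img p + - 1 *: img q = 0.
    by rewrite qpE scale1r scaleN1r subrr.
  by rewrite oner_eq0.
have [w [d [[a [b ab]] d0 we]]] := primitive_exists qp.
have dz : det2 w (z0 - p) = 0.
  by move/eqP: e; rewrite we det2Mzl eq_sym mulf_eq0 gt_eqF // => /eqP.
have zE := on_line ab dz; set m := a * _ + _ in zE.
apply: (@img_neq0_relation [:: (z0, d); (q, - m); (p, m - d)] z0 d) => //.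
- by move=> u; rewrite !inE => /orP[|/orP[]] /eqP->.
- rewrite !big_cons big_nil /= addr0.
  have -> : z0 *~ d + (q *~ - m + p *~ (m - d)) = (z0 - p) *~ d - (q - p) *~ m.
    by apply: row2P; rewrite !(mxE, intmxMzE); ring.
  by rewrite zE we -!mulrzA mulrC subrr.
- by rewrite !big_cons big_nil /=; ring.
- move=> u; rewrite !inE => /orP[|/orP[]] /eqP-> /=; [|by []|by []].
  by rewrite ltNge ltW.
- by rewrite mem_head.
Qed.

End ZeroImage.

(** * The base cut out by a line *)

Section BaseOfRetraction.
Context (k : fieldType) (kc : alg_closed k) (R : realType) (P : set 'rV[R]_2).
Context (Pl : lattice_polytope P).
Local Notation kP := (kalg k P).
Local Notation mon := (mon k).
Context (h : {lrmorphism kP -> kP}) (hg : graded h).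
Local Notation img := (img h).
Local Notation pt := (@Defs.pt R 2).

Definition section (x w : Z2) : set 'rV[R]_2 :=
  (P `&` affine_space (pt x) <[pt w]>)%classic.

Lemma latpts_section x w z : w != 0 ->
  latpts (section x w) z <-> latpts P z /\ det2 w (z - x) = 0.
Proof.
move=> w0; split=> [[zP]|[zP d]]; last by split=> //; apply: det2_eq0_line.
rewrite /affine_space /= => /vlineP[r e]; split=> //.
have E j : (z 0 j)%:~R - (x 0 j)%:~R = r * (w 0 j)%:~R :> R.
  by have := congr1 (fun v : 'rV[R]_2 => v 0 j) e; rewrite !mxE.
have : (det2 w (z - x))%:~R = 0 :> R.
  by rewrite /det2 !mxE !(rmorphB, rmorphM) /= !E; ring.
by move/eqP; rewrite intr_eq0 => /eqP.
Qed.

Lemma semigrp_section x w u : semigrp (section x w) u -> semigrp P u.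
Proof. by case=> s sQ ->; exists s => // z /sQ[]. Qed.

Section Base.
Context (x w : Z2) (N : nat) (B : line_base h x w N).
Local Notation Q := (section x w).

Definition point_on (d s : nat) : Z3 := (x *~ d + w *~ s, d%:Z).

Let wprim : primitive w. Proof. by case: B. Qed.
Let w0 : w != 0. Proof. exact: primitive_neq0 wprim. Qed.
Let N0 : (0 < N)%N. Proof. by case: B. Qed.

Lemma base_latpts i : (i <= N)%N -> latpts Q (x + w *~ i).
Proof.
move=> iN; apply/(latpts_section _ _ w0); split; first by case: B => _ _ + _ _; apply.
by rewrite addrAC subrr add0r det2Mz det2aa mul0r.
Qed.

Lemma base_latptsP z : latpts Q z -> exists2 i : nat, (i <= N)%N & z = x + w *~ i.
Proof. by move/(latpts_section _ _ w0) => [zP d]; case: B => _ _ _ + _; apply. Qed.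

Lemma base_semigrpP u : semigrp Q u ->
  exists d s : nat, (s <= d * N)%N /\ u = point_on d s.
Proof.
elim/semigrp_ind: u / => [|z u zQ _ [d [s [sd ->]]]].
  by exists 0%N, 0%N; split=> //; rewrite /point_on !mulr0z addr0.
have [i iN ->] := base_latptsP zQ; exists d.+1, (i + s)%N; split.
  by rewrite mulSn leq_add.
apply: injective_projections; last exact: intS.
by rewrite /= intS PoszD !mulrzDr mulr1z addrACA.
Qed.

Lemma base_semigrp d s : (s <= d * N)%N -> semigrp Q (point_on d s).
Proof.
elim: d s => [|d IH] s.
  by rewrite leqn0 => /eqP->; rewrite /point_on !mulr0z addr0; apply: semigrp0.
rewrite mulSn => sd.
have [i [iN isd ils]] : exists i, [/\ (i <= N)%N, (s - i <= d * N)%N & (i <= s)%N].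
  by have [le|lt] := leqP s N; [exists s | exists N]; split; lia.
have -> : point_on d.+1 s = up (x + w *~ i) + point_on d (s - i).
  apply: injective_projections; last exact: intS.
  rewrite /= -subzn // intS (mulrzDr x) mulr1z mulrzBr addrACA; congr (_ + _).
  by rewrite addrCA subrr addr0.
by apply: semigrpD; [apply/semigrp_gen/base_latpts | apply: IH].
Qed.

Lemma base_relation d s : (s <= d * N)%N ->
  h (mon P (point_on d s)) * img x ^+ s = img x ^+ d * img (x + w) ^+ s.
Proof.
move=> sd; have uP := semigrp_section (base_semigrp sd).
have xP : semigrp P (up x).
  by apply/semigrp_section/semigrp_gen; have := @base_latpts 0 isT; rewrite mulr0z addr0; apply.
have yP : semigrp P (up (x + w)).
  by apply/semigrp_section/semigrp_gen; have := base_latpts N0; rewrite mulr1z; apply.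
have e : point_on d s + up x *+ s = up x *+ d + up (x + w) *+ s.
  rewrite /up !pair_mulrn; congr pair => /=.
  by rewrite -!pmulrn mulrnDl addrAC addrA.
have := congr1 (fun u => h (mon P u)) e.
rewrite /= monD //; last exact: semigrpMn.
rewrite [in RHS]monD //; [|exact: semigrpMn..].
by rewrite !monMn // !rmorphM !rmorphXn.
Qed.

Lemma graded_avoids (f : kP) (d : int) :
  (forall v, (kval f)@_v != 0 -> v.2 != d) ->
  forall v, (kval (h f))@_v != 0 -> v.2 != d.
Proof.
move=> fd v; rewrite (kalgE f) linear_sum kval_sum mcoeff_sum => nz.
have [u [uf nzu]] : exists u, (kval f)@_u != 0 /\ (kval (h (mon P u)))@_v != 0.
  apply: contrapT => no; case/eqP: nz; apply: big1_seq => u /= uf.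
  rewrite linearZ; apply/eqP/negP => /negP nzu; apply: no; exists u.
  split; first by rewrite mcoeff_neq0.
  move: nzu; rewrite (_ : kval _ = (kval f)@_u *: kval (h (mon P u))) //.
  by rewrite gcoeffZ mulf_eq0 negb_or => /andP[].
have -> : v.2 = u.2; last exact: fd.
apply: hg nzu => u'; rewrite kval_mon; last exact: kval_support uf.
by rewrite mcoeff_gmon; have [<- //|_] := eqVneq u u'; rewrite eqxx.
Qed.

Lemma base_injective (f : kP) : kval f \in kalg_pred Q -> h f = 0 -> f = 0.
Proof.
move=> /asboolP fQ hf; apply/kval_inj/malgP => v; rewrite kval0 gcoeff0.
apply/eqP/negP => /negP nzv; have [d [s0 [s0d ev]]] := base_semigrpP (fQ _ nzv).
pose e (s : 'I_(d * N).+1) := point_on d s.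
have einj : injective e.
  move=> s s' /(congr1 fst) /addrI /eqP; rewrite -subr_eq0 -mulrzBr => es.
  apply/val_inj/eqP; move: es; case: (eqVneq (s : nat) s') => // ss' es.
  case/negP: w0; apply/eqP/row2P; rewrite mxE; apply/eqP.
    have := congr1 (fun v : Z2 => v 0 0) (eqP es); rewrite intmxMzE mxE => /eqP.
    by rewrite mulf_eq0 => /orP[//|/eqP]; lia.
  have := congr1 (fun v : Z2 => v 0 1) (eqP es); rewrite intmxMzE mxE => /eqP.
  by rewrite mulf_eq0 => /orP[//|/eqP]; lia.
pose c (s : nat) := (kval f)@_(point_on d s).
pose g : kP := \sum_(s < (d * N).+1) c s *: mon P (e s).
have eQ s : semigrp P (e s) by apply/semigrp_section/base_semigrp; rewrite -ltnS.
have gE : kval g = \sum_(s < (d * N).+1) c s *: gmon k (e s).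
  by rewrite kval_sum; apply: eq_bigr => s _; rewrite kvalZ kval_mon.
have gc s : (kval g)@_(e s) = c s by rewrite gE (mcoeff_family (fun s : 'I_(d * N).+1 => c s) s einj).
have gs u : (kval g)@_u != 0 -> exists s, u = e s by rewrite gE; apply: mcoeff_family_supp.
have ghom : homog d%:Z g by move=> u /gs[s ->].
have fg u : (kval (f - g))@_u != 0 -> u.2 != d%:Z.
  rewrite (_ : (kval (f - g))@_u = (kval f)@_u - (kval g)@_u); last exact: mcoeffB.
  move=> nz; apply/eqP => ud; case/eqP: nz.
  have [fu|fu] := eqVneq (kval f)@_u 0.
    have [gu|/gs[s us]] := eqVneq (kval g)@_u 0; first by rewrite fu gu subrr.
    by move: fu; rewrite us gc /c => ->; rewrite subrr.
  have [d' [s [sd us]]] := base_semigrpP (fQ _ fu).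
  have dd : d' = d by move: ud; rewrite us /= => -[].
  rewrite dd in sd us.
  by rewrite us -[point_on d s]/(e (Ordinal (sd : (s < (d * N).+1)%N))) gc subrr.
have hg0 : h g = 0.
  apply/kval_inj/malgP => u; rewrite kval0 gcoeff0; apply/eqP/negP => /negP nzu.
  have /eqP ud := hg ghom nzu; have := graded_avoids fg (v := u).
  rewrite ud => /(_ _)/negP; apply=> //.
  rewrite rmorphB /= hf sub0r; rewrite (_ : _@_u = - (kval (h g))@_u); last exact: mcoeffN.
  by rewrite oppr_eq0.
have [_ _ _ _ [ind _]] := B; have [x0 _] := indep_neq0 ind.
have c0 : forall i, (i <= d * N)%N -> c i = 0.
  apply: (@geometric_indep k kc kP (@kalg_mul_eq0 k R P) (img x) (img (x + w)) (img x ^+ d)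
    (fun i => h (mon P (point_on d i))) (d * N) c ind); first exact: kalg_exp_neq0.
    by move=> i /base_relation.
  by rewrite -[RHS]hg0 linear_sum; apply: eq_bigr => s _; rewrite linearZ.
by move: nzv; rewrite ev -/(c s0) c0 ?eqxx.
Qed.

Lemma base_injective2 (f g : kP) : kval f \in kalg_pred Q ->
  kval g \in kalg_pred Q -> h f = h g -> f = g.
Proof.
move=> fQ gQ e; apply/eqP; rewrite -subr_eq0; apply/eqP/base_injective.
  have [_ cl _] := kalg_subalg_closed k Q.
  rewrite (_ : kval (f - g) = -1 *: kval g + kval f); first exact: cl.
  by rewrite scaleN1r addrC.
by rewrite rmorphB /= e subrr.
Qed.

Lemma base_mon i : (i <= N)%N -> kval (mon P (up (x + w *~ i))) \in kalg_pred Q.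
Proof.
move=> iN; have iQ := base_latpts iN; apply/asboolP => u.
rewrite kval_mon ?mcoeff_gmon; last by apply/semigrp_section/semigrp_gen/iQ.
have [<- _|_] := eqVneq (up (x + w *~ i)) u; last by rewrite eqxx.
exact: semigrp_gen.
Qed.

Lemma base_pred_sum (I : Type) (r : seq I) (p : pred I) (F : I -> kP) :
  (forall i, p i -> kval (F i) \in kalg_pred Q) ->
  kval (\sum_(i <- r | p i) F i) \in kalg_pred Q.
Proof.
move=> H; have [one cl _] := kalg_subalg_closed k Q.
rewrite kval_sum; apply: (big_ind (fun f => f \in kalg_pred Q)) => //.
  by have := cl (-1) _ _ one one; rewrite scaleN1r addNr.
by move=> f g fQ gQ; have := cl 1 _ _ fQ gQ; rewrite scale1r.
Qed.

Lemma base_predZ (c : k) (f : kP) : kval f \in kalg_pred Q ->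
  kval (c *: f) \in kalg_pred Q.
Proof.
move=> fQ; have [one cl _] := kalg_subalg_closed k Q.
have z : (0 : grpalg k Z3) \in kalg_pred Q by have := cl (-1) _ _ one one; rewrite scaleN1r addNr.
rewrite kvalZ -[_ *: _]addr0; exact: cl.
Qed.

Lemma base_image z : latpts P z -> exists c : nat -> k,
  h (\sum_(i < N.+1) c i *: mon P (up (x + w *~ i))) = img z.
Proof.
move=> zP; have [_ _ _ _ [_ /(_ z zP)[c ->]]] := B; exists c.
by rewrite linear_sum; apply: eq_bigr => i _; rewrite linearZ.
Qed.

Lemma base_combination (c : nat -> k) :
  kval (\sum_(i < N.+1) c i *: mon P (up (x + w *~ i))) \in kalg_pred Q.
Proof.
apply: base_pred_sum => i _; apply: base_predZ; apply: base_mon.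
by rewrite -ltnS.
Qed.

Lemma base_surjective a : exists2 f : kP, kval f \in kalg_pred Q & h f = h a.
Proof.
have [one cl mul] := kalg_subalg_closed k Q.
have /choice[F FP] : forall u, exists f : kP, semigrp P u ->
    kval f \in kalg_pred Q /\ h f = h (mon P u).
  move=> u; have [uP|nu] := pselect (semigrp P u); last by exists 0.
  suff [f [fQ fu]] : exists f : kP, kval f \in kalg_pred Q /\ h f = h (mon P u) by exists f.
  elim/semigrp_ind: u / uP => [|z u zP uP [f [fQ fu]]].
    by exists 1; rewrite kval1 mon0.
  have [c cz] := base_image zP; set g := \sum_(i < _) _ in cz.
  exists (g * f); split; first by rewrite kvalM; apply: mul => //; apply: base_combination.
  rewrite rmorphM /= cz fu -rmorphM monD //; exact: semigrp_gen.
exists (\sum_(u <- msupp (kval a)) (kval a)@_u *: F u).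
  rewrite big_seq; apply: base_pred_sum => u ua; apply: base_predZ.
  have uP : semigrp P u by apply: (@kval_support _ _ _ _ a); rewrite mcoeff_neq0.
  by have [] := FP u uP.
rewrite [in RHS](kalgE a) !linear_sum; apply: eq_big_seq => u ua; rewrite !linearZ /=.
have uP : semigrp P u by apply: (@kval_support _ _ _ _ a); rewrite mcoeff_neq0.
by have [_ ->] := FP u uP.
Qed.

Lemma base_set_bij : set_bij (@subalg k R 2 P Q) (range h) h.
Proof.
split.
- by move=> f _; exists f.
- by move=> f g /set_mem fQ /set_mem gQ; apply: base_injective2.
by move=> _ [a _ <-]; have [f fQ fa] := base_surjective a; exists f.
Qed.

End Base.
End BaseOfRetraction.

Section SectionGeometry.
Context (R : realType) (P : set 'rV[R]_2) (Pl : lattice_polytope P).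
Local Notation pt := (@Defs.pt R 2).
Context (x w : Z2) (a b : int) (ab : a * w 0 0 + b * w 0 1 = 1).
Local Notation Q := (section P x w).

Lemma primitive_ab : primitive w. Proof. by exists a, b. Qed.
Let w0 : w != 0. Proof. exact: primitive_neq0 primitive_ab. Qed.
Let abR : a%:~R * (w 0 0)%:~R + b%:~R * (w 0 1)%:~R = 1 :> R.
Proof. by rewrite -!rmorphM -rmorphD /= ab. Qed.

Definition detR (p : 'rV[R]_2) : R :=
  (w 0 0)%:~R * (p 0 1 - (x 0 1)%:~R) - (w 0 1)%:~R * (p 0 0 - (x 0 0)%:~R).
Definition coordR (p : 'rV[R]_2) : R :=
  a%:~R * (p 0 0 - (x 0 0)%:~R) + b%:~R * (p 0 1 - (x 0 1)%:~R).

Lemma on_lineR p : detR p = 0 -> p = pt x + coordR p *: pt w.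
Proof.
rewrite /detR => d; apply: row2P; rewrite !mxE /coordR.
  set X := p 0 0 - _ in d *; set Y := p 0 1 - _ in d *.
  rewrite -[LHS](subrK (x 0 0)%:~R) -/X addrC; congr (_ + _).
  transitivity (X * (a%:~R * (w 0 0)%:~R + b%:~R * (w 0 1)%:~R)); first by rewrite abR mulr1.
  set W0 := (w 0 0)%:~R in d *; set W1 := (w 0 1)%:~R in d *.
  transitivity (a%:~R * X * W0 + b%:~R * (W1 * X)); first by ring.
  by move/eqP: d; rewrite subr_eq0 => /eqP <-; ring.
set X := p 0 0 - _ in d *; set Y := p 0 1 - _ in d *.
rewrite -[LHS](subrK (x 0 1)%:~R) -/Y addrC; congr (_ + _).
transitivity (Y * (a%:~R * (w 0 0)%:~R + b%:~R * (w 0 1)%:~R)); first by rewrite abR mulr1.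
set W0 := (w 0 0)%:~R in d *; set W1 := (w 0 1)%:~R in d *.
transitivity (a%:~R * (W0 * Y) + b%:~R * Y * W1); first by ring.
by move/eqP: d; rewrite subr_eq0 => /eqP ->; ring.
Qed.

Lemma mem_line p : (p - pt x \in <[pt w]>%VS) <-> detR p = 0.
Proof.
split=> [/vlineP[r e]|/on_lineR ->]; last by rewrite addrAC subrr add0r memvZ ?memv_line.
have E j : p 0 j - (x 0 j)%:~R = r * (w 0 j)%:~R :> R.
  by have := congr1 (fun v : 'rV[R]_2 => v 0 j) e; rewrite !mxE.
by rewrite /detR !E; ring.
Qed.

Lemma sectionP p : Q p <-> P p /\ detR p = 0.
Proof. by split=> -[pP /mem_line]. Qed.

Lemma has_dim_section : latpts P x -> latpts P (x + w) -> has_dim Q 1.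
Proof.
move=> xP yP.
have xQ : Q (pt x) by split=> //; rewrite /affine_space /= subrr mem0v.
have yQ : Q (pt (x + w)).
  by split=> //; rewrite /affine_space /= ptD addrAC subrr add0r memv_line.
split; first by exists (pt x).
exists (pt x), <[pt w]>%VS; split=> [||p' U' sub p].
- rewrite dim_vline; case: eqP => // e; case/eqP: w0; apply/row2P; rewrite mxE.
    by have /eqP := congr1 (fun v : 'rV[R]_2 => v 0 0) e; rewrite !mxE intr_eq0 => /eqP.
  by have /eqP := congr1 (fun v : 'rV[R]_2 => v 0 1) e; rewrite !mxE intr_eq0 => /eqP.
- by move=> p [].
rewrite /affine_space /= => /vlineP[r e]; have := sub _ xQ; have := sub _ yQ.
rewrite /affine_space /= => yU xU.
have wU : pt w \in U'.
  have -> : pt w = (pt (x + w) - p') - (pt x - p'); last exact: memvB.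
  by apply/rowP => j; rewrite !mxE rmorphD /=; ring.
by rewrite -[p](subrK (pt x)) e -addrA memvD // memvZ.
Qed.

Lemma polytope_slope (K C : int) :
  (forall z, latpts P z -> 0 <= a * (z - x) 0 0 + b * (z - x) 0 1 + K * det2 w (z - x) + C) ->
  forall p, P p -> 0 <= coordR p + K%:~R * detR p + C%:~R.
Proof.
move=> H p pP.
pose A := a - K * w 0 1; pose B := b + K * w 0 0.
pose D := C - A * x 0 0 - B * x 0 1.
have := polytope_ge0 Pl (a := A) (b := B) (c := D).
have H' z : latpts P z -> 0 <= A * z 0 0 + B * z 0 1 + D.
  move=> /H; rewrite /det2 !mxE; congr (0 <= _); rewrite /A /B /D /A /B; ring.
move=> /(_ H' p pP); congr (0 <= _); rewrite /A /B /D /A /B /coordR /detR.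
by rewrite !(rmorphB, rmorphD, rmorphM) /=; ring.
Qed.

Lemma polytope_slopeN (K C : int) :
  (forall z, latpts P z -> 0 <= - (a * (z - x) 0 0 + b * (z - x) 0 1) + K * det2 w (z - x) + C) ->
  forall p, P p -> 0 <= - coordR p + K%:~R * detR p + C%:~R.
Proof.
move=> H p pP.
pose A := - a - K * w 0 1; pose B := - b + K * w 0 0.
pose D := C - A * x 0 0 - B * x 0 1.
have := polytope_ge0 Pl (a := A) (b := B) (c := D).
have H' z : latpts P z -> 0 <= A * z 0 0 + B * z 0 1 + D.
  move=> /H; rewrite /det2 !mxE; congr (0 <= _); rewrite /A /B /D /A /B; ring.
move=> /(_ H' p pP); congr (0 <= _); rewrite /A /B /D /A /B /coordR /detR.
by rewrite !(rmorphB, rmorphD, rmorphN, rmorphM) /=; ring.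
Qed.

Lemma section_hull (N : nat) (K1 K2 : int) : (0 < N)%N ->
  latpts P x -> latpts P (x + w *~ N) ->
  (forall z, latpts P z -> 0 <= a * (z - x) 0 0 + b * (z - x) 0 1 + K1 * det2 w (z - x)) ->
  (forall z, latpts P z -> a * (z - x) 0 0 + b * (z - x) 0 1 + K2 * det2 w (z - x) <= N%:Z) ->
  Q = conv_hull (map pt [:: x; x + w *~ N]).
Proof.
move=> N0 xP yP lo hi; apply/seteqP; split=> p.
  move=> /sectionP[pP d].
  have r0 : 0 <= coordR p.
    have := @polytope_slope K1 0 _ p pP; rewrite d mulr0 !addr0; apply=> z zP.
    by rewrite addr0; apply: lo.
  have rN : coordR p <= N%:R.
    have := @polytope_slopeN (- K2) N _ p pP; rewrite d mulr0 addr0 addrC subr_ge0 -pmulrn.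
    by apply=> z zP; have := hi z zP; lia.
  have NR : N%:R != 0 :> R by rewrite pnatr_eq0 -lt0n.
  exists (fun i : 'I_2 => if i == 0 then 1 - coordR p / N%:R else coordR p / N%:R).
  split=> [i||].
  - case: ifP => _; last by rewrite divr_ge0.
    by rewrite subr_ge0 ler_pdivrMr ?mul1r // ltr0n.
  - by rewrite !big_ord_recl big_ord0 /= addr0 subrK.
  rewrite !big_ord_recl big_ord0 /= addr0 [LHS](on_lineR d) ptD ptMz -pmulrn scalerDr scalerA.
  by rewrite divfK // addrA -scalerDl subrK scale1r.
move=> [c [c0 c1 ->]]; split.
  apply: polytope_convex => // i; have xs := @conv_hull_vertex.
  by case: i => -[|[|i]] //.
rewrite !big_ord_recl big_ord0 /= addr0 in c1.
apply/mem_line; rewrite !big_ord_recl big_ord0 /= addr0.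
rewrite /detR !mxE.
have -> : c ord0 = 1 - c (lift ord0 ord0) by rewrite -c1 addrK.
by rewrite !intmxMzE !(rmorphD, rmorphM) /= -?pmulrn; ring.
Qed.

Lemma section_facet : has_dim P 2 -> latpts P x -> latpts P (x + w) ->
  (forall z, latpts P z -> 0 <= det2 w (z - x)) -> facet P Q.
Proof.
move=> dP xP yP ge0; split; last by exists 1%N; split=> //; apply: has_dim_section.
have mulE (p : 'rV[R]_2) : (p *m \col_j (if j == 0 then (w 0 1)%:~R else - (w 0 0)%:~R)) 0 0 =
    p 0 0 * (w 0 1)%:~R - p 0 1 * (w 0 0)%:~R.
  rewrite mxE !big_ord_recl big_ord0 addr0 (_ : lift ord0 ord0 = 1); last exact/val_inj.
  by rewrite !mxE /= mulrN.
exists (\col_j (if j == 0 then (w 0 1)%:~R else - (w 0 0)%:~R)),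
  ((x 0 0)%:~R * (w 0 1)%:~R - (x 0 1)%:~R * (w 0 0)%:~R); split=> [p pP|].
  rewrite mulE -subr_ge0.
  have := polytope_ge0 Pl (a := - w 0 1) (b := w 0 0) (c := w 0 1 * x 0 0 - w 0 0 * x 0 1).
  have H z : latpts P z -> 0 <= - w 0 1 * z 0 0 + w 0 0 * z 0 1 + (w 0 1 * x 0 0 - w 0 0 * x 0 1).
    by move/ge0; rewrite /det2 !mxE; congr (0 <= _); ring.
  move=> /(_ H p pP); congr (0 <= _).
  by rewrite !(rmorphB, rmorphN, rmorphM) /=; ring.
apply/seteqP; split=> p.
  move=> /sectionP[pP d]; split=> //=; rewrite mulE; apply/eqP; rewrite -subr_eq0 -oppr_eq0.
  by apply/eqP; rewrite -[RHS]d /detR; ring.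
move=> [pP /=]; rewrite mulE => e; apply/sectionP; split=> //.
by move/eqP: e; rewrite -subr_eq0 -oppr_eq0 => /eqP e; rewrite -[RHS]e /detR; ring.
Qed.

Lemma section_hyperplane : hyperplane (affine_space (pt x) <[pt w]>%VS).
Proof.
exists (pt x), <[pt w]>%VS; split=> //; rewrite dim_vline; case: eqP => // e.
case/eqP: w0; apply/row2P; rewrite mxE.
  by have /eqP := congr1 (fun v : 'rV[R]_2 => v 0 0) e; rewrite !mxE intr_eq0 => /eqP.
by have /eqP := congr1 (fun v : 'rV[R]_2 => v 0 1) e; rewrite !mxE intr_eq0 => /eqP.
Qed.

End SectionGeometry.

Lemma prod4 (A : comNzRingType) (I : Type) (F : I -> A) i1 i2 i3 i4 :
  \prod_(i <- [:: i1; i2; i3; i4]) F i = F i1 * (F i2 * (F i3 * F i4)).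
Proof. by rewrite !big_cons big_nil mulr1. Qed.

Lemma gmon_comb (k : fieldType) (G : zmodType) (u v : G) (m n : nat) :
  gmon k (u *+ m + v *+ n) = gmon k u ^+ m * gmon k v ^+ n.
Proof. by rewrite gmonD !gmonMn. Qed.

(** * Retractions killing no lattice point *)

Section NonzeroStructure.
Context (k : fieldType) (kc : alg_closed k) (R : realType) (P : set 'rV[R]_2).
Context (Pl : lattice_polytope P).
Local Notation kP := (kalg k P).
Local Notation mon := (mon k).

Lemma dual_vector (w : Z2) : primitive w -> exists w', det2 w w' = 1.
Proof.
move=> [a [b ab]]; exists (\row_j if j == 0 then - b else a).
by rewrite /det2 !mxE /= -ab; ring.
Qed.

Lemma dual_decomposition (w w' d : Z2) : det2 w w' = 1 ->
  d = w *~ det2 d w' + w' *~ det2 w d.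
Proof.
move=> e; rewrite -[LHS]mulr1z -e /det2.
by apply: row2P; rewrite !(mxE, intmxMzE); ring.
Qed.

Lemma level_one x w z : primitive w -> latpts P x -> latpts P (x + w) -> latpts P z ->
  0 < det2 w (z - x) -> exists2 z1, latpts P z1 & det2 w (z1 - x) = 1.
Proof.
move=> /dual_vector[w' ww'] xP yP zP; have := dual_decomposition (z - x) ww'.
set s := det2 (z - x) w'; set j := det2 w (z - x) => zE j0.
pose l := ((s + (j - 1)) %/ j)%Z; pose r := j * l - s.
have [r0 rj] : 0 <= r /\ r < j.
  have := divz_eq (s + (j - 1)) j; rewrite -/l => E.
  have := modz_ge0 (s + (j - 1)) (lt0r_neq0 j0).
  have := ltz_pmod (s + (j - 1)) j0.
  by rewrite /r mulrC; lia.
exists (x + w *~ l + w'); last first.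
  by rewrite -ww' /det2 !(mxE, intmxMzE); ring.
apply: (lattice_convex Pl (n1 := 1) (n2 := j - 1 - r) (n3 := r) (n4 := 0)
  (x1 := z) (x2 := x) (x3 := x + w) (x4 := x)) => //; try lia.
have E i : z 0 i = x 0 i + w 0 i * s + w' 0 i * j.
  have := congr1 (fun v : Z2 => v 0 i) zE; rewrite /= !(mxE, intmxMzE) => e.
  by rewrite -addrA -e; ring.
by apply: row2P; rewrite !(mxE, intmxMzE) E /r; ring.
Qed.

Context (h : {lrmorphism kP -> kP}) (hg : graded h).
Local Notation img := (img h).

Lemma line_base_rev x w N : line_base h x w N ->
  (forall z, latpts P z -> img z != 0) -> line_base h (x + w *~ N) (- w) N.
Proof.
move=> [[a [b ab]] N0 sP ext [ind span]] nz.
have eE i : (i <= N)%N -> x + w *~ N + - w *~ i = x + w *~ (N - i)%N.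
  by move=> iN; rewrite -subzn // mulrzBr mulNrz addrA.
have xP : latpts P x by have := sP 0%N isT; rewrite mulr0z addr0.
have yP : latpts P (x + w) by have := sP 1%N N0; rewrite mulr1z.
split=> //.
- by exists (- a), (- b); rewrite !mxE !mulrNN.
- by move=> i iN; rewrite eE //; apply: sP; rewrite leq_subr.
- move=> z zP d; have [|i iN ->] := ext z zP.
    by move: d; rewrite /det2 !(mxE, intmxMzE) => d; rewrite -[RHS]oppr0 -d; ring.
  by exists (N - i)%N; rewrite ?leq_subr // eE ?leq_subr // subKn.
split=> [|z zP].
  apply: contrapT => nind; apply: (dep_transfer (D := 1) (a := -1) (b := 0) kc nz
    (x := x + w *~ N) (y := x + w *~ N - w) (x' := x) (y' := x) (z := x) (z' := x + w)) => //.
  - exact: sP.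
  - by have := eE 1%N N0; rewrite mulr1z => ->; apply: sP; rewrite leq_subr.
  - by apply: row2P; rewrite !(mxE, intmxMzE); ring.
  - move=> ind2; have /ind2[/eqP] : 1 *: img x + -1 *: img x = 0.
      by rewrite scale1r scaleN1r subrr.
    by rewrite oner_eq0.
have [c ->] := span z zP; exists (fun i => c (N - i)%N).
rewrite (reindex_inj rev_ord_inj) /=; apply: eq_bigr => i _.
by rewrite subSS eE // -ltnS.
Qed.

Context (nz : forall z, latpts P z -> img z != 0).
Context (x w : Z2) (N : nat) (B : line_base h x w N).
Context (a b : int) (ab : a * w 0 0 + b * w 0 1 = 1).
Context (z1 : Z2) (z1P : latpts P z1) (z1lev : det2 w (z1 - x) = 1).
Local Notation Q := (section P x w).
Local Notation lev z := (det2 w (z - x)).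

Definition line_sum (c : nat -> k) : kP := \sum_(i < N.+1) c i *: mon P (up (x + w *~ i)).

Lemma line_sum_kval c : kval (line_sum c) =
  \sum_(i < N.+1) c i *: gmon k (up (x + w *~ i)).
Proof.
rewrite kval_sum; apply: eq_bigr => i _; rewrite kvalZ kval_mon //.
apply/semigrp_gen; have [_ _ sP _ _] := B; apply: sP.
by rewrite -ltnS.
Qed.

Lemma line_point_inj : injective (fun i : 'I_N.+1 => up (x + w *~ i)).
Proof.
move=> i i' /(congr1 fst) /addrI e; apply/val_inj/eqP; rewrite -eqz_nat.
rewrite -[X in X == _]mul1r -[X in _ == X]mul1r -ab !mulrDl -!mulrA.
by have e0 := congr1 (fun v : Z2 => v 0 0) e; have e1 := congr1 (fun v : Z2 => v 0 1) e;
   rewrite !intmxMzE in e0 e1; rewrite e0 e1.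
Qed.

Lemma line_sum_coef c (i : 'I_N.+1) : (kval (line_sum c))@_(up (x + w *~ i)) = c i.
Proof.
by rewrite line_sum_kval (mcoeff_family (fun i : 'I_N.+1 => c i) i line_point_inj).
Qed.

Lemma line_sum_supp c u : (kval (line_sum c))@_u != 0 ->
  exists2 i : nat, (i <= N)%N & u = up (x + w *~ i) /\ c i != 0.
Proof.
move=> nzu; have [i ui] : exists i : 'I_N.+1, u = up (x + w *~ i).
  by move: nzu; rewrite line_sum_kval; apply: mcoeff_family_supp.
exists i; first by rewrite -ltnS.
by split=> //; rewrite -line_sum_coef -ui.
Qed.

(* The element of [k[Q]] representing [h z] modulo the kernel of [h]. *)
Definition represents (q : Z2 -> kP) := forall z, latpts P z ->
  h (q z) = img z /\ exists c, q z = line_sum c.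

Lemma represents_exists : exists q, represents q.
Proof.
suff /choice[q qP] : forall z, exists f : kP, latpts P z ->
    h f = img z /\ exists c, f = line_sum c by exists q.
move=> z; have [zP|zP] := pselect (latpts P z); last by exists 0.
have [c cz] := base_image B zP; exists (line_sum c) => _; split=> //.
by exists c.
Qed.

Context (q : Z2 -> kP) (qP : represents q).

Lemma q_pred z : latpts P z -> kval (q z) \in kalg_pred Q.
Proof. by move=> /qP[_ [c ->]]; apply: (base_combination B c). Qed.

Lemma q_prod_pred (s : seq (Z2 * int)) (e : int -> nat) :
  (forall p, p \in s -> latpts P p.1) ->
  kval (\prod_(p <- s) q p.1 ^+ e p.2) \in kalg_pred Q.
Proof.
have [one cl mul] := kalg_subalg_closed k Q.
elim: s => [|p s IH] sP; first by rewrite big_nil kval1.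
rewrite big_cons kvalM; apply: (mul _ _ _ _); last first.
  by apply: IH => p' ps; apply: sP; rewrite inE ps orbT.
have pQ : kval (q p.1) \in kalg_pred Q by apply/q_pred/sP; rewrite inE eqxx.
elim: (e p.2) => [|m IHm]; first by rewrite expr0 kval1.
by rewrite exprS kvalM; apply: mul.
Qed.

Lemma q_prod_img (s : seq (Z2 * int)) (e : int -> nat) :
  (forall p, p \in s -> latpts P p.1) ->
  h (\prod_(p <- s) q p.1 ^+ e p.2) = \prod_(p <- s) img p.1 ^+ e p.2.
Proof.
move=> sP; rewrite rmorph_prod; apply: eq_big_seq => p ps.
by rewrite rmorphXn /=; have [-> _] := qP (sP p ps).
Qed.

Lemma q_relation (s : seq (Z2 * int)) :
  (forall p, p \in s -> latpts P p.1) ->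
  \sum_(p <- s) p.1 *~ p.2 = 0 -> \sum_(p <- s) p.2 = 0 ->
  \prod_(p <- s) q p.1 ^+ pos_part p.2 = \prod_(p <- s) q p.1 ^+ neg_part p.2.
Proof.
move=> sP s1 s2; apply: (base_injective2 kc hg B); try exact: q_prod_pred.
by rewrite !q_prod_img //; apply: img_relation.
Qed.

Lemma q_line (i : nat) : (i <= N)%N -> q (x + w *~ i) = mon P (up (x + w *~ i)).
Proof.
move=> iN; have [_ _ sP _ _] := B; have iP := sP i iN.
apply: (base_injective2 kc hg B); [exact: q_pred | exact: (base_mon B iN) |].
by have [-> _] := qP iP.
Qed.

Definition along z : int :=
  a * (z - x - (z1 - x) *~ lev z) 0 0 + b * (z - x - (z1 - x) *~ lev z) 0 1.

Lemma along_decomposition z : z = x + w *~ along z + (z1 - x) *~ lev z.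
Proof.
have d : det2 w (z - x - (z1 - x) *~ lev z) = 0.
  by rewrite (det2B w (z - x)) det2Mz z1lev mul1r subrr.
rewrite /along -(on_line ab d) -addrA subrK.
by rewrite addrC subrK.
Qed.

Lemma q_formula z : latpts P z ->
  kval (q z) * kval (q z1) ^+ neg_part (lev z) *
    gmon k (up x *+ pos_part (lev z + along z - 1) + up (x + w) *+ neg_part (along z)) =
  kval (q z1) ^+ pos_part (lev z) *
    gmon k (up x *+ neg_part (lev z + along z - 1) + up (x + w) *+ pos_part (along z)).
Proof.
move=> zP; have [_ N0 sP _ _] := B.
have xP : latpts P x by have := sP 0%N isT; rewrite mulr0z addr0.
have yP : latpts P (x + w) by have := sP 1%N N0; rewrite mulr1z.
have xq : q x = mon P (up x) by have := @q_line 0 isT; rewrite mulr0z addr0.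
have yq : q (x + w) = mon P (up (x + w)) by have := q_line N0; rewrite mulr1z.
set j := lev z; set i := along z; have zE := along_decomposition z.
rewrite -/i -/j in zE.
pose s : seq (Z2 * int) := [:: (z, 1); (z1, - j); (x, j + i - 1); (x + w, - i)].
have sPp : forall p, p \in s -> latpts P p.1.
  by move=> p; rewrite !inE => /orP[|/orP[|/orP[]]] /eqP->.
have s1 : \sum_(p <- s) p.1 *~ p.2 = 0.
  have E j' : z 0 j' = x 0 j' + w 0 j' * i + (z1 0 j' - x 0 j') * j.
    by have := congr1 (fun v : Z2 => v 0 j') zE; rewrite /= !(mxE, intmxMzE).
  rewrite !big_cons big_nil; apply: row2P; rewrite !(mxE, intmxMzE) /= E; ring.
have s2 : \sum_(p <- s) p.2 = 0 by rewrite !big_cons big_nil /=; ring.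
have kP4 (u v v' v'' : kP) : kval (u * (v * (v' * v''))) = kval u * (kval v * (kval v' * kval v'')).
  by [].
have := congr1 (@kval _ _ _ _) (q_relation sPp s1 s2); rewrite /s !prod4 !kP4 !kvalX.
rewrite xq yq (kval_mon k (semigrp_gen xP)) (kval_mon k (semigrp_gen yP)).
rewrite !pos_partN !neg_partN [pos_part 1]/= [neg_part 1]/= expr1 expr0 mul1r => e.
rewrite (gmon_comb k (up x) (up (x + w)) (pos_part (j + i - 1)) (neg_part i)).
rewrite (gmon_comb k (up x) (up (x + w)) (neg_part (j + i - 1)) (pos_part i)).
exact: (etrans (esym (mulrA _ _ _)) e).
Qed.

Definition chi (eps : int) (u : Z3) : int := eps * (a * u.1 0 0 + b * u.1 0 1).

Lemma chiD eps : additive_weight (chi eps).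
Proof. by move=> u v; rewrite /chi /= !mxE; ring. Qed.

Lemma chi_line eps (i : int) : chi eps (up (x + w *~ i)) = chi eps (up x) + eps * i.
Proof.
rewrite /chi /= !(mxE, intmxMzE) -[in RHS](mulr1 i) -ab; ring.
Qed.

Lemma line_lead eps z : eps != 0 -> latpts P z -> exists2 m : nat, (m <= N)%N &
  lead (chi eps) (kval (q z)) (up (x + w *~ m)).
Proof.
move=> e0 zP; have [hq [c qc]] := qP zP.
have [||u lu] := @lead_exists k _ (chi eps) (kval (q z)).
- apply/eqP => e; have /eqP := nz zP; apply; rewrite -hq.
  by rewrite (_ : q z = 0) ?rmorph0 //; apply: kval_inj; rewrite e kval0.
- move=> u v; rewrite -!mcoeff_neq0 qc => /line_sum_supp[i _ [-> _]] /line_sum_supp[j _ [-> _]].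
  by rewrite !chi_line => /addrI/(mulfI e0)[->].
have := proj1 lu; rewrite {1}qc => /line_sum_supp[m mN [um _]].
by exists m; rewrite -?um.
Qed.

Lemma lead_formula eps z (m l : nat) : latpts P z ->
  lead (chi eps) (kval (q z)) (up (x + w *~ m)) ->
  lead (chi eps) (kval (q z1)) (up (x + w *~ l)) ->
  m%:Z = along z + l%:Z * lev z.
Proof.
move=> zP lz l1; have wD := chiD eps.
have := lead_mul wD (lead_mul wD lz (lead_exp wD (neg_part (lev z)) l1)) (lead_gmon k (chi eps)
  (up x *+ pos_part (lev z + along z - 1) + up (x + w) *+ neg_part (along z))).
rewrite (q_formula zP) => /lead_uniq H.
have {H} := H _ (lead_mul wD (lead_exp wD (pos_part (lev z)) l1) (lead_gmon k (chi eps)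
  (up x *+ neg_part (lev z + along z - 1) + up (x + w) *+ pos_part (along z)))).
move/(congr1 (chi 1)); set i := along z; set j := lev z.
rewrite !chiD !(weightMn (chiD 1)) !chi_line (_ : chi 1 (up (x + w)) = chi 1 (up x) + 1); last first.
  by have := chi_line 1 1; rewrite mulr1z mul1r.
have mn (c' : int) n : c' *+ n = c' * n%:Z by rewrite -mulr_natr natz.
rewrite !mn; set X := chi 1 (up x); rewrite !mul1r.
have pj := pos_negE j; have pi := pos_negE i; have pji := pos_negE (j + i - 1).
set p1 := (pos_part j)%:Z in pj *; set n1 := (neg_part j)%:Z in pj *.
set p2 := (pos_part i)%:Z in pi *; set n2 := (neg_part i)%:Z in pi *.
set p3 := (pos_part _)%:Z in pji *; set n3 := (neg_part _)%:Z in pji *.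
move=> e; apply/eqP; rewrite -subr_eq0; apply/eqP.
have e3 : p3 = n3 + j + i - 1 by lra.
by move: e; rewrite e3 pj pi => e; lra.
Qed.

Lemma slopes : exists l1 l2 : nat, [/\ forall z, latpts P z ->
    [/\ 0 <= along z + l1%:Z * lev z,
      along z + l1%:Z * lev z <= along z + l2%:Z * lev z &
      along z + l2%:Z * lev z <= N%:Z] &
  exists c, q z1 = line_sum c /\ forall i : nat, (i <= N)%N -> c i != 0 -> (l1 <= i <= l2)%N].
Proof.
have [l2 l2N lead2] := @line_lead 1 z1 isT z1P.
have [l1 l1N lead1'] := @line_lead (-1) z1 isT z1P.
exists l1, l2; split=> [z zP|].
  have [m2 m2N lz2] := @line_lead 1 z isT zP; have [m1 m1N lz1] := @line_lead (-1) z isT zP.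
  rewrite -(lead_formula zP lz2 lead2) -(lead_formula zP lz1 lead1').
  by have := lead_le lz2 (proj1 lz1); rewrite !chi_line; split; lia.
have [_ [c qc]] := qP z1P; exists c; split=> // i iN ci.
have nzi : (kval (q z1))@_(up (x + w *~ i)) != 0.
  by rewrite qc (line_sum_coef c (Ordinal (iN : (i < N.+1)%N))).
by have := lead_le lead1' nzi; have := lead_le lead2 nzi; rewrite !chi_line; lia.
Qed.

End NonzeroStructure.

Section Shift.
Context (k : fieldType) (G : zmodType) (lev : G -> int) (levD : additive_weight lev).
Context (n : nat) (v : 'I_n -> G) (vlev : forall l, lev (v l) = -1).
Implicit Types (c : 'I_n -> k) (u : G).

Definition shift_sum c : grpalg k G := \sum_l c l *: gmon k (v l).
Definition shift c u : grpalg k G := (1 + shift_sum c) ^+ `|lev u|%N * gmon k u.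

Lemma shift_sumD c d : shift_sum (fun l => c l + d l) = shift_sum c + shift_sum d.
Proof. by rewrite -big_split; apply: eq_bigr => l _; rewrite scalerDl. Qed.

Lemma shift_sum0 c : (forall l, c l = 0) -> shift_sum c = 0.
Proof. by move=> c0; apply: big1 => l _; rewrite c0 scale0r. Qed.

Lemma shift_sum_gmon c u : shift_sum c * gmon k u = \sum_l c l *: gmon k (u + v l).
Proof.
rewrite /shift_sum mulr_suml; apply: eq_bigr => l _.
by rewrite -scalerAl -gmonD addrC.
Qed.

Lemma shiftS (f : grpalg k G) c u i : (f + shift_sum c) ^+ i.+1 * gmon k u =
  f * ((f + shift_sum c) ^+ i * gmon k u) + \sum_l c l *: ((f + shift_sum c) ^+ i * gmon k (u + v l)).
Proof.
rewrite exprS -mulrA mulrDl; congr (_ + _).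
by rewrite mulrCA shift_sum_gmon mulr_sumr; apply: eq_bigr => l _; rewrite scalerAr.
Qed.

Lemma linext_comb (m : G -> grpalg k G) (f : grpalg k G) (F : 'I_n -> grpalg k G) c :
  linext m (f + \sum_l c l *: F l) = linext m f + \sum_l c l *: linext m (F l).
Proof.
rewrite [LHS]linearD; congr (_ + _); rewrite [LHS]linear_sum.
by apply: eq_bigr => l _; rewrite [LHS]linearZ.
Qed.

Lemma shift_linext c d i u : i%:Z <= lev u ->
  linext (shift c) ((1 + shift_sum d) ^+ i * gmon k u) =
  (1 + shift_sum c + shift_sum d) ^+ i * ((1 + shift_sum c) ^+ (`|lev u| - i) * gmon k u).
Proof.
elim: i u => [|i IH] u iu.
  by rewrite !expr0 !mul1r subn0 linext_gmon.
rewrite shiftS mul1r linext_comb IH; last by lia.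
have -> : (`|lev u| - i = (`|lev u| - i.+1).+1)%N by lia.
set p := 1 + shift_sum c; set m := (`|lev u| - i.+1)%N.
rewrite (eq_bigr (fun l => p ^+ m * ((p + shift_sum d) ^+ i * (d l *: gmon k (u + v l))))).
  rewrite -!mulr_sumr -shift_sum_gmon; set g := gmon k u; set s := shift_sum d.
  by rewrite !exprS; ring.
move=> l _; rewrite IH; last by rewrite levD vlev; lia.
have -> : (`|lev (u + v l)| - i = m)%N by rewrite levD vlev /m; lia.
by rewrite -!scalerAr mulrCA.
Qed.

Lemma shift_shift c d e u : 0 <= lev u -> (forall l, e l = c l + d l) ->
  linext (shift c) (shift d u) = shift e u.
Proof.
move=> u0 ecd.
have S : shift_sum e = shift_sum c + shift_sum d.
  by rewrite -shift_sumD; congr shift_sum; apply/funext => l.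
have ui : `|lev u|%N%:Z <= lev u by rewrite gez0_abs.
have H := shift_linext c d ui.
rewrite subnn expr0 (mul1r (gmon k u)) -(addrA 1) -S in H; exact: H.
Qed.

Lemma mcoeff_comb (f : grpalg k G) (F : 'I_n -> grpalg k G) c x :
  (f + \sum_l c l *: F l)@_x = f@_x + \sum_l c l * (F l)@_x.
Proof.
by rewrite gcoeffD mcoeff_sum; congr (_ + _); apply: eq_bigr => l _; rewrite gcoeffZ.
Qed.

Lemma shift_support c u i (deg : G -> int) : additive_weight deg ->
  (forall l, deg (v l) = 0) ->
  forall x, ((1 + shift_sum c) ^+ i * gmon k u)@_x != 0 -> deg x = deg u.
Proof.
move=> degD v0; elim: i u => [|i IH] u x.
  rewrite expr0 mul1r mcoeff_gmon; have [-> //|_] := eqVneq u x.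
  by rewrite eqxx.
rewrite shiftS mul1r mcoeff_comb => nz.
have [e|nA] := eqVneq ((1 + shift_sum c) ^+ i * gmon k u)@_x 0; last exact: IH nA.
have [l] : exists l, ((1 + shift_sum c) ^+ i * gmon k (u + v l))@_x != 0.
  apply: contrapT => no; case/eqP: nz; rewrite [X in X + _]e add0r; apply: big1 => l _.
  by apply/eqP; rewrite mulf_eq0; apply/orP; right; apply/negP => /negP nz; apply: no; exists l.
by move/IH; rewrite degD v0 addr0.
Qed.

End Shift.

(** * Projections, elementary and toric automorphisms *)

Section Maps.
Context (k : fieldType) (R : realType) (n : nat).
Implicit Types (P Q : set 'rV[R]_n).
Local Notation "k[ P ]" := (kalg k P) (at level 0, format "k[ P ]").
Local Notation mon := (mon k).

Lemma conj_byE P (a a' h : k[P] -> k[P]) : cancel a a' -> cancel a' a ->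
  conj_by a h = a \o h \o a'.
Proof.
move=> aK a'K; apply/funext => y; rewrite /conj_by /=; congr (a (h _)).
by apply: (can_inj aK); rewrite a'K; apply: (@xgetPex _ 0 [set x | a x = y]%classic); exists (a' y).
Qed.

Lemma graded_mon P Q (f : {lrmorphism k[P] -> k[Q]}) :
  (forall u, semigrp P u -> homog u.2 (f (mon P u))) -> graded f.
Proof.
move=> H d a ad v; rewrite (kalgE a) linear_sum kval_sum mcoeff_sum => nz.
have [u [ua nzu]] : exists u, (kval a)@_u != 0 /\ (kval (f (mon P u)))@_v != 0.
  apply: contrapT => no; case/eqP: nz; apply: big1_seq => u /= ua.
  rewrite linearZ; apply/eqP/negP => /negP nzu; apply: no; exists u.
  split; first by rewrite mcoeff_neq0.
  move: nzu; rewrite (_ : kval _ = (kval a)@_u *: kval (f (mon P u))) //.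
  by rewrite gcoeffZ mulf_eq0 negb_or => /andP[].
by rewrite (H u (kval_support ua) v nzu); apply: ad.
Qed.

Section Inclusion.
Context (P Q : set 'rV[R]_n) (QP : forall u, semigrp Q u -> semigrp P u).

Lemma incl_homD u v : semigrp Q u -> semigrp Q v -> mon P (u + v) = mon P u * mon P v.
Proof. by move=> uQ vQ; apply: monD; apply: QP. Qed.

Definition incl := lift_lr (SemigroupHom (mon0 k P) incl_homD).

Lemma incl_mon u : semigrp Q u -> incl (mon Q u) = mon P u.
Proof. by move=> uQ; rewrite /incl /lift_lr /= lift_mon. Qed.

Lemma kval_incl f : kval (incl f) = kval f.
Proof.
rewrite [in LHS](kalgE f) linear_sum kval_sum [RHS]grpalgE.
apply: eq_big_seq => u uf; have uQ : semigrp Q u by apply: (@kval_support _ _ _ _ f); rewrite mcoeff_neq0.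
transitivity (kval ((kval f)@_u *: incl (mon Q u))); first by rewrite linearZ.
by rewrite kvalZ (incl_mon uQ) (kval_mon k (QP uQ)).
Qed.

Lemma incl_graded : graded incl.
Proof. by move=> d f fd u; rewrite kval_incl; apply: fd. Qed.

End Inclusion.
End Maps.

Section BasedFactor.
Context (k : fieldType) (kc : alg_closed k) (R : realType) (P : set 'rV[R]_2).
Context (Pl : lattice_polytope P).
Local Notation kP := (kalg k P).
Local Notation mon := (mon k).
Context (h : {lrmorphism kP -> kP}) (hg : graded h).
Local Notation img := (img h).
Context (x w : Z2) (N : nat) (B : line_base h x w N).
Context (a b : int) (ab : a * w 0 0 + b * w 0 1 = 1).
Local Notation Q := (section P x w).
Local Notation lev z := (det2 w (z - x)).

Lemma base_latpts2 : latpts P x /\ latpts P (x + w).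
Proof.
have [_ N0 sP _ _] := B; split; first by have := sP 0%N isT; rewrite mulr0z addr0.
by have := sP 1%N N0; rewrite mulr1z.
Qed.

Lemma based_section (K1 K2 : int) : krull_dim (im_ring h) 2 ->
  (forall z, latpts P z -> 0 <= a * (z - x) 0 0 + b * (z - x) 0 1 + K1 * lev z) ->
  (forall z, latpts P z -> a * (z - x) 0 0 + b * (z - x) 0 1 + K2 * lev z <= N%:Z) ->
  based h.
Proof.
move=> dim lo hi; exists Q; have [xP yP] := base_latpts2; have [_ N0 sP _ _] := B; split.
- by exists 1%N; split=> //; apply: (has_dim_section ab).
- by exists (pt R x), <[pt R w]>%VS.
- by exists [:: x; x + w *~ N]; apply: (section_hull Pl ab N0 xP (sP N (leqnn N)) lo hi).
exact: (base_set_bij kc hg B).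
Qed.

Definition section_incl := @incl k R 2 P Q (@semigrp_section R P x w).

Lemma base_factor (p : {lrmorphism kP -> kalg k Q}) (al al' : {lrmorphism kP -> kP}) :
  cancel al al' -> cancel al' al -> graded al ->
  (forall z, latpts P z ->
     h (al' (mon P (up z))) = h (section_incl (p (mon P (up z))))) ->
  exists iota : {lrmorphism kalg k Q -> kP},
    graded_embedding iota /\ conj_by al h = iota \o p.
Proof.
move=> alK al'K alg E.
exists (al \o h \o section_incl : {lrmorphism kalg k Q -> kP}); split; first split.
- by move=> d f fd; apply/alg/hg/incl_graded.
- move=> f g /(can_inj alK) /(base_injective2 kc hg B) e; apply/kval_inj.
  have pr q : kval (section_incl q) \in kalg_pred Q by rewrite kval_incl; apply: (valP q).
  by have := congr1 (@kval _ _ _ _) (e (pr f) (pr g)); rewrite !kval_incl.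
rewrite (conj_byE _ alK al'K); apply/funext => f; rewrite /=; congr (al _).
exact: (@lrmorph_ext _ _ _ P kP (h \o al' : {lrmorphism kP -> kP})
  (h \o section_incl \o p : {lrmorphism kP -> kP}) E f).
Qed.

End BasedFactor.

Section FacetCase.
Context (k : fieldType) (R : realType) (P : set 'rV[R]_2).
Local Notation kP := (kalg k P).
Local Notation mon := (mon k).
Context (x w : Z2) (w0 : w != 0).
Local Notation Q := (section P x w).
Local Notation lev z := (det2 w (z - x)).

Definition level (u : Z3) : int := det2 w (u.1 - x *~ u.2).

Lemma levelD : additive_weight level.
Proof. by move=> u v; rewrite /level -det2D; congr det2; rewrite mulrzDr /= opprD addrACA. Qed.

Lemma level_up z : level (up z) = lev z.
Proof. by []. Qed.

Context (ge0 : forall z, latpts P z -> 0 <= lev z).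

Lemma level_ge0 u : semigrp P u -> 0 <= level u.
Proof.
elim/semigrp_ind: u / => [|z u zP uP IH]; first by rewrite (weight0 levelD).
by rewrite levelD addr_ge0 // ge0.
Qed.

Lemma section_level u : semigrp Q u -> level u = 0.
Proof.
elim/semigrp_ind: u / => [|z u zQ uQ IH]; first by rewrite (weight0 levelD).
by rewrite levelD IH level_up addr0; have /(latpts_section _ _ _ w0)[] := zQ.
Qed.

Lemma level0_section u : semigrp P u -> level u = 0 -> semigrp Q u.
Proof.
elim/semigrp_ind: u / => [_|z u zP uP IH]; first exact: semigrp0.
rewrite levelD level_up => e; have z0 := ge0 zP; have u0 := level_ge0 uP.
have [lz lu] : lev z = 0 /\ level u = 0 by split; lia.
by apply: semigrpD (IH lu); apply/semigrp_gen/(latpts_section _ _ _ w0).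
Qed.

Definition facet_hom (u : Z3) : kalg k Q := if level u == 0 then mon Q u else 0.

Lemma facet_hom0 : facet_hom 0 = 1.
Proof. by rewrite /facet_hom (weight0 levelD) eqxx mon0. Qed.

Lemma facet_homD u v : semigrp P u -> semigrp P v ->
  facet_hom (u + v) = facet_hom u * facet_hom v.
Proof.
move=> uP vP; rewrite /facet_hom levelD; have u0 := level_ge0 uP; have v0 := level_ge0 vP.
have [lu|lu] := eqVneq (level u) 0; last first.
  by rewrite mul0r ifF //; move: lu; lia.
have [lv|lv] := eqVneq (level v) 0; last first.
  by rewrite mulr0 ifF //; move: lv; lia.
by rewrite lu lv addr0 eqxx monD //; apply: level0_section.
Qed.

Definition facet_proj := lift_lr (SemigroupHom facet_hom0 facet_homD).

Lemma facet_proj_mon z : latpts P z -> facet_proj (mon P (up z)) = facet_hom (up z).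
Proof. by move=> zP; rewrite /facet_proj /lift_lr /= lift_mon //; apply: semigrp_gen. Qed.

Lemma facet_projP : is_facet_proj facet_proj.
Proof.
move=> z zP; have := facet_proj_mon zP; rewrite mon.unlock /facet_hom level_up => E.
split=> [zQ|zQ]; rewrite [LHS]E.
  have /(latpts_section _ _ _ w0)[_ ->] := zQ; by rewrite eqxx mon.unlock.
by case: eqP => // l0; case: zQ; apply/(latpts_section _ _ _ w0).
Qed.

Context (kc : alg_closed k) (Pl : lattice_polytope P) (dP : has_dim P 2).
Context (h : {lrmorphism kP -> kP}) (hg : graded h).
Local Notation img := (img h).
Context (N : nat) (B : line_base h x w N).

Lemma facet_factor (al al' : {lrmorphism kP -> kP}) :
  cancel al al' -> cancel al' al -> graded al ->
  (forall z, latpts P z -> lev z = 0 -> h (al' (mon P (up z))) = img z) ->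
  (forall z, latpts P z -> lev z != 0 -> h (al' (mon P (up z))) = 0) ->
  factors_through_facet (conj_by al h).
Proof.
move=> alK al'K alg E0 E1; have [[a [b ab]] _ _ _ _] := B.
have [|iota [ig e]] := base_factor kc hg B (p := facet_proj) alK al'K alg.
  move=> z zP; rewrite facet_proj_mon // /facet_hom level_up.
  have [l0|l0] := eqVneq (lev z) 0; last by rewrite E1 // !rmorph0.
  rewrite E0 // /img; congr (h _); rewrite incl_mon //.
  by apply/semigrp_gen/(latpts_section _ _ _ w0).
have [xP yP] := base_latpts2 B.
exists Q, facet_proj, iota; split=> //; last exact: facet_projP.
exact: (section_facet Pl ab dP xP yP ge0).
Qed.

End FacetCase.

Lemma shift_expD (A : comNzRingType) (s g1 g2 : A) m n :
  s ^+ (m + n) * (g1 * g2) = s ^+ m * g1 * (s ^+ n * g2).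
Proof. by rewrite exprD; ring. Qed.

Section ShiftAutomorphisms.
Context (k : fieldType) (R : realType) (P : set 'rV[R]_2) (Pl : lattice_polytope P).
Context (dP : has_dim P 2).
Local Notation kP := (kalg k P).
Local Notation mon := (mon k).
Context (x w : Z2) (a b : int) (ab : a * w 0 0 + b * w 0 1 = 1).
Context (xP : latpts P x) (yP : latpts P (x + w)).
Local Notation Q := (section P x w).
Local Notation lev z := (det2 w (z - x)).
Local Notation level := (level x w).
Context (ge0 : forall z, latpts P z -> 0 <= lev z).
Context (n : nat) (dir : 'I_n -> Z2) (dir_lev : forall l, det2 w (dir l) = -1).
Implicit Types (c d : 'I_n -> k).

Let w0 : w != 0. Proof. exact: primitive_neq0 (primitive_ab ab). Qed.

(* The slope condition under which [dir l] is a column vector of height [lev]. *)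
Definition full_column l := forall z, latpts P z -> latpts P (z + dir l *~ lev z).

Definition shiftable c := forall l, c l != 0 -> full_column l.

Let v l : Z3 := (dir l, 0).

Lemma level_dir l : level (v l) = -1.
Proof. by rewrite -[RHS](dir_lev l); congr det2; apply: subr0. Qed.

Lemma full_column_step l z : full_column l -> latpts P z -> 0 < lev z -> latpts P (z + dir l).
Proof.
move=> fl zP z0; apply: (lattice_convex Pl (n1 := lev z - 1) (n2 := 1) (n3 := 0) (n4 := 0)
  zP (fl z zP) zP zP); rewrite ?addr0 ?subrK //; first by lia.
by apply: row2P; rewrite !(mxE, intmxMzE); ring.
Qed.

Lemma full_column_vector l : full_column l -> column_vector P Q (dir l).
Proof.
move=> fl; split.
- by apply/eqP => e; have := dir_lev l; rewrite e /det2 !mxE !mulr0 subrr.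
- exact: (section_facet Pl ab dP xP yP ge0).
move=> z zP nQ; apply: full_column_step => //.
rewrite lt_neqAle ge0 // andbT eq_sym; apply/negP => /eqP e; apply: nQ.
exact/(latpts_section _ _ _ w0).
Qed.

Lemma ht_level l u : full_column l -> semigrp P u -> ht P Q (dir l) u = `|level u|%N.
Proof.
move=> fl uP; rewrite /ht; case: asboolP => [uQ|nQ].
  by rewrite (section_level w0 uQ).
have u0 := level_ge0 ge0 uP; pose m := `|level u|%N.
have le m' : semigrp P (u + (dir l, 0) *+ m') -> (m' <= m)%N.
  move=> /(level_ge0 ge0); rewrite (levelD x w) (weightMn (levelD x w)) (level_dir l) -mulr_natr natz.
  by rewrite /m; lia.
have mP : semigrp P (u + (dir l, 0) *+ m).
  have -> : (dir l, 0 : int) *+ m = (dir l *~ level u, 0).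
    rewrite -(gez0_abs u0) -/m; elim: (m) => [|m' IH]; first by rewrite mulr0z mulr0n.
    by rewrite mulrS IH intS mulrzDr mulr1z; apply: injective_projections; rewrite /= ?addr0.
  elim/semigrp_ind: u / uP {nQ u0 m le} => [|z u zP uP IH].
    by rewrite (weight0 (levelD x w)) mulr0z addr0; apply: semigrp0.
  have -> : up z + u + (dir l *~ level (up z + u), 0) =
      up (z + dir l *~ lev z) + (u + (dir l *~ level u, 0)).
    rewrite (levelD x w) level_up mulrzDr.
    by apply: injective_projections => /=; rewrite ?addr0 // addrACA.
  by apply: semigrpD IH; apply/semigrp_gen/fl.
apply: xget_unique => [|m' [m'P /(_ m mP) mm']]; first by split.
by apply/eqP; rewrite eqn_leq mm' le.
Qed.

Lemma pred_sum (I : Type) (r : seq I) (F : I -> grpalg k Z3) :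
  (forall i, F i \in kalg_pred P) -> \sum_(i <- r) F i \in kalg_pred P.
Proof.
move=> H; have [one cl _] := kalg_subalg_closed k P.
apply: (big_ind (fun f => f \in kalg_pred P)) => //.
  by have := cl (-1) _ _ one one; rewrite scaleN1r addNr.
by move=> f g fQ gQ; have := cl 1 _ _ fQ gQ; rewrite scale1r.
Qed.

Lemma pred_scale (c : k) (f : grpalg k Z3) : (c != 0 -> f \in kalg_pred P) ->
  c *: f \in kalg_pred P.
Proof.
move=> H; have [one cl _] := kalg_subalg_closed k P.
have z : (0 : grpalg k Z3) \in kalg_pred P by have := cl (-1) _ _ one one; rewrite scaleN1r addNr.
have [->|c0] := eqVneq c 0; first by rewrite scale0r.
by rewrite -[_ *: _]addr0; apply: (cl _ _ _ (H c0) z).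
Qed.

Lemma shift_pred_gen c (i : nat) z : shiftable c -> latpts P z -> i%:Z <= lev z ->
  (1 + shift_sum v c) ^+ i * gmon k (up z) \in kalg_pred P.
Proof.
move=> cs; elim: i z => [|i IH] z zP iz.
  by rewrite expr0 mul1r -(kval_mon k (semigrp_gen zP)); apply: (valP (mon P (up z))).
rewrite shiftS mul1r; have [_ cl _] := kalg_subalg_closed k P.
rewrite -[X in X + _]scale1r; apply: (cl _ _ _ _ _).
  by apply: IH => //; lia.
apply: pred_sum => l; apply: pred_scale => cl0; have -> : up z + v l = up (z + dir l).
  by apply: injective_projections => /=; rewrite ?addr0.
apply: IH; first by apply: full_column_step (cs l cl0) zP _; lia.
have -> : lev (z + dir l) = lev z - 1 by rewrite (addrAC z) (det2D w (z - x)) (dir_lev l).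
by move: iz; clear; lia.
Qed.

Lemma shiftD c u u' : semigrp P u -> semigrp P u' ->
  shift level v c (u + u') = shift level v c u * shift level v c u'.
Proof.
move=> /(level_ge0 ge0) u0 /(level_ge0 ge0) u'0.
have e : `|level (u + u')%R|%N = (`|level u| + `|level u'|)%N by rewrite (levelD x w u u'); lia.
rewrite /shift e (gmonD k u u'); exact: shift_expD.
Qed.

Lemma shift_pred c u : shiftable c -> semigrp P u -> shift level v c u \in kalg_pred P.
Proof.
move=> cs; have [one _ mul] := kalg_subalg_closed k P.
elim/semigrp_ind: u / => [|z u zP uP IH].
  by rewrite /shift (weight0 (levelD x w)) absz0 expr0 mul1r.
rewrite (shiftD c (semigrp_gen zP) uP); apply: mul (IH); apply: shift_pred_gen => //.
by rewrite level_up; have := ge0 zP; lia.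
Qed.

Definition shift_mon c (u : Z3) : kP := insubd 0 (shift level v c u).

Lemma kval_shift_mon c u : shiftable c -> semigrp P u ->
  kval (shift_mon c u) = shift level v c u.
Proof. by move=> cs uP; rewrite /shift_mon -[LHS]/(val _) insubdK //; apply: shift_pred. Qed.

Section Shiftable.
Context (c : 'I_n -> k) (cs : shiftable c).

Lemma shift_mon0 : shift_mon c 0 = 1.
Proof.
apply/kval_inj; rewrite (kval_shift_mon cs (semigrp0 P)) kval1.
by rewrite /shift (weight0 (levelD x w)) absz0 expr0 mul1r.
Qed.

Lemma shift_monD u u' : semigrp P u -> semigrp P u' ->
  shift_mon c (u + u') = shift_mon c u * shift_mon c u'.
Proof.
move=> uP uP'; apply/kval_inj; rewrite kvalM.
apply: (etrans (etrans (kval_shift_mon cs (semigrpD uP uP')) (shiftD c uP uP'))).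
exact: (congr2 *%R (esym (kval_shift_mon cs uP)) (esym (kval_shift_mon cs uP'))).
Qed.

Definition shift_lr := lift_lr (SemigroupHom shift_mon0 shift_monD).

Lemma kval_shift_lr_mon u : semigrp P u -> kval (shift_lr (mon P u)) = shift level v c u.
Proof.
move=> uP; rewrite -(kval_shift_mon cs uP); congr (kval _).
by rewrite /shift_lr /lift_lr /= lift_mon.
Qed.

Lemma kval_shift_lr f : kval (shift_lr f) = linext (shift level v c) (kval f).
Proof.
rewrite [in LHS](kalgE f) linear_sum kval_sum /linext.
apply: eq_big_seq => u uf; have uP : semigrp P u by apply: (@kval_support _ _ _ _ f); rewrite mcoeff_neq0.
transitivity (kval ((kval f)@_u *: shift_lr (mon P u))); first by rewrite linearZ.
by rewrite kvalZ kval_shift_lr_mon.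
Qed.

Lemma shift_graded : graded shift_lr.
Proof.
apply: graded_mon => u uP u'; rewrite (kval_shift_lr_mon uP).
by apply: (@shift_support _ _ _ _ _ _ _ (fun u : Z3 => u.2)).
Qed.

End Shiftable.

Lemma shift_comp c d e (cs : shiftable c) (ds : shiftable d) (es : shiftable e) :
  (forall l, e l = c l + d l) -> shift_lr cs \o shift_lr ds =1 shift_lr es.
Proof.
move=> ecd; apply: (@lrmorph_ext _ _ _ P kP (shift_lr cs \o shift_lr ds : {lrmorphism kP -> kP})
  (shift_lr es)) => z zP; apply: kval_inj; have zS := semigrp_gen zP.
rewrite [LHS]kval_shift_lr [in LHS](kval_shift_lr_mon ds zS) (kval_shift_lr_mon es zS).
apply: (shift_shift (levelD x w) level_dir) ecd; exact: ge0.
Qed.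

Lemma shift_id c (cs : shiftable c) : (forall l, c l = 0) -> shift_lr cs =1 id.
Proof.
move=> c0; apply: (@lrmorph_ext _ _ _ P kP (shift_lr cs) idfun) => z zP.
apply: kval_inj; have zS := semigrp_gen zP.
by rewrite (kval_shift_lr_mon cs zS) /shift shift_sum0 // addr0 expr1n mul1r kval_mon.
Qed.

Lemma shiftableN c : shiftable c -> shiftable (fun l => - c l).
Proof. by move=> cs l; rewrite oppr_eq0; apply: cs. Qed.

Lemma shiftable0 : shiftable (fun=> 0).
Proof. by move=> l; rewrite eqxx. Qed.

Lemma shiftK c (cs : shiftable c) (ds : shiftable (fun l => - c l)) :
  cancel (shift_lr cs) (shift_lr ds) /\ cancel (shift_lr ds) (shift_lr cs).
Proof.
split=> f; first have := shift_comp ds cs shiftable0 (fun l => esym (addNr (c l))) f.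
  by rewrite (shift_id shiftable0).
have := shift_comp cs ds shiftable0 (fun l => esym (addrN (c l))) f.
by rewrite (shift_id shiftable0).
Qed.

Lemma shift_Gamma c (cs : shiftable c) : Gamma (shift_lr cs).
Proof.
exists (shift_lr cs); split=> //; first exact: shift_graded.
have [K K'] := shiftK cs (shiftableN cs); exact: (Bijective K K').
Qed.

Lemma shift_elementary c (cs : shiftable c) l : c l != 0 ->
  (forall l', l' != l -> c l' = 0) -> elementary Q (dir l) (c l) (shift_lr cs).
Proof.
move=> cl0 c0; split=> [|u uP]; first exact: shift_Gamma.
have S : shift_sum v c = c l *: gmon k (dir l, 0).
  rewrite /shift_sum (bigD1 l) // big1 => [|l' /c0 ->]; [exact: addr0 | exact: scale0r].
have E := kval_shift_lr_mon cs uP; rewrite mon.unlock in E.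
by rewrite (ht_level (cs l cl0) uP) -S; exact: E.
Qed.

Lemma shift_elem_group c (cs : shiftable c) : elem_group (shift_lr cs).
Proof.
suff H m : forall c (cs : shiftable c), (forall l : 'I_n, (m <= l)%N -> c l = 0) ->
    elem_group (shift_lr cs).
  by apply: (H n) => l; rewrite leqNgt ltn_ord.
elim: m => [|m IH] {c cs} c cs c0.
  rewrite (_ : (shift_lr cs : kP -> kP) = id); first exact: elem_group_id.
  by apply/funext => f; apply: (shift_id cs (fun l => c0 l isT)).
have [mn|nm] := ltnP m n; last first.
  by apply: IH => l ml; have := ltn_ord l; lia.
pose l := Ordinal mn; have [cl0|cl0] := eqVneq (c l) 0.
  apply: IH => l' ml'; have [e|ne] := eqVneq (l' : nat) m.
    by rewrite (_ : l' = l) //; apply/val_inj.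
  by apply: c0; rewrite ltn_neqAle eq_sym ne.
pose c1 l' := if l' == l then 0 else c l'; pose c2 l' := if l' == l then c l' else 0.
have s1 : shiftable c1 by move=> l'; rewrite /c1; have [_|_] := eqVneq l' l; [rewrite eqxx | exact: cs].
have s2 : shiftable c2 by move=> l'; rewrite /c2; have [_|_] := eqVneq l' l; [exact: cs | rewrite eqxx].
rewrite (_ : (shift_lr cs : kP -> kP) = shift_lr s1 \o shift_lr s2); last first.
  apply/funext => f; apply/esym/shift_comp => l'; rewrite /c1 /c2.
  by case: eqP; rewrite ?addr0 ?add0r.
apply: elem_group_comp.
  apply: IH => l' ml'; rewrite /c1; case: eqP => // ne; apply: c0; rewrite ltn_neqAle ml' andbT.
  by apply/eqP => e; apply: ne; apply/val_inj.
have c2l : c2 l != 0 by rewrite /c2 eqxx.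
apply: elem_group_elementary (full_column_vector (s2 l c2l)) (shift_elementary s2 c2l _) => l'.
by rewrite /c2 => /negbTE->.
Qed.

End ShiftAutomorphisms.

Lemma mul_exp_swap (A : comNzRingType) (s g g1 : A) (n : nat) :
  s ^+ n * g * g1 ^+ n = (s ^+ 1 * g1) ^+ n * g.
Proof. by rewrite expr1 exprMn; ring. Qed.

(** * Facet and interior bases *)

Section NonzeroCases.
Context (k : fieldType) (kc : alg_closed k) (R : realType) (P : set 'rV[R]_2).
Context (Pl : lattice_polytope P) (dP : has_dim P 2).
Local Notation kP := (kalg k P).
Local Notation mon := (mon k).
Context (h : {lrmorphism kP -> kP}) (hg : graded h) (dim : krull_dim (im_ring h) 2).
Local Notation img := (img h).
Context (nz : forall z, latpts P z -> img z != 0).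
Context (x w : Z2) (N : nat) (B : line_base h x w N).
Context (a b : int) (ab : a * w 0 0 + b * w 0 1 = 1).
Context (z1 : Z2) (z1P : latpts P z1) (z1lev : det2 w (z1 - x) = 1).
Local Notation Q := (section P x w).
Local Notation lev z := (det2 w (z - x)).
Local Notation along := (along x w a b z1).
Local Notation dir l := (w *~ l - (z1 - x)).

Lemma along_coord z : a * (z - x) 0 0 + b * (z - x) 0 1 =
  along z + (a * (z1 - x) 0 0 + b * (z1 - x) 0 1) * lev z.
Proof.
rewrite /along; set j := lev z; rewrite !(mxE, intmxMzE); ring.
Qed.

Lemma slopes_based (l1 l2 : nat) :
  (forall z, latpts P z -> [/\ 0 <= along z + l1%:Z * lev z,
      along z + l1%:Z * lev z <= along z + l2%:Z * lev z &
      along z + l2%:Z * lev z <= N%:Z]) -> based h.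
Proof.
move=> S; pose X := a * (z1 - x) 0 0 + b * (z1 - x) 0 1.
apply: (based_section kc Pl hg B ab (K1 := l1%:Z - X) (K2 := l2%:Z - X) dim) => z zP;
  have [s1 s2 s3] := S z zP; rewrite along_coord -/X.
  by move: s1; congr (0 <= _); ring.
by move: s3; congr (_ <= _); ring.
Qed.

Lemma dir_level (l : int) : det2 w (dir l) = -1.
Proof. by rewrite (det2B w (w *~ l)) z1lev det2Mz det2aa mul0r sub0r. Qed.

Lemma project_along (l : int) z :
  z + dir l *~ lev z = x + w *~ (along z + l * lev z).
Proof.
have E i : z 0 i = x 0 i + w 0 i * along z + (z1 0 i - x 0 i) * lev z.
  by have := congr1 (fun v : Z2 => v 0 i) (along_decomposition ab z1lev z);
    rewrite [X in _ = X -> _]mxE [X in _ = X + _ -> _]mxE !intmxMzE [X in _ = _ + X * _ -> _]mxE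
      [X in _ = _ + (_ + X) * _ -> _]mxE.
set j := lev z in E *; set i := along z in E *.
by apply: row2P; rewrite !(mxE, intmxMzE) E; ring.
Qed.

Lemma project_latpts (l : int) z : latpts P z ->
  0 <= along z + l * lev z -> along z + l * lev z <= N%:Z -> latpts P (z + dir l *~ lev z).
Proof.
move=> zP; rewrite project_along; case: (along z + l * lev z) => // i _ iN.
by have [_ _ sP _ _] := B; apply: sP.
Qed.

Context (q : Z2 -> kP) (qP : represents h x w N q).

Section Facet.
Context (ge0 : forall z, latpts P z -> 0 <= lev z).

Lemma nonzero_facet : based h /\
  exists eps, [/\ elem_group eps, Gamma eps & factors_through_facet (conj_by eps h)].
Proof.
have [l1 [l2 [S [c [qc cl]]]]] := slopes kc hg nz B ab z1P z1lev qP.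
split; first exact: slopes_based S.
have [xP yP] := base_latpts2 B; have w0 := primitive_neq0 (primitive_ab ab).
pose d (l : 'I_N.+1) : Z2 := dir l; have dlev l : det2 w (d l) = -1 by exact: dir_level.
pose c' (l : 'I_N.+1) := c l.
have cs : shiftable P x w d c'.
  move=> l cl0 z zP; have [s1 _ s3] := S z zP; have z0 := ge0 zP.
  have /andP[l1l ll2] : (l1 <= l <= l2)%N by apply: cl cl0; rewrite -ltnS.
  have le1 : l1%:Z * lev z <= l%:Z * lev z by rewrite ler_wpM2r.
  have le2 : l%:Z * lev z <= l2%:Z * lev z by rewrite ler_wpM2r.
  apply: project_latpts => //.
    by apply: le_trans s1 _; rewrite lerD2l.
  by apply: le_trans s3; rewrite lerD2l.
pose ds := shiftableN cs.
pose al := shift_lr Pl ab ge0 dlev cs; pose al' := shift_lr Pl ab ge0 dlev ds.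
have [K K'] : cancel al al' /\ cancel al' al := shiftK Pl ab ge0 dlev cs ds.
have kal' z : latpts P z ->
    kval (al' (mon P (up z))) = shift (level x w) (fun l => (d l, 0)) (fun l => - c' l) (up z).
  by move=> zP; apply: (kval_shift_lr_mon Pl ab ge0 dlev ds (semigrp_gen zP)).
exists al; split; first exact: (shift_elem_group Pl dP ab xP yP ge0 dlev cs).
  exact: (shift_Gamma Pl ab ge0 dlev cs).
apply: (facet_factor w0 ge0 kc Pl dP hg B K K').
- exact: shift_graded.
- move=> z zP l0; congr (h _); apply: kval_inj; rewrite kal' //.
  by rewrite /shift level_up l0 absz0 expr0 mul1r kval_mon //; apply: semigrp_gen.
have E1 : al' (mon P (up z1)) = mon P (up z1) - q z1.
  apply: kval_inj; have [_ _ sP _ _] := B.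
  rewrite (kal' z1 z1P) qc /shift level_up z1lev.
  rewrite (_ : kval (_ - _) = gmon k (up z1) - kval (line_sum P x w N c)); last first.
    by rewrite -(kval_mon k (semigrp_gen z1P)).
  rewrite (line_sum_kval B) [X in X * _]expr1 mulrDl mul1r shift_sum_gmon -sumrN; congr (_ + _).
  apply: eq_bigr => l _; rewrite -scaleNr; congr (_ *: gmon k _).
  apply: injective_projections; rewrite /= ?addr0 // /d.
  by apply: row2P; rewrite !(mxE, intmxMzE); ring.
have h1 : h (al' (mon P (up z1))) = 0.
  by rewrite E1 rmorphB /=; have [-> _] := qP z1P; apply: subrr.
move=> z zP l0; have j0 := ge0 zP; pose j := `|lev z|%N.
have : al' (mon P (up z)) * mon P (up z1) ^+ j = al' (mon P (up z1)) ^+ j * mon P (up z).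
  apply: kval_inj; rewrite !kvalM !kvalX (kal' z zP) (kal' z1 z1P) /shift !level_up z1lev.
  rewrite (kval_mon k (semigrp_gen zP)) (kval_mon k (semigrp_gen z1P)).
  exact: mul_exp_swap.
move=> /(congr1 h); rewrite !rmorphM !rmorphXn /= h1 expr0n.
have -> : (j == 0)%N = false by apply/negbTE; rewrite /j absz_eq0.
rewrite mul0r => /kalg_mul_eq0[//|/eqP].
by rewrite (negbTE (kalg_exp_neq0 _ (nz z1P))).
Qed.

End Facet.
End NonzeroCases.

Section TorusLevel.
Context (k : fieldType) (R : realType) (P : set 'rV[R]_2) (x w : Z2).
Local Notation kP := (kalg k P).
Local Notation mon := (mon k).
Local Notation level := (level x w).

Section Scalar.
Context (c : k) (c0 : c != 0).

Definition torus_hom (u : Z3) : kP := (c ^ level u) *: mon P u.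

Lemma torus_hom0 : torus_hom 0 = 1.
Proof. by rewrite /torus_hom (weight0 (levelD x w)) expr0z scale1r mon0. Qed.

Lemma torus_homD u v : semigrp P u -> semigrp P v ->
  torus_hom (u + v) = torus_hom u * torus_hom v.
Proof.
move=> uP vP; rewrite /torus_hom (levelD x w u v) expfzDr // (monD _ uP vP).
by rewrite -scalerAl -scalerAr scalerA.
Qed.

Definition torus_lr := lift_lr (SemigroupHom torus_hom0 torus_homD).

Lemma torus_lr_mon u : semigrp P u -> torus_lr (mon P u) = (c ^ level u) *: mon P u.
Proof. by move=> uP; rewrite /torus_lr /lift_lr /= lift_mon. Qed.

Lemma torus_graded : graded torus_lr.
Proof.
apply: graded_mon => u uP u'; rewrite (torus_lr_mon uP) kvalZ (kval_mon k uP) gcoeffZ mcoeff_gmon.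
by have [->//|_] := eqVneq u u'; rewrite mulr0 eqxx.
Qed.

End Scalar.

Lemma torus_comp c c' (c0 : c != 0) (c'0 : c' != 0) : c' * c = 1 ->
  cancel (torus_lr c0) (torus_lr c'0).
Proof.
move=> cc; apply: (@lrmorph_ext _ _ _ P kP (torus_lr c'0 \o torus_lr c0 : {lrmorphism kP -> kP})
  idfun) => z /semigrp_gen zP.
transitivity (torus_lr c'0 (c ^ level (up z) *: mon P (up z))).
  by congr (torus_lr c'0 _); apply: torus_lr_mon.
rewrite linearZ; transitivity (c ^ level (up z) *: (c' ^ level (up z) *: mon P (up z))).
  by congr (_ *: _); apply: torus_lr_mon.
by rewrite scalerA -expfzMl mulrC cc exp1rz scale1r.
Qed.

Lemma torus_lrP c (c0 : c != 0) : torus (torus_lr c0).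
Proof.
have c'0 : c^-1 != 0 by rewrite invr_eq0.
split=> [|u uP]; last first.
  exists (c ^ level u); first exact: expfz_neq0.
  by have := torus_lr_mon c0 uP; rewrite mon.unlock.
exists (torus_lr c0); split=> //; first exact: torus_graded.
exact: (Bijective (torus_comp c0 c'0 (mulVf c0)) (torus_comp c'0 c0 (mulfV c0))).
Qed.

End TorusLevel.

Section FibrationProjection.
Context (k : fieldType) (R : realType) (P : set 'rV[R]_2).
Local Notation kP := (kalg k P).
Local Notation mon := (mon k).
Context (x w : Z2) (w0 : w != 0) (d : Z2) (dlev : det2 w d = -1).
Local Notation Q := (section P x w).
Local Notation lev z := (det2 w (z - x)).
Local Notation level := (level x w).
Context (full : forall z, latpts P z -> latpts P (z + d *~ lev z)).

Definition project (u : Z3) : Z3 := u + (d *~ level u, 0).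

Lemma projectD u v : project (u + v) = project u + project v.
Proof.
rewrite /project (levelD x w u v) mulrzDr addrACA.
by congr (_ + (_, _)).
Qed.

Lemma project_up z : project (up z) = up (z + d *~ lev z).
Proof. by apply: injective_projections; rewrite /= ?addr0. Qed.

Lemma project_latptsQ z : latpts P z -> latpts Q (z + d *~ lev z).
Proof.
move=> zP; apply/(latpts_section _ _ _ w0); split; first exact: full.
by rewrite (addrAC z) (det2D w (z - x)) det2Mz dlev mulN1r subrr.
Qed.

Lemma project_semigrp u : semigrp P u -> semigrp Q (project u).
Proof.
elim/semigrp_ind: u / => [|z u zP uP IH].
  by rewrite /project (weight0 (levelD x w)) mulr0z addr0; apply: semigrp0.
by rewrite projectD project_up; apply/(semigrpD _ IH)/semigrp_gen/project_latptsQ.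
Qed.

Definition fibration_hom (u : Z3) : kalg k Q := mon Q (project u).

Lemma fibration_hom0 : fibration_hom 0 = 1.
Proof. by rewrite /fibration_hom /project (weight0 (levelD x w)) mulr0z addr0 mon0. Qed.

Lemma fibration_homD u v : semigrp P u -> semigrp P v ->
  fibration_hom (u + v) = fibration_hom u * fibration_hom v.
Proof. by move=> uP vP; rewrite /fibration_hom projectD monD //; apply: project_semigrp. Qed.

Definition fibration_proj := lift_lr (SemigroupHom fibration_hom0 fibration_homD).

Lemma fibration_proj_mon z : latpts P z ->
  fibration_proj (mon P (up z)) = mon Q (up (z + d *~ lev z)).
Proof.
move=> zP; rewrite -project_up /fibration_proj /lift_lr /= lift_mon //.
exact: semigrp_gen.
Qed.

Local Notation pt := (@Defs.pt R 2).

Lemma pt_inj : injective pt.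
Proof.
move=> y z e; apply/rowP => j; apply/eqP; rewrite -(eqr_int R); apply/eqP.
by have := congr1 (fun v : 'rV[R]_2 => v 0 j) e; rewrite !mxE.
Qed.

Lemma fibration_projP :
  @is_fibration_proj k R 2 P (affine_space (pt x) <[pt w]>%VS) (pt d) fibration_proj.
Proof.
move=> z z0 zP /(latpts_section _ _ _ w0)[z0P lz0] [t e].
have := fibration_proj_mon zP; rewrite mon.unlock => E; rewrite [LHS]E.
suff -> : z0 = z + d *~ lev z by [].
apply: pt_inj; rewrite e ptD ptMz; congr (_ + _ *: _).
have E0 j : (z0 0 j)%:~R = (z 0 j)%:~R + t * (d 0 j)%:~R :> R.
  by have := congr1 (fun v : 'rV[R]_2 => v 0 j) e; rewrite !mxE.
have l0 : (lev z0)%:~R = 0 :> R by rewrite lz0.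
have d0 : (det2 w d)%:~R = -1 :> R by rewrite dlev.
have lE : (lev z0)%:~R = (lev z)%:~R + t * (det2 w d)%:~R :> R.
  rewrite /det2 !mxE !(rmorphB, rmorphD, rmorphM, rmorphN) /= !E0.
  by ring.
by move/eqP: lE; rewrite l0 d0 mulrN1 eq_sym subr_eq0 => /eqP.
Qed.

Lemma fibration_segmental (a b : int) : a * w 0 0 + b * w 0 1 = 1 ->
  lattice_polytope P -> has_dim P 2 ->
  segmental_fibration P (affine_space (pt x) <[pt w]>%VS) (pt d).
Proof.
move=> ab Pl dP; split=> //; first exact: (section_hyperplane R x ab).
  apply/eqP => e; have /pt_inj d0 : pt d = pt 0 by rewrite e; apply/rowP => j; rewrite !mxE.
  by have := dlev; rewrite d0 /det2 !mxE !mulr0 subrr.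
move=> z zP; have [z0P z0H] := project_latptsQ zP; exists (z + d *~ lev z); split=> //.
by exists (- (lev z)%:~R); rewrite ptD ptMz scaleNr addrK.
Qed.

End FibrationProjection.

Lemma cancel_power (k : fieldType) (R : realType) (P : set 'rV[R]_2) (c : k) (c0 : c != 0)
    (j : int) (X Z Y : kalg k P) : X != 0 ->
  Z * (X ^+ pos_part j * (c *: X) ^+ neg_part j) =
    Y * (X ^+ neg_part j * (c *: X) ^+ pos_part j) ->
  Z = c ^ j *: Y.
Proof.
move=> X0; rewrite !exprZn -!scalerAr (mulrC (X ^+ pos_part j)).
set W := X ^+ neg_part j * X ^+ pos_part j => e.
have W0 : W != 0 by apply: kalg_mul_neq0; apply: kalg_exp_neq0.
have : (c ^+ neg_part j *: Z - c ^+ pos_part j *: Y) * W = 0.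
  by rewrite mulrBl -!scalerAl e subrr.
move=> /kalg_mul_eq0[/eqP|/eqP]; last by rewrite (negbTE W0).
rewrite subr_eq0 => /eqP eZ.
have n0 : c ^+ neg_part j != 0 by apply: expf_neq0.
have cj : c ^+ pos_part j = c ^+ neg_part j * c ^ j.
  transitivity (c ^ ((neg_part j)%:Z + j)); last exact: expfzDr.
  by have -> : (neg_part j)%:Z + j = (pos_part j)%:Z by have := pos_negE j; lia.
have := congr1 (fun v => (c ^+ neg_part j)^-1 *: v) eZ.
by rewrite cj !scalerA mulrA (mulVf n0) mul1r scale1r.
Qed.

Section InteriorCase.
Context (k : fieldType) (kc : alg_closed k) (R : realType) (P : set 'rV[R]_2).
Context (Pl : lattice_polytope P) (dP : has_dim P 2).
Local Notation kP := (kalg k P).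
Local Notation mon := (mon k).
Context (h : {lrmorphism kP -> kP}) (hg : graded h) (dim : krull_dim (im_ring h) 2).
Local Notation img := (img h).
Context (nz : forall z, latpts P z -> img z != 0).
Context (x w : Z2) (N : nat) (B : line_base h x w N).
Local Notation lev z := (det2 w (z - x)).

Lemma nonzero_interior zm zp : latpts P zm -> latpts P zp ->
  lev zm < 0 -> 0 < lev zp -> based h /\
  exists tau, torus tau /\ factors_through_fibration (conj_by tau h).
Proof.
move=> mP pP lm lp; have [xP yP] := base_latpts2 B; have [[a [b ab]] _ _ _ _] := B.
have w0 := primitive_neq0 (primitive_ab ab).
have [z1 z1P z1lev] := level_one Pl (primitive_ab ab) xP yP pP lp.
have [q qP] := represents_exists B.
have [l [l2 [S [c [qc cl]]]]] := slopes kc hg nz B ab z1P z1lev qP.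
split; first exact: (slopes_based kc Pl hg dim B ab S).
have ll : l2 = l.
  have [_ + _] := S _ mP; have [_ + _] := S _ z1P.
  rewrite !lerD2l z1lev !mulr1 ler_nM2r // => l1 l2'; apply/eqP; rewrite eqn_leq.
  by move: l1 l2'; rewrite !lez_nat => -> ->.
rewrite {}ll in S cl.
have full z : latpts P z -> latpts P (z + (w *~ l - (z1 - x)) *~ lev z).
  by move=> zP; have [s1 _ s2] := S z zP; apply: (project_latpts B ab z1lev zP).
have dlev : det2 w (w *~ l - (z1 - x)) = -1 by exact: dir_level.
have lP : latpts P (x + w *~ l).
  have := full z1 z1P; rewrite z1lev mulr1z; congr (latpts P _).
  by apply: row2P; rewrite !(mxE, intmxMzE); ring.
have lN : (l <= N)%N.
  have [_ _] := S z1 z1P; rewrite (_ : along _ _ _ _ _ _ = 0) ?add0r ?z1lev ?mulr1 ?lez_nat //.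
  by rewrite /along z1lev mulr1z subrr !mxE !mulr0 addr0.
have h1 : img z1 = c l *: img (x + w *~ l).
  have [<- _] := qP z1 z1P; rewrite qc /line_sum.
  have lN' : (l < N.+1)%N by [].
  rewrite (bigD1 (Ordinal lN')) // big1 => [|i il].
    rewrite [X in h X]addr0; exact: linearZ.
  have [->|ci] := eqVneq (c i) 0; first exact: scale0r.
  have : (l <= i <= l)%N by apply: cl; rewrite // -ltnS.
  rewrite -eqn_leq => e; case/eqP: il; apply/val_inj/esym; exact: eqP e.
have c0 : c l != 0 by apply/eqP => e; have := nz z1P; rewrite h1 e scale0r eqxx.
have rel z : latpts P z -> img z = c l ^ lev z *: img (z + (w *~ l - (z1 - x)) *~ lev z).
  move=> zP; apply: (cancel_power c0 (nz lP)).
  set z0 := z + (w *~ l - (z1 - x)) *~ lev z; pose s : seq (Z2 * int) := [:: (z, 1); (z0, -1); (x + w *~ l, lev z); (z1, - lev z)].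
  have sPp p : p \in s -> latpts P p.1.
    by rewrite !inE => /orP[|/orP[|/orP[]]] /eqP->;
      [exact: zP | exact: (full z zP) | exact: lP | exact: z1P].
  have s1 : \sum_(p <- s) p.1 *~ p.2 = 0.
    rewrite !big_cons big_nil /z0; set j := lev z.
    by apply: row2P; rewrite !(mxE, intmxMzE) /=; ring.
  have s2 : \sum_(p <- s) p.2 = 0 by rewrite !big_cons big_nil /=; ring.
  have := img_relation h sPp s1 s2; rewrite !prod4.
  rewrite (pos_partN (lev z)) (neg_partN (lev z)).
  rewrite [pos_part 1]/= [neg_part 1]/= [pos_part (-1)]/= [neg_part (-1)]/= -h1.
  by rewrite !expr1 !expr0 !mul1r.
have c'0 : (c l)^-1 != 0 by rewrite invr_eq0.
pose tau := torus_lr P x w c0; pose tau' := torus_lr P x w c'0.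
have K : cancel tau tau' := torus_comp x w c0 c'0 (mulVf c0).
have K' : cancel tau' tau := torus_comp x w c'0 c0 (mulfV c0).
exists tau; split; first exact: torus_lrP.
have [|iota [ig e]] := base_factor kc hg B (p := fibration_proj k w0 dlev full) K K' (@torus_graded _ _ _ x w _ c0).
  move=> z zP; rewrite fibration_proj_mon //.
  rewrite (_ : section_incl k P x w (mon (section P x w) (up (z + (w *~ l - (z1 - x)) *~ lev z))) = mon P (up (z + (w *~ l - (z1 - x)) *~ lev z))); last first.
    by apply/incl_mon/semigrp_gen/(project_latptsQ w0 dlev full zP).
  transitivity (h ((c l)^-1 ^ lev z *: mon P (up z))).
    by congr (h _); apply: (torus_lr_mon x w c'0 (semigrp_gen zP)).
  rewrite linearZ; transitivity ((c l)^-1 ^ lev z *: img z); first by [].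
  rewrite rel // scalerA -expfzMl mulVf // exp1rz; exact: scale1r.
exists (affine_space (pt R x) <[pt R w]>%VS), (pt R (w *~ l - (z1 - x))).
exists (fibration_proj k w0 dlev full), iota; split=> //.
  exact: (fibration_segmental w0 dlev full ab Pl dP).
exact: fibration_projP.
Qed.

End InteriorCase.

Section Dichotomy.
Context (k : fieldType) (kc : alg_closed k) (R : realType) (P : set 'rV[R]_2).
Context (Pl : lattice_polytope P) (dP : has_dim P 2).
Local Notation kP := (kalg k P).
Local Notation mon := (mon k).
Context (h : {lrmorphism kP -> kP}) (hg : graded h) (hh : forall f, h (h f) = h f) (h1 : codim h 1).
Local Notation img := (img h).

Definition alternatives := based h /\
  ((exists tau, torus tau /\ factors_through_fibration (conj_by tau h)) \/
   (exists eps, [/\ elem_group eps, Gamma eps & factors_through_facet (conj_by eps h)])).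

Lemma Gamma_id : Gamma (@idfun kP).
Proof. by exists (idfun : {lrmorphism kP -> kP}); split=> //; exists id. Qed.

Lemma zero_alternatives (x w : Z2) N (L : seq Z2) : krull_dim (im_ring h) 2 -> (forall z, z \in L <-> latpts P z) ->
  line_base h x w N -> (forall z, latpts P z -> 0 <= det2 w (z - x)) ->
  (forall z, latpts P z -> det2 w (z - x) != 0 -> img z = 0) -> alternatives.
Proof.
move=> dim LP B ge0 off; have [[a [b ab]] _ _ ext _] := B.
have w0 := primitive_neq0 (primitive_ab ab).
pose X (z : Z2) := a * (z - x) 0 0 + b * (z - x) 0 1.
have [D D0 HD] := weight_bound L X.
have XN z : latpts P z -> det2 w (z - x) = 0 -> 0 <= X z <= N%:Z.
  move=> zP /(ext z zP)[i iN ->]; rewrite /X (_ : _ + _ = i%:Z) ?lez_nat //.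
  by rewrite !(mxE, intmxMzE) -[RHS]mul1r -ab; ring.
have bound z : latpts P z -> `|X z| <= D by move/LP/HD.
split.
  apply: (based_section kc Pl hg B ab (K1 := D) (K2 := - D) dim) => z zP; rewrite -/(X z);
    have [l0|l0] := eqVneq (det2 w (z - x)) 0; have := bound z zP; have := ge0 z zP.
  - by have := XN z zP l0; rewrite l0; lia.
  - move=> z0 zD; have : D <= D * det2 w (z - x) by rewrite ler_peMr //; lia.
    by lia.
  - by have := XN z zP l0; rewrite l0; lia.
  - move=> z0 zD; have : D <= D * det2 w (z - x) by rewrite ler_peMr //; lia.
    by lia.
right; exists idfun; split; [exact: elem_group_id | exact: Gamma_id |].
apply: (@facet_factor _ _ _ _ _ w0 ge0 kc Pl dP _ hg _ B idfun idfun) => //.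
Qed.

Lemma nonzero_alternatives (x w : Z2) N : krull_dim (im_ring h) 2 ->
  (forall z, latpts P z -> img z != 0) -> line_base h x w N -> alternatives.
Proof.
move=> dim nz.
have key (x' w' : Z2) N' zp : line_base h x' w' N' -> latpts P zp -> 0 < det2 w' (zp - x') ->
    (forall z, latpts P z -> 0 <= det2 w' (z - x')) -> alternatives.
  move=> B pP lp ge0; have [xP yP] := base_latpts2 B; have [[a [b ab]] _ _ _ _] := B.
  have [z1 z1P z1lev] := level_one Pl (primitive_ab ab) xP yP pP lp.
  have [q qP] := represents_exists B.
  have [? ?] := nonzero_facet kc Pl dP hg dim nz B ab z1P z1lev qP ge0.
  by split=> //; right.
move=> B; have [[a [b ab]] _ _ _ _] := B.
have [z zP lz] := not_collinear Pl x dP (primitive_neq0 (primitive_ab ab)).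
have [ge0|] := pselect (forall z, latpts P z -> 0 <= det2 w (z - x)).
  by apply: (key x w N z B zP _ ge0); rewrite lt_neqAle eq_sym lz ge0.
move=> /existsNP[zm /not_implyP[mP /negP]]; rewrite -ltNge => lm.
have [le0|] := pselect (forall z, latpts P z -> det2 w (z - x) <= 0).
  have lev_rev y : det2 (- w) (y - (x + w *~ N)) = - det2 w (y - x).
    by rewrite /det2 !(mxE, intmxMzE); ring.
  apply: (key _ _ _ zm (line_base_rev kc B nz) mP).
    by rewrite lev_rev oppr_gt0.
  by move=> y yP; rewrite lev_rev oppr_ge0 le0.
move=> /existsNP[zp /not_implyP[pP /negP]]; rewrite -ltNge => lp.
by have [? ?] := nonzero_interior kc Pl dP hg dim nz B mP pP lm lp; split=> //; left.
Qed.

Lemma retraction_alternatives : alternatives.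
Proof.
have [L [Lu LP]] := latpts_finite Pl.
have [p0 [p1 [p2 [P0 P1 P2 ind]]]] := three_points Pl dP.
have dim := im_dim h1 P0 P1 P2 ind.
have [p [q [pP qP pq]]] := indep_pair kc hh dim.
have [nz|/existsNP[z0 /not_implyP[z0P /negP/negPn/eqP iz0]]] :=
  pselect (forall z, latpts P z -> img z != 0).
  have [x [w [N B]]] := line_base_exists kc Pl hg hh h1 Lu LP nz pP qP pq.
  exact: nonzero_alternatives B.
have [x [w [N [B ge0 off]]]] := zero_image_line Pl LP pP qP pq z0P iz0.
exact: zero_alternatives dim LP B ge0 off.
Qed.

End Dichotomy.

Theorem theorem8p1 (k : closedFieldType) (R : realType)
    (P : set 'rV[R]_2)
    (P_lattice : lattice_polytope P) (P_dim : has_dim P 2)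
    (h : {lrmorphism kalg k P -> kalg k P})
    (h_retr : retraction h) (h_codim : codim h 1) :
  based h /\
  ((exists tau, torus tau /\ factors_through_fibration (conj_by tau h)) \/
   (exists eps, elem_group eps /\ factors_through_facet (conj_by eps h))) /\
  tame h.
Proof.
have [hg hh] := h_retr.
have kc : alg_closed k by move=> p; have [r e] := closed_field_poly_normal p; exists r.
have [hB alt] := retraction_alternatives kc P_lattice P_dim hg hh h_codim.
split=> //; case: alt => [[tau [tT ft]]|[eps [eE eG fe]]]; split.
- by left; exists tau.
- split=> //; exists tau; split; [exact: (proj1 tT) | by right].
- by right; exists eps.
- by split=> //; exists eps; split=> //; left.
Qed.
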